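(* Every left-invariant sub-Riemannian Engel structure on a 4-dimensional Lie group is uniquely locally determined by the structure constants $T_1,\dots,T_6$ of its canonical left-invariant frame $\{X_1,X_2,X_3,X_4\}$ (two such structures with the same $T_1,\dots,T_6$ are locally isometric), and it belongs to at least one of the following families, i.e. its constants satisfy the listed restrictions and the structure equations of the canonical frame are $[X_1,X_2]=X_3$, $[X_1,X_3]=X_4$ together with the listed ones (brackets $[X_i,X_j]$, $i<j$, not listed are zero): I. $T_2=T_4=T_6=0$; $[X_1,X_4]=T_5X_2+T_3X_3+T_1X_4$. II. $T_4=T_5=T_6=0$; $[X_1,X_4]=T_3X_3+T_1X_4$, $[X_2,X_3]=T_2X_3$, $[X_2,X_4]=T_2X_4$. III. $T_1=T_2=T_5=0$; $[X_1,X_4]=T_3X_3$, $[X_2,X_3]=T_6X_1+T_4X_2$, $[X_2,X_4]=T_4X_3$, $[X_3,X_4]=-T_6T_3X_1-T_4T_3X_2+T_4X_4$. IV. $T_1=T_3=T_4=T_5=0$; $[X_2,X_3]=T_6X_1+T_2X_3$, $[X_2,X_4]=T_2X_4$. V. $T_1\neq0$, $T_4=\frac12\frac{T_2(T_1^2+4T_3)}{T_1}$, $T_5=-\frac18T_1^3-\frac12T_1T_3$, $T_6=-\frac{T_2^2(T_1^2+4T_3)}{T_1^2}$; $$\begin{aligned} [X_1,X_4]&=T_1X_4-\tfrac{T_1^3+8T_5}{4T_1}X_3+T_5X_2-\tfrac{2T_2T_5}{T_1}X_1,\\ [X_2,X_3]&=T_2X_3-\tfrac{4T_2T_5}{T_1^2}X_2+\tfrac{8T_2^2T_5}{T_1^3}X_1,\\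 [X_2,X_4]&=T_2X_4-\tfrac{4T_2T_5}{T_1^2}X_3,\\ [X_3,X_4]&=\tfrac{2T_2T_5}{T_1}\left(X_3-\tfrac{2}{T_1}X_4-\tfrac{4T_5}{T_1^2}X_2+\tfrac{8T_2T_5}{T_1^3}X_1\right). \end{aligned}$$
   Context: A sub-Riemannian Engel structure $(M,\mathcal{D},g)$ is a smooth 4-dimensional manifold $M$ with a smooth rank-2 distribution $\mathcal{D}$ such that $[\mathcal{D},\mathcal{D}]$ has rank 3 and $[\mathcal{D},[\mathcal{D},\mathcal{D}]]$ has rank 4, together with a positive-definite metric $g$ on $\mathcal{D}$. It is left-invariant if $M$ is a Lie group and $\mathcal{D}$, $g$ are invariant under left translations. Canonical frame: a frame $\{X_1,X_2,X_3,X_4\}$ such that $X_1,X_2$ is a $g$-orthonormal frame of $\mathcal{D}$, $X_3=[X_1,X_2]$, $X_4=[X_1,X_3]$, and $[X_2,X_3]\in\mathrm{span}\{X_1,X_2,X_3\}$. It is unique up to the sign changes $X_1\mapsto -X_1$ and $X_2\mapsto -X_2$ (with the induced changes of $X_3,X_4$), and is unique once orientations of $M$ and of $\mathcal{D}$ are fixed and required to be compatible with $\{X_1,\dots,X_4\}$ and $\{X_1,X_2\}$. For a left-invariant structure it is left-invariant. Writing $[X_i,X_j]^k$ for the $X_k$-component of $[X_i,X_j]$: $T_1=[X_1,X_4]^4$, $T_2=[X_2,X_3]^3$, $T_3=[X_1,X_4]^3$, $T_4=[X_2,X_3]^2$, $T_5=[X_1,X_4]^2$, $T_6=[X_2,X_3]^1$;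 in the left-invariant case these are real constants. Locally isometric means: related near any pair of points by a local diffeomorphism preserving $\mathcal{D}$ and $g$. *)

(* Defs.v *)
From HB Require Import structures.
From mathcomp Require Import all_boot all_order all_algebra.
From mathcomp Require Import all_classical all_reals all_analysis.

Set Implicit Arguments.
Unset Strict Implicit.
Unset Printing Implicit Defensive.

Import Order.TTheory GRing.Theory Num.Theory.
Import numFieldNormedType.Exports.

Local Open Scope classical_set_scope.
Local Open Scope ring_scope.

(* C^k and C^oo maps between finite-dimensional normed spaces, on an open set
   U: all iterated directional derivatives exist and are continuous on U. *)
Fixpoint Ck (R : realType) (V W : normedModType R) (k : nat) (U : set V)
    (f : V -> W) : Prop :=
  (forall x, U x -> {for x, continuous f}) /\
  (if k is k'.+1 then
     forall v : V,
       (forall x, U x -> derivable f x v) /\ Ck k' U (fun x => 'D_v f x)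
   else True).

Definition smooth_on (R : realType) (V W : normedModType R) (U : set V)
    (f : V -> W) : Prop :=
  forall k, Ck k U f.

Definition smooth_near (R : realType) (V W : normedModType R) (x : V)
    (f : V -> W) : Prop :=
  exists U : set V, [/\ open U, U x & smooth_on U f].

(* The functions are total; a chart is only meaningful on cdom c, and its
   inverse only on the image of cdom c. *)
Record chart (R : realType) (M : topologicalType) := Chart {
  cdom : set M;
  cfun : M -> 'rV[R]_4;
  cinv : 'rV[R]_4 -> M;
  cdom_open : open cdom;
  cimg_open : open (cfun @` cdom);
  cfunK : forall p, cdom p -> cinv (cfun p) = p;
  cfun_continuous : forall p, cdom p -> {for p, continuous cfun};
  cinv_continuous : forall x, (cfun @` cdom) x -> {for x, continuous cinv}
}.

HB.mixin Record isManifold4 (R : realType) M of Topological M := {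
  atlas : set (chart R M);
  atlas_cover : forall p : M, exists2 c, atlas c & cdom c p;
  atlas_compat : forall c d, atlas c -> atlas d ->
    smooth_on (cfun c @` (cdom c `&` cdom d)) (cfun d \o cinv c);
  manifold_hausdorff : hausdorff_space M;
  manifold_second_countable : @second_countable M
}.

#[short(type="manifold4Type")]
HB.structure Definition Manifold4 (R : realType) :=
  {M of Topological M & isManifold4 R M}.

Definition chart_at (R : realType) (M : manifold4Type R) (p : M)
    (c : chart R M) : Prop :=
  atlas c /\ cdom c p.

Definition smooth_fun_at (R : realType) (M : manifold4Type R) (p : M)
    (f : M -> R) : Prop :=
  forall c : chart R M, chart_at p c -> smooth_near (cfun c p) (f \o cinv c).

Definition smooth_map_at (R : realType) (M N : manifold4Type R) (p : M)
    (F : M -> N) : Prop :=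
  {for p, continuous F} /\
  forall (c : chart R M) (d : chart R N), chart_at p c -> chart_at (F p) d ->
    smooth_near (cfun c p) (cfun d \o F \o cinv c).

Definition smooth_map2_at (R : realType) (M N P : manifold4Type R)
    (p : M) (q : N) (F : M -> N -> P) : Prop :=
  {for (p, q), continuous (fun z : M * N => F z.1 z.2)} /\
  forall (c : chart R M) (d : chart R N) (e : chart R P),
    chart_at p c -> chart_at q d -> chart_at (F p q) e ->
    smooth_near (cfun c p, cfun d q)
      (fun z : 'rV[R]_4 * 'rV[R]_4 => cfun e (F (cinv c z.1) (cinv d z.2))).

HB.mixin Record isLieGroup4 (R : realType) G of Manifold4 R G & Group G := {
  mulg_smooth : forall p q : G, smooth_map2_at p q (fun x y : G => (x * y)%g);
  invg_smooth : forall p : G, smooth_map_at p (fun x : G => (x^-1)%g)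
}.

#[short(type="lieGroup4Type")]
HB.structure Definition LieGroup4 (R : realType) :=
  {G of Manifold4 R G & Group G & isLieGroup4 R G}.

Section LinearAlgebra.
Context {R : realType} {V : lmodType R}.

Definition lspan (S : set V) : set V :=
  [set v | exists n (a : 'I_n -> R) (E : 'I_n -> V),
     (forall i, S (E i)) /\ v = \sum_i a i *: E i].

Definition is_basis n (E : 'I_n -> V) (S : set V) : Prop :=
  (forall a : 'I_n -> R, \sum_i a i *: E i = 0 -> forall i, a i = 0) /\
  S = [set v | exists a : 'I_n -> R, v = \sum_i a i *: E i].

Definition has_dim n (S : set V) : Prop := exists E : 'I_n -> V, is_basis E S.

End LinearAlgebra.

(* A tangent vector at p is an operator on functions smooth near p. Functions
   are total, so it is normalized by the value 0 on all the others; then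
   equality of tangent vectors is Leibniz equality, and they form a linear
   subspace of the space of all operators. *)
Notation operator R M := ((M -> R) -> R).
Notation vfield R M := (M -> operator R M).

Section Geometry.
Context {R : realType} {M : manifold4Type R}.

Definition at_germs (p : M) (v : operator R M) : operator R M :=
  fun f => if `[< smooth_fun_at p f >] then v f else 0.

(* The directional derivatives at p, read in a chart. *)
Definition tangent (p : M) : set (operator R M) :=
  [set v | exists (c : chart R M) (xi : 'rV[R]_4), chart_at p c /\
     v = at_germs p (fun f => 'D_xi (f \o cinv c : 'rV[R]_4 -> R) (cfun c p))].

Definition smooth_vfield_at (p : M) (X : vfield R M) : Prop :=
  tangent p (X p) /\
  forall f, smooth_fun_at p f -> smooth_fun_at p (fun q => X q f).

Definition lie_bracket (X Y : vfield R M) : vfield R M :=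
  fun p => at_germs p (fun f => X p (fun q => Y q f) - Y p (fun q => X q f)).

(* X is a smooth section of the family of subspaces D on a neighbourhood
   of p. *)
Definition local_section (D : M -> set (operator R M)) (p : M)
    (X : vfield R M) : Prop :=
  \forall q \near p, smooth_vfield_at q X /\ D q (X q).

Definition is_distribution (r : nat) (D : M -> set (operator R M)) : Prop :=
  forall p : M, exists E : 'I_r -> vfield R M,
    \forall q \near p, (forall i, smooth_vfield_at q (E i)) /\
                       is_basis (fun i => E i q) (D q).

(* The family [D, D'] of spaces spanned by the brackets of local sections. No
   lower-order terms are added: [X, f Y] = f [X, Y] + (X f) Y, so that [D, D']
   already contains the values of local sections of D' if D is a distribution
   of positive rank. *)
Definition bracket_family (D D' : M -> set (operator R M)) (p : M)
    : set (operator R M) :=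
  lspan [set v | exists X Y, [/\ local_section D p X, local_section D' p Y
                              & v = lie_bracket X Y p]].

Definition subriemannian_metric (D : M -> set (operator R M))
    (g : M -> operator R M -> operator R M -> R) : Prop :=
  [/\ forall p u v, D p u -> D p v -> g p u v = g p v u,
      forall p (a : R) u v w, D p u -> D p v -> D p w ->
        g p (a *: u + v) w = a * g p u w + g p v w,
      forall p v, D p v -> v != 0 -> 0 < g p v v
    & forall p X Y, local_section D p X -> local_section D p Y ->
        smooth_fun_at p (fun q => g q (X q) (Y q))].

End Geometry.

(* The values of engel_metric outside engel_dist are irrelevant. *)
Record engel_structure (R : realType) (M : manifold4Type R) :=
    EngelStructure {
  engel_dist : M -> set (operator R M);
  engel_metric : M -> operator R M -> operator R M -> R;
  edist_rank2 : is_distribution 2 engel_dist;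
  ederived_rank3 : forall p, has_dim 3 (bracket_family engel_dist engel_dist p);
  ederived_rank4 : forall p,
    has_dim 4 (bracket_family engel_dist (bracket_family engel_dist engel_dist) p);
  emetricP : subriemannian_metric engel_dist engel_metric
}.

Section LocalIsometry.
Context {R : realType} {M N : manifold4Type R}.

Definition tangent_map (F : M -> N) (p : M) (v : operator R M)
    : operator R N :=
  at_germs (F p) (fun f => v (f \o F)).

Definition isometry_at (S : engel_structure M) (S' : engel_structure N)
    (F : M -> N) (p : M) : Prop :=
  engel_dist S' (F p) = tangent_map F p @` engel_dist S p /\
  forall v w, engel_dist S p v -> engel_dist S p w ->
    engel_metric S' (F p) (tangent_map F p v) (tangent_map F p w)
      = engel_metric S p v w.

Definition locally_isometric (S : engel_structure M) (S' : engel_structure N)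
    : Prop :=
  forall (p : M) (q : N),
    exists (U : set M) (V : set N) (F : M -> N) (F' : N -> M),
      [/\ [/\ open U, U p, open V, V q & F p = q],
          [/\ F @` U = V, forall x, U x -> F' (F x) = x,
              forall x, U x -> smooth_map_at x F
            & forall y, V y -> smooth_map_at y F']
        & forall x, U x -> isometry_at S S' F x].

End LocalIsometry.

Definition i1 : 'I_4 := @Ordinal 4 0 isT.
Definition i2 : 'I_4 := @Ordinal 4 1 isT.
Definition i3 : 'I_4 := @Ordinal 4 2 isT.
Definition i4 : 'I_4 := @Ordinal 4 3 isT.

Section CanonicalFrame.
Context {R : realType} {M : manifold4Type R}.
Implicit Type X : 'I_4 -> vfield R M.

Definition canonical_frame (S : engel_structure M) X : Prop :=
  [/\ forall p, (forall i, smooth_vfield_at p (X i)) /\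
                is_basis (fun i => X i p) (tangent p),
      forall p,
        [/\ engel_dist S p = lspan [set X i1 p; X i2 p],
            engel_metric S p (X i1 p) (X i1 p) = 1,
            engel_metric S p (X i2 p) (X i2 p) = 1
          & engel_metric S p (X i1 p) (X i2 p) = 0],
      X i3 = lie_bracket (X i1) (X i2),
      X i4 = lie_bracket (X i1) (X i3)
    & forall p, lspan [set X i1 p; X i2 p; X i3 p]
                     (lie_bracket (X i2) (X i3) p)].

(* [X_i, X_j]^k at p *)
Definition bracket_coef X (i j k : 'I_4) (p : M) : R :=
  (get [set a : 'rV[R]_4 |
        lie_bracket (X i) (X j) p = \sum_(l < 4) a 0 l *: X l p]) 0 k.

Definition structure_constants X (T1 T2 T3 T4 T5 T6 : R) : Prop :=
  forall p,
    [/\ bracket_coef X i1 i4 i4 p = T1, bracket_coef X i2 i3 i3 p = T2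
      & bracket_coef X i1 i4 i3 p = T3] /\
    [/\ bracket_coef X i2 i3 i2 p = T4, bracket_coef X i1 i4 i2 p = T5
      & bracket_coef X i2 i3 i1 p = T6].

Definition structure_equations X (B14 B23 B24 B34 : vfield R M) : Prop :=
  [/\ lie_bracket (X i1) (X i2) = X i3, lie_bracket (X i1) (X i3) = X i4
    & [/\ lie_bracket (X i1) (X i4) = B14, lie_bracket (X i2) (X i3) = B23,
          lie_bracket (X i2) (X i4) = B24 & lie_bracket (X i3) (X i4) = B34]].

Definition family_I X (T1 T2 T3 T4 T5 T6 : R) : Prop :=
  [/\ T2 = 0, T4 = 0, T6 = 0 &
   structure_equations X
     (T5 *: X i2 + T3 *: X i3 + T1 *: X i4)
     0
     0
     0].

Definition family_II X (T1 T2 T3 T4 T5 T6 : R) : Prop :=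
  [/\ T4 = 0, T5 = 0, T6 = 0 &
   structure_equations X
     (T3 *: X i3 + T1 *: X i4)
     (T2 *: X i3)
     (T2 *: X i4)
     0].

Definition family_III X (T1 T2 T3 T4 T5 T6 : R) : Prop :=
  [/\ T1 = 0, T2 = 0, T5 = 0 &
   structure_equations X
     (T3 *: X i3)
     (T6 *: X i1 + T4 *: X i2)
     (T4 *: X i3)
     (- (T6 * T3) *: X i1 - (T4 * T3) *: X i2 + T4 *: X i4)].

Definition family_IV X (T1 T2 T3 T4 T5 T6 : R) : Prop :=
  [/\ T1 = 0, T3 = 0, T4 = 0, T5 = 0 &
   structure_equations X
     0
     (T6 *: X i1 + T2 *: X i3)
     (T2 *: X i4)
     0].

Definition family_V X (T1 T2 T3 T4 T5 T6 : R) : Prop :=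
  [/\ T1 != 0,
      T4 = 2^-1 * (T2 * (T1 ^+ 2 + 4 * T3) / T1),
      T5 = - (8^-1 * T1 ^+ 3) - 2^-1 * (T1 * T3),
      T6 = - (T2 ^+ 2 * (T1 ^+ 2 + 4 * T3) / T1 ^+ 2) &
   structure_equations X
     (T1 *: X i4 - ((T1 ^+ 3 + 8 * T5) / (4 * T1)) *: X i3 + T5 *: X i2
        - (2 * T2 * T5 / T1) *: X i1)
     (T2 *: X i3 - (4 * T2 * T5 / T1 ^+ 2) *: X i2
        + (8 * T2 ^+ 2 * T5 / T1 ^+ 3) *: X i1)
     (T2 *: X i4 - (4 * T2 * T5 / T1 ^+ 2) *: X i3)
     ((2 * T2 * T5 / T1) *:
        (X i3 - (2 / T1) *: X i4 - (4 * T5 / T1 ^+ 2) *: X i2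
         + (8 * T2 * T5 / T1 ^+ 3) *: X i1))].

End CanonicalFrame.

Section LeftInvariance.
Context {R : realType} {G : lieGroup4Type R}.

Definition left_translation (a : G) : G -> G := fun x => (a * x)%g.

Definition left_invariant (S : engel_structure G) : Prop :=
  forall a p : G, isometry_at S S (left_translation a) p.

Definition left_invariant_frame (X : 'I_4 -> vfield R G) : Prop :=
  forall i (a p : G),
    X i (left_translation a p) = tangent_map (left_translation a) p (X i p).

End LeftInvariance.

(* Main.v *)
(* Left-invariant fields form a frame with constant structure coefficients, so the
   Jacobi identity turns into polynomial equations between them.

   Existence: D is spanned by left-invariant fields. If w1, w2 is an orthonormal
   basis of it and w3 = [w1, w2], the rank conditions say that span(w1, w2, w3) is
   a hyperplane which does not contain both [w1, w3] and [w2, w3]; rotating w1, w2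
   puts [X2, X3] in the hyperplane.

   Families: the Jacobi identities for (1,2,3) and (1,2,4) determine [X2, X4] and
   [X3, X4]; those for (1,3,4) and (2,3,4) give [X1, X4]^1 = T1 T4 / 2 and the
   equations whose solutions are the five families. In particular T1, ..., T6
   determine all structure constants.

   Local isometry: let gamma_j be the integral curve of X_j through 1 and
   phi(t) = p gamma_1(t_1) ... gamma_4(t_4), a local diffeomorphism. In the frame
   X the differential of phi has components given by Ad(gamma_j(t_j)), and these
   solve linear ODEs whose coefficients are structure constants. Hence they agree
   for two groups with the same constants, and phi' o phi^-1 maps X to X', where
   phi' is the parametrization of the second group. *)
Require Import Defs.
From HB Require Import structures.
From mathcomp Require Import all_boot all_order all_algebra.
From mathcomp Require Import all_classical all_reals all_analysis.
From mathcomp Require Import ring lra.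

Set Implicit Arguments.
Unset Strict Implicit.
Unset Printing Implicit Defensive.

Import Order.TTheory GRing.Theory Num.Theory.
Import numFieldNormedType.Exports.

Local Open Scope classical_set_scope.
Local Open Scope ring_scope.

(** [Ck] speaks only of iterated directional derivatives, so the calculus is rebuilt from the mean
    value theorem in one variable: additivity in the direction, symmetry of second derivatives,
    chain rule, inverse functions, integral curves. Two obstacles shape the rest. The rank
    conditions concern brackets of arbitrary local sections, not only of left-invariant ones. They
    reduce to linear algebra because coefficients that stay in a fixed subspace have their
    derivatives in it too. The local isometry is built without integrating an isomorphism of Lie
    algebras and without smooth dependence of flows on initial points: [phi] is smooth because the
    group law and four single curves are. Its differential involves only products of Ad along these
    curves, so uniqueness for a linear ODE on a small interval is enough. Since [Ad] is obtained by
    choice, its differentiability along a curve has to be extracted first, from the smoothness of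
    the group law. *)

Local Notation ev j := (delta_mx (0 : 'I_1) j).

(** * Calculus of C^k maps *)

Section DirectionalMVT.
Context {R : realType} {V : normedModType R}.
Implicit Types (g : V -> R) (x h u v : V).

Lemma is_derive_line (W : normedModType R) (g : V -> W) x h (s : R) :
  derivable g (x + s *: h) h ->
  is_derive s (1 : R) (fun r : R => g (x + r *: h)) ('D_h g (x + s *: h)).
Proof.
have E : (fun k : R => k^-1 *: (((fun r : R => g (x + r *: h)) \o shift s) (k *: (1 : R))
      - g (x + s *: h))) =
   (fun k : R => k^-1 *: ((g \o shift (x + s *: h)) (k *: h) - g (x + s *: h))).
  apply/funext => k /=; congr (_ *: (g _ - _)).
  by rewrite [k *: 1]mulr1 scalerDl addrCA.
by move=> dg; split; rewrite /derivable /derive E.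
Qed.

Lemma is_derive_translate (W : normedModType R) (g : V -> W) x a v :
  derivable g (x + a) v ->
  is_derive x v (fun y => g (y + a)) ('D_v g (x + a)).
Proof.
have E : (fun k : R => k^-1 *: (((fun y => g (y + a)) \o shift x) (k *: v)
      - g (x + a))) =
   (fun k : R => k^-1 *: ((g \o shift (x + a)) (k *: v) - g (x + a))).
  by apply/funext => k /=; rewrite addrA.
by move=> dg; split; rewrite /derivable /derive E.
Qed.

(** Derivability along [v] alone suffices: on the line through [x] the claim is linearity of a
    differential in one variable, and [t = 0] is included. *)
Lemma is_derive_scale (W : normedModType R) (g : V -> W) x v (t : R) :
  derivable g x v -> is_derive x (t *: v) g (t *: 'D_v g x).
Proof.
move=> dg; have := @is_derive_line W g x v 0.
rewrite scale0r addr0 => /(_ dg) [df Df].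
have dff : differentiable (fun r : R => g (x + r *: v)) (0 : R).
  exact/derivable1_diffP.
have E : (fun k : R => k^-1 *: (((fun r : R => g (x + r *: v)) \o shift 0) (k *: t)
      - g (x + 0 *: v))) =
   (fun k : R => k^-1 *: ((g \o shift x) (k *: (t *: v)) - g x)).
  apply/funext => k /=; rewrite scale0r !addr0; congr (_ *: (g _ - _)).
  by rewrite scalerA addrC.
have := diff_derivable (v := t) dff; have := deriveE t dff.
rewrite /derivable /derive E => D1 D2; split => //.
rewrite [LHS]D1 -[X in _ = _ *: X]Df deriveE // -linearZ /=.
by rewrite [t *: _]mulr1.
Qed.

(** The intermediate parameter is sought in [0, 1] rather than between 0 and [t], so [t] may have
    any sign. *)
Lemma mvt_dir g x v (t : R) :
  (forall s : R, 0 <= s <= 1 -> derivable g (x + (s * t) *: v) v) ->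
  exists2 s : R, 0 < s < 1 & g (x + t *: v) - g x = t * 'D_v g (x + (s * t) *: v).
Proof.
move=> dg.
pose f := fun r : R => g (x + r *: (t *: v)).
pose df := fun s : R => t * 'D_v g (x + (s * t) *: v).
have D (s : R) : s \in `[0, 1] -> is_derive s (1 : R) f (df s).
  rewrite in_itv /= => s01; have [d1 d2] := is_derive_scale t (dg _ s01).
  rewrite /f /df -[t * _]d2 -scalerA; apply: is_derive_line.
  by rewrite scalerA.
have M1 (s : R) : s \in `]0, 1[ -> is_derive s (1 : R) f (df s).
  by move=> s01; apply: D; exact: subset_itv_oo_cc.
have M2 : {within `[0, 1], continuous f}.
  apply: derivable_within_continuous => s s01.
  by have [] := D s s01.
have [s s01] := @MVT R f df 0 1 ltr01 M1 M2.
rewrite /f /df scale1r scale0r addr0 subr0 mulr1 => ->.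
by exists s => //; move: s01; rewrite in_itv.
Qed.

Lemma Ck_cont (W : normedModType R) k U (f : V -> W) x :
  Ck k U f -> U x -> {for x, continuous f}.
Proof. by case: k => [|k] [+ _]; apply. Qed.

Lemma Ck_derivable (W : normedModType R) k U (f : V -> W) x v :
  Ck k.+1 U f -> U x -> derivable f x v.
Proof. by move=> [_ /(_ v) [+ _]]; apply. Qed.

Lemma Ck_derive (W : normedModType R) k U (f : V -> W) v :
  Ck k.+1 U f -> Ck k U (fun x => 'D_v f x).
Proof. by move=> [_ /(_ v) []]. Qed.

Lemma near_line (U : set V) x : nbhs x U ->
  forall u, \forall t \near (0 : R), U (x + t *: u).
Proof.
move=> Ux u.
have : (fun t : R => x + t *: u) @ (0 : R) --> x + (0 : R) *: u.
  by apply: cvgD; [exact: cvg_cst|exact: scalel_continuous].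
by rewrite scale0r addr0; apply.
Qed.

Lemma near_2lines (U : set V) x : nbhs x U ->
  forall u v, exists2 d : R, 0 < d & forall s t : R, `|s| <= d -> `|t| <= d ->
  U (x + s *: u + t *: v).
Proof.
move=> /nbhs_normP [e /= e0 eU] u v.
(* The [+ 1] keeps the denominator positive when [u] and [v] vanish; the halving makes the final
   estimate strict. *)
exists (e / (`|u| + `|v| + 1) / 2).
  by rewrite !divr_gt0 // ltr_wpDl ?addr_ge0.
move=> s t sd td; apply: eU; rewrite /= -addrA opprD addrA subrr sub0r normrN.
set d := e / _ / 2 in sd td.
apply: (@le_lt_trans _ _ (d * (`|u| + `|v| + 1))).
  apply: le_trans (ler_normD _ _) _; rewrite !normrZ -addrA mulrDr.
  apply: lerD; first by rewrite ler_wpM2r.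
  apply: le_trans (_ : d * `|v| <= _); first by rewrite ler_wpM2r.
  rewrite ler_wpM2l ?lerDl // /d !divr_ge0 ?(ltW e0) // ltW // ltr_wpDl ?addr_ge0.
rewrite /d mulrAC divfK; last by rewrite gt_eqF // ltr_wpDl ?addr_ge0.
by rewrite ltr_pdivrMr // ltr_pMr // ltr1n.
Qed.

(** Existence of directional derivatives does not give additivity; continuity of ['D_v g] does. The
    quotient along [u + v] is cut at [x + h *: u], and the second piece, whose base point moves with
    [h], is a value of ['D_v g] near [x]. *)
Lemma derive_dirD U g x u v : open U -> U x -> Ck 1 U g ->
  'D_(u + v) g x = 'D_u g x + 'D_v g x.
Proof.
move=> oU Ux gU; apply: cvg_lim => //.
pose F1 (h : R) := h^-1 * (g (x + h *: u + h *: v) - g (x + h *: u)).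
pose F2 (h : R) := h^-1 *: ((g \o shift x) (h *: u) - g x).
have -> : (fun h : R => h^-1 *: ((g \o shift x) (h *: (u + v)) - g x)) = F2 + F1.
  apply/funext => h; rewrite /F1 /F2 [RHS]addrC /= -mulrDr; congr (_ * _).
  by rewrite scalerDr (addrC _ x) addrA (addrC _ x) subrKA.
apply: cvgD; first by have := Ck_derivable gU Ux; exact.
apply/cvgrPdist_le => e e0.
have cD : \forall y \near x, `|'D_v g x - 'D_v g y| <= e /\ U y.
  apply: filterI; last exact: open_nbhs_nbhs.
  by have /cvgrPdist_le := Ck_cont (Ck_derive v gU) Ux; exact.
have [d d0 dP] := near_2lines cD u v.
near=> h.
have hd : `|h| <= d by near: h; exact: dnbhs0_le.
have h0 : h != 0 by near: h; exact: nbhs_dnbhs_neq.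
have sd (s : R) : 0 <= s <= 1 -> `|s * h| <= d.
  move=> /andP[s0 s1]; rewrite normrM (ger0_norm s0) (le_trans _ hd) //.
  by rewrite ler_piMl.
have [s s01|s /andP[s0 s1]] := @mvt_dir g (x + h *: u) v h.
  by apply: Ck_derivable gU _; case: (dP h (s * h) hd (sd _ s01)).
rewrite /F1 => ->; rewrite mulKf //.
by have [] := dP h (s * h) hd _; rewrite ?sd ?(ltW s0) ?(ltW s1).
Unshelve. all: by end_near. Qed.

(** Two mean value steps, along [u] for the increment of [g] in direction [v] and then along [v] for
    ['D_u g], turn the quotient into a value of the second derivative near [x]. The quotient is
    symmetric in [u] and [v], which yields [derive_comm]. *)
Lemma second_difference U g x u v : open U -> U x -> Ck 2 U g ->
  (fun h : R => h^-1 ^+ 2 * (g (x + h *: u + h *: v) - g (x + h *: u)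
                - g (x + h *: v) + g x)) @ 0^' --> 'D_v ('D_u g) x.
Proof.
move=> oU Ux gU.
apply/cvgrPdist_le => e e0.
have cD : \forall y \near x, `|'D_v ('D_u g) x - 'D_v ('D_u g) y| <= e /\ U y.
  apply: filterI; last exact: open_nbhs_nbhs.
  by have /cvgrPdist_le := Ck_cont (Ck_derive v (Ck_derive u gU)) Ux; exact.
have [d d0 dP] := near_2lines cD u v.
near=> h.
have hd : `|h| <= d by near: h; exact: dnbhs0_le.
have h0 : h != 0 by near: h; exact: nbhs_dnbhs_neq.
have sd (s : R) : 0 <= s <= 1 -> `|s * h| <= d.
  move=> /andP[s0 s1]; rewrite normrM (ger0_norm s0) (le_trans _ hd) //.
  by rewrite ler_piMl.
have dgu y : U y -> derivable g y u by exact: Ck_derivable gU.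
pose f y := g (y + h *: v) - g y.
have df (y : V) : U (y + h *: v) -> U y ->
    is_derive y u f ('D_u g (y + h *: v) - 'D_u g y).
  move=> Uyv Uy.
  have := is_derive_translate (dgu _ Uyv).
  move=> d1; have d3 := derivableP (dgu _ Uy).
  exact: (@is_deriveB R V R (fun y => g (y + h *: v)) g y u _ _ d1 d3).
have Ul (s t : R) : 0 <= s <= 1 -> 0 <= t <= 1 -> U (x + (s * h) *: u + (t * h) *: v).
  by move=> s01 t01; case: (dP (s * h) (t * h) (sd _ s01) (sd _ t01)).
have le11 : 0 <= (1 : R) <= 1 by rewrite ler01 lexx.
have le01 : 0 <= (0 : R) <= 1 by rewrite ler01 lexx.
have [s s01|s /andP[s0 s1]] := @mvt_dir f x u h.
  have := Ul s 0 s01 le01; have := Ul s 1 s01 le11.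
  by rewrite mul1r mul0r scale0r addr0 => U1 U2; have [] := df _ U1 U2.
have s01 : 0 <= s <= 1 by rewrite !ltW.
have U1 : U (x + (s * h) *: u + h *: v) by have := Ul s 1 s01 le11; rewrite mul1r.
have U0 : U (x + (s * h) *: u).
  by have := Ul s 0 s01 le01; rewrite mul0r scale0r addr0.
have [_ ->] := df _ U1 U0.
have [t t01|t /andP[t0 t1]] := @mvt_dir ('D_u g) (x + (s * h) *: u) v h.
  by apply: Ck_derivable (Ck_derive u gU) _; exact: Ul.
move=> -> fE.
have -> : g (x + h *: u + h *: v) - g (x + h *: u) - g (x + h *: v) + g x =
  f (x + h *: u) - f x.
  by rewrite /f; ring.
rewrite fE; set D := ('D_v _ (_ + _)).
rewrite (_ : _ ^+ 2 * _ = D); last by field.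
by have [] := dP (s * h) (t * h) (sd _ s01) (sd _ _); rewrite // !ltW.
Unshelve. all: by end_near. Qed.

Lemma derive_comm U g x u v : open U -> U x -> Ck 2 U g ->
  'D_v ('D_u g) x = 'D_u ('D_v g) x.
Proof.
move=> oU Ux gU; have H1 := @second_difference U g x u v oU Ux gU.
have := @second_difference U g x v u oU Ux gU.
rewrite (_ : (fun h : R => _) = (fun h : R => h^-1 ^+ 2 * (g (x + h *: u + h *: v) - g (x + h *: u)
                - g (x + h *: v) + g x))); last first.
  apply/funext => h; congr (_ * (_ + _)).
  by rewrite addrAC (addrAC x).
by move=> H2; exact: cvg_unique H1 H2.
Qed.

End DirectionalMVT.

(** * Closure properties of C^k maps *)

Section CkTheory.
Context {R : realType} {V : normedModType R}.
Implicit Types (U : set V).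

Lemma Ck_ext (W : normedModType R) k U (f g : V -> W) :
  open U -> (forall x, U x -> f x = g x) -> Ck k U f -> Ck k U g.
Proof.
move=> oU; elim: k f g => [|k IH] f g fg [cf Df]; split.
1,3: move=> x Ux; rewrite /prop_for /continuous_at -(fg _ Ux);
  apply: cvg_trans (cf x Ux); apply: near_eq_cvg;
  by apply: filterS (open_nbhs_nbhs (conj oU Ux)) => y; exact: fg.
- by [].
- have nfg x : U x -> \near x, f x = g x.
    by move=> Ux; apply: filterS (open_nbhs_nbhs (conj oU Ux)) => y; exact: fg.
  move=> v; have [df Dfv] := Df v; split => [x Ux|].
    by apply: near_eq_derivable (df x Ux); exact: nfg.
  apply: IH Dfv => x Ux; apply: near_eq_derive; exact: nfg.
Qed.

(** Replaces the operator ['D_v] by an explicit formula valid on [U], to which an induction on [k]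
    can be applied. *)
Lemma CkS_intro (W : normedModType R) k U (f : V -> W) (df : V -> V -> W) :
  open U -> (forall x, U x -> {for x, continuous f}) ->
  (forall v x, U x -> is_derive x v f (df v x)) ->
  (forall v, Ck k U (df v)) -> Ck k.+1 U f.
Proof.
move=> oU cf Df Ckd; split => // v; split=> [x Ux|].
  by have [] := Df v x Ux.
by apply: Ck_ext (Ckd v) => // x Ux; have [_ ->] := Df v x Ux.
Qed.

Lemma Ck_pred (W : normedModType R) k U (f : V -> W) : Ck k.+1 U f -> Ck k U f.
Proof.
elim: k f => [|k IH] f [cf Df]; split => // v.
by have [d1 d2] := Df v; split => //; exact: IH.
Qed.

Lemma Ck_le (W : normedModType R) k l U (f : V -> W) :
  (l <= k)%N -> Ck k U f -> Ck l U f.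
Proof.
move=> /subnK <-; elim: (k - l)%N => // n IH.
by rewrite addSn => /Ck_pred.
Qed.

Lemma Ck_sub (W : normedModType R) k U U' (f : V -> W) :
  U' `<=` U -> Ck k U f -> Ck k U' f.
Proof.
move=> UU'; elim: k f => [|k IH] f [cf Df]; split => //.
- by move=> x /UU'; exact: cf.
- by move=> x /UU'; exact: cf.
by move=> v; have [d1 d2] := Df v; split => [x /UU'|]; [exact: d1|exact: IH].
Qed.

Lemma Ck_cst (W : normedModType R) k U (a : W) : open U -> Ck k U (fun _ : V => a).
Proof.
move=> oU; elim: k a => [|k IH] a; first by split => // x _; exact: cvg_cst.
apply: (@CkS_intro _ _ _ _ (fun _ _ => 0)) => //.
by move=> x _; exact: cvg_cst.
Qed.

Lemma Ck_id k U : open U -> Ck k U (fun x : V => x).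
Proof.
move=> oU; case: k => [|k]; first by split => // x _; exact: cvg_id.
apply: (@CkS_intro _ _ _ _ (fun v _ => v)) => //.
- by move=> x _; exact: cvg_id.
- by move=> v; exact: Ck_cst.
Qed.

Lemma CkD (W : normedModType R) k U (f g : V -> W) :
  open U -> Ck k U f -> Ck k U g -> Ck k U (fun x => f x + g x).
Proof.
move=> oU; elim: k f g => [|k IH] f g cf cg.
  by split => // x Ux; apply: cvgD; [exact: (Ck_cont cf)|exact: (Ck_cont cg)].
apply: (@CkS_intro _ _ _ _ (fun v x => 'D_v f x + 'D_v g x)) => //.
- by move=> x Ux; apply: cvgD; [exact: (Ck_cont cf)|exact: (Ck_cont cg)].
- move=> v x Ux; have d1 := derivableP (@Ck_derivable _ _ _ _ _ _ _ v cf Ux).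
  have d2 := derivableP (@Ck_derivable _ _ _ _ _ _ _ v cg Ux).
  exact: (@is_deriveD _ _ _ f g x v _ _ d1 d2).
- by move=> v; apply: IH; exact: Ck_derive.
Qed.

Lemma CkZ (W : normedModType R) k U (f : V -> W) (a : R) :
  open U -> Ck k U f -> Ck k U (fun x => a *: f x).
Proof.
move=> oU; elim: k f => [|k IH] f cf.
  by split => // x Ux; apply: cvgZl_tmp; exact: (Ck_cont cf).
apply: (@CkS_intro _ _ _ _ (fun v x => a *: 'D_v f x)) => //.
- by move=> x Ux; apply: cvgZl_tmp; exact: (Ck_cont cf).
- move=> v x Ux; have d1 := derivableP (@Ck_derivable _ _ _ _ _ _ _ v cf Ux).
  exact: (@is_deriveZ _ _ _ f a x v _ d1).
- by move=> v; apply: IH; exact: Ck_derive.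
Qed.

Lemma CkM k U (f g : V -> R) :
  open U -> Ck k U f -> Ck k U g -> Ck k U (fun x => f x * g x).
Proof.
move=> oU; elim: k f g => [|k IH] f g cf cg.
  by split => // x Ux; apply: cvgM; [exact: (Ck_cont cf)|exact: (Ck_cont cg)].
apply: (@CkS_intro _ _ _ _ (fun v x => f x * 'D_v g x + g x * 'D_v f x)) => //.
- by move=> x Ux; apply: cvgM; [exact: (Ck_cont cf)|exact: (Ck_cont cg)].
- move=> v x Ux; have d1 := derivableP (@Ck_derivable _ _ _ _ _ _ _ v cf Ux).
  have d2 := derivableP (@Ck_derivable _ _ _ _ _ _ _ v cg Ux).
  exact: (@is_deriveM _ _ f g x v _ _ d1 d2).
- move=> v; apply: CkD => //; apply: IH.
  + exact: Ck_pred.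
  + exact: Ck_derive.
  + exact: Ck_pred.
  + exact: Ck_derive.
Qed.

Lemma CkV k U (f : V -> R) :
  open U -> (forall x, U x -> f x != 0) -> Ck k U f -> Ck k U (fun x => (f x)^-1).
Proof.
move=> oU f0; elim: k f f0 => [|k IH] f f0 cf.
  by split => // x Ux; apply: continuousV; [exact: f0|exact: (Ck_cont cf)].
apply: (@CkS_intro _ _ _ _ (fun v x => (-1) *: (((f x)^-1 * (f x)^-1) * 'D_v f x))) => //.
- by move=> x Ux; apply: continuousV; [exact: f0|exact: (Ck_cont cf)].
- move=> v x Ux; have d1 := @Ck_derivable _ _ _ _ _ _ _ v cf Ux.
  split; first exact: derivableV (f0 _ Ux) d1.
  rewrite deriveV ?f0 // -[LHS]/(_ * _) -[RHS]/(_ * _).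
  by field; exact: f0.
- move=> v; have cV := IH _ f0 (Ck_pred cf).
  by apply: CkZ => //; apply: CkM => //; [exact: CkM|exact: Ck_derive].
Qed.

Lemma Ck_sum (W : normedModType R) k U I (r : seq I) (P : pred I) (f : I -> V -> W) :
  open U -> (forall i, Ck k U (f i)) -> Ck k U (fun x => \sum_(i <- r | P i) f i x).
Proof.
move=> oU cf; elim: r => [|i r IH].
  by under eq_fun do rewrite big_nil; exact: Ck_cst.
under eq_fun do rewrite big_cons.
by case: (P i) => //; exact: CkD.
Qed.

Lemma Ck_prod k U I (r : seq I) (P : pred I) (f : I -> V -> R) :
  open U -> (forall i, Ck k U (f i)) -> Ck k U (fun x => \prod_(i <- r | P i) f i x).
Proof.
move=> oU cf; elim: r => [|i r IH].
  by under eq_fun do rewrite big_nil; exact: Ck_cst.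
under eq_fun do rewrite big_cons.
by case: (P i) => //; exact: CkM.
Qed.

Lemma continuous_mxP m n (f : V -> 'M[R]_(m, n)) x :
  {for x, continuous f} <-> forall i j, {for x, continuous (fun y => f y i j)}.
Proof.
split=> [cf i j|cf].
  apply: (@continuous_comp _ _ _ f (fun M : 'M[R]_(m, n) => M i j)) => //.
  exact: coord_continuous.
apply/cvgrPdist_le => e e0; near=> y.
rewrite /Num.Def.normr/= mx_normrE (bigmax_le _ (ltW e0))//= => i _.
rewrite !mxE/=.
move: i; near: y; apply: filter_forall => /= i.
exact: ((cvgrPdist_le _ _).1 (cf i.1 i.2)).
Unshelve. all: by end_near. Qed.

Lemma Ck_mxP m n k U (f : V -> 'M[R]_(m, n)) : open U ->
  Ck k U f <-> forall i j, Ck k U (fun x => f x i j).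
Proof.
move=> oU; elim: k f => [|k IH] f; split.
- by move=> cf i j; split=> // x Ux; move: i j; apply/continuous_mxP/(Ck_cont cf).
- by move=> cf; split=> // x Ux; apply/continuous_mxP => i j; apply: (Ck_cont (cf i j)).
- move=> cf i j; apply: (@CkS_intro _ _ _ _ (fun v x => 'D_v f x i j)) => //.
  + by move=> x Ux; move: i j; apply/continuous_mxP/(Ck_cont cf).
  + move=> v x Ux; have d1 := @Ck_derivable _ _ _ _ _ _ _ v cf Ux.
    split; last by rewrite derive_mx // mxE.
    by move: i j; apply/derivable_mxP.
  + by move=> v; move: i j; apply/IH; exact: Ck_derive.
- move=> cf; split=> [x Ux|v].
    by apply/continuous_mxP => i j; exact: (Ck_cont (cf i j)).
  have d1 x : U x -> derivable f x v.
    by move=> Ux; apply/derivable_mxP => i j; exact: (Ck_derivable (cf i j)).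
  split => //; apply/IH => i j.
  apply: Ck_ext (Ck_derive v (cf i j)) => // x Ux.
  by rewrite derive_mx ?mxE //; exact: d1.
Qed.

End CkTheory.

(** * Differentiability of C^1 maps and the chain rule *)

Section Chain.
Context {R : realType}.

Lemma mx_norm_coord m n (M : 'M[R]_(m, n)) i j : `|M i j| <= `|M|.
Proof.
rewrite [leRHS]/Num.Def.normr /= mx_normrE.
exact: (le_bigmax _ (fun ij : 'I_m * 'I_n => `|M ij.1 ij.2|) (i, j)).
Qed.

Lemma mx_norm_le m n (M : 'M[R]_(m, n)) (e : R) :
  0 <= e -> (forall i j, `|M i j| <= e) -> `|M| <= e.
Proof.
by move=> e0 Me; rewrite /Num.Def.normr /= mx_normrE (bigmax_le _ e0).
Qed.

Lemma derive_dir_sum n U (g : 'rV[R]_n -> R) x h : open U -> U x -> Ck 1 U g ->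
  'D_h g x = \sum_j h 0 j * 'D_(ev j) g x.
Proof.
move=> oU Ux gU; rewrite {1}(row_sum_delta h).
rewrite (big_morph (fun v => 'D_v g x) (fun u v => @derive_dirD _ _ _ _ _ u v oU Ux gU)
  (derive0 g x)).
apply: eq_bigr => j _.
have d1 := @Ck_derivable _ _ _ _ _ _ _ (ev j) gU Ux.
by have [_ ->] := is_derive_scale (h 0 j) d1.
Qed.

(** Differentiability in epsilon form. The mean value theorem along [h] turns the increment into a
    derivative at a nearby point, where the partial derivatives have hardly changed. *)
Lemma C1_approx n U (g : 'rV[R]_n -> R) x (e : R) : open U -> U x -> Ck 1 U g ->
  0 < e -> \forall h \near (0 : 'rV[R]_n),
  `|g (h + x) - (g x + \sum_j h 0 j * 'D_(ev j) g x)| <= e * `|h|.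
Proof.
move=> oU Ux gU e0.
(* There are [n] coordinate errors, each at most this times the norm of [h]; the successor covers
   [n = 0]. *)
have e1 : 0 < e / n.+1%:R by rewrite divr_gt0.
have cD1 : \forall y \near x, forall j : 'I_n,
    `|'D_(ev j) g x - 'D_(ev j) g y| <= e / n.+1%:R.
  near=> y; move=> j; move: j; near: y; apply: filter_forall => j.
  by have /cvgrPdist_le := Ck_cont (Ck_derive (ev j) gU) Ux; exact.
have cD : \forall y \near x, U y /\ forall j : 'I_n,
    `|'D_(ev j) g x - 'D_(ev j) g y| <= e / n.+1%:R.
  by apply: filterI cD1; exact: open_nbhs_nbhs.
have /nbhs_normP [d /= d0 dP] := cD.
near=> h.
have hd : `|h| < d.
  by near: h; exact: (@nbhs0_lt R 'rV[R]_n d d0).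
have Us (s : R) : 0 <= s <= 1 -> ball_ Num.norm x d (x + (s * 1) *: h).
  move=> /andP[s0 s1]; rewrite /= opprD addrA subrr sub0r normrN mulr1 normrZ.
  by rewrite (ger0_norm s0) (le_lt_trans _ hd) // ler_piMl.
have [s s01|s /andP[s0 s1]] := @mvt_dir _ _ g x h 1.
  by apply: (Ck_derivable gU); case: (dP _ (Us _ s01)).
rewrite scale1r mul1r (addrC h x) opprD addrA => ->.
have s01 : 0 <= s <= 1 by rewrite !ltW.
have [Us1 ds] := dP _ (Us s s01).
rewrite (derive_dir_sum h oU Us1 gU) /= -sumrB.
apply: le_trans (ler_norm_sum _ _ _) _.
apply: (@le_trans _ _ (\sum_(j < n) `|h| * (e / n.+1%:R))).
  apply: ler_sum => j _; rewrite -mulrBr normrM ler_pM // ?mx_norm_coord //.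
  by rewrite distrC; exact: ds.
rewrite sumr_const card_ord -[_ *+ n]mulr_natr.
have -> : `|h| * (e / n.+1%:R) * n%:R = (e * `|h|) * (n%:R / n.+1%:R).
  by rewrite mulrCA -!mulrA (mulrC n%:R).
by rewrite ler_piMr ?mulr_ge0 ?(ltW e0) // ler_pdivrMr // mul1r ler_nat.
Unshelve. all: by end_near. Qed.

Lemma C1_differentiable n U (g : 'rV[R]_n -> R) x : open U -> U x -> Ck 1 U g ->
  differentiable g x.
Proof.
move=> oU Ux gU.
pose L (h : 'rV[R]_n) : R := \sum_j h 0 j * 'D_(ev j) g x.
have linL : linear L.
  move=> a u v; rewrite /L scaler_sumr -big_split /=; apply: eq_bigr => j _.
  by rewrite !mxE mulrDl -scalerAl.
pose LL : {linear 'rV[R]_n -> R} :=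
  HB.pack L (GRing.isLinear.Build _ _ _ _ _ linL).
have cL : continuous LL.
  have -> : LL = \sum_j (fun h : 'rV[R]_n => h 0 j * 'D_(ev j) g x) :> (_ -> R).
    by apply/funext => h; rewrite fct_sumE.
  have : continuous (\sum_j (fun h : 'rV[R]_n => h 0 j * 'D_(ev j) g x)).
    elim/big_ind : _ => [|f f' cf cf' y|j _ y]; first exact: cst_continuous.
      by apply: continuousD; [exact: cf|exact: cf'].
    have c1 := @coord_continuous R 1 n 0 j y.
    apply: (@continuousM R _ (fun h : 'rV[R]_n => h 0 j) (cst _) y c1).
    exact: cst_continuous.
  exact.
have E : g \o shift x = cst (g x) + LL +o_ 0 id.
  apply/eqaddoP => e e0.
  near=> h; rewrite -[X in `|X| <= _]/(g (h + x) - (g x + L h)).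
  by near: h; rewrite nbhs_simpl; exact: C1_approx gU e0.
have dE := diff_unique cL E.
by apply/diff_locallyP; rewrite dE.
Unshelve. all: by end_near. Qed.

(** [f] need only be derivable along [v]: its restriction [c] to the line is then a differentiable
    curve, and the chain rule for differentials applies to [g \o c]. *)
Lemma chain_rule (V : normedModType R) n U (g : 'rV[R]_n -> R) (f : V -> 'rV[R]_n) x v :
  open U -> U (f x) -> Ck 1 U g -> derivable f x v ->
  is_derive x v (g \o f) (\sum_j 'D_v f x 0 j * 'D_(ev j) g (f x)).
Proof.
move=> oU Ufx gU df.
have dg : differentiable g (f x) by exact: C1_differentiable gU.
pose c := fun r : R => f (x + r *: v).
have c0 : c 0 = f x by rewrite /c scale0r addr0.
have := @is_derive_line _ _ _ f x v 0.
rewrite scale0r addr0 -/c => /(_ df) [dc Dc].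
have dc' : differentiable c (0 : R) by exact/derivable1_diffP.
have dg' : differentiable g (c 0) by rewrite c0.
have dgc := differentiable_comp dc' dg'.
have E : (fun k : R => k^-1 *: (((g \o c) \o shift 0) (k *: (1 : R))
      - (g \o c) 0)) =
   (fun k : R => k^-1 *: (((g \o f) \o shift x) (k *: v) - (g \o f) x)).
  apply/funext => k /=; rewrite c0; congr (_ *: (g _ - _)).
  by rewrite /c addr0 addrC [k *: 1]mulr1.
have dd := diff_derivable (v := 1 : R) dgc; have DD := deriveE (1 : R) dgc.
split; first by move: dd; rewrite /derivable E.
move: DD; rewrite {1}/derive E => DD; rewrite [LHS]DD.
have Ed : 'd c (0 : R) 1 = 'D_v f x by rewrite -deriveE.
have -> := diff_comp dc' dg'.
rewrite [LHS]/= Ed c0 -deriveE //.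
exact: derive_dir_sum gU.
Qed.

(** Induction on [k] for all [g] at once: the derivative of the composite contains partial
    derivatives of [g] composed with the same [f]. *)
Lemma Ck_comp (V : normedModType R) n k U U' (g : 'rV[R]_n -> R) (f : V -> 'rV[R]_n) :
  open U -> open U' -> (forall x, U x -> U' (f x)) -> Ck k U f -> Ck k U' g ->
  Ck k U (g \o f).
Proof.
move=> oU oU' UU'; elim: k g => [|k IH] g cf cg.
  split=> // x Ux; apply: continuous_comp; first exact: Ck_cont cf Ux.
  by apply: (Ck_cont cg); exact: UU'.
apply: (@CkS_intro _ _ _ _ _ _ (fun v x => \sum_j 'D_v f x 0 j * 'D_(ev j) g (f x))) => //.
- move=> x Ux; apply: continuous_comp; first exact: Ck_cont cf Ux.
  by apply: (Ck_cont cg); exact: UU'.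
- move=> v x Ux; apply: (chain_rule oU' (UU' _ Ux)).
    by apply: Ck_le cg.
  exact: Ck_derivable cf Ux.
- move=> v; apply: Ck_sum => // j; apply: CkM => //.
  + by move: {+}0 j; apply/Ck_mxP => //; exact: Ck_derive.
  + exact: (IH _ (Ck_pred cf) (Ck_derive _ cg)).
Qed.

Lemma Ck_comp_mx (V : normedModType R) n p q k U U' (g : 'rV[R]_n -> 'M[R]_(p, q))
    (f : V -> 'rV[R]_n) :
  open U -> open U' -> (forall x, U x -> U' (f x)) -> Ck k U f -> Ck k U' g ->
  Ck k U (g \o f).
Proof.
move=> oU oU' UU' cf cg; apply/Ck_mxP => // i j.
have cgij : Ck k U' (fun x => g x i j) by move: i j; apply/Ck_mxP.
exact: Ck_comp cf cgij.
Qed.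

End Chain.

(** * Maps smooth near a point *)

Section SmoothNear.
Context {R : realType}.
Implicit Types V W : normedModType R.

Lemma smooth_near_open V W (x : V) (f : V -> W) (U : set V) :
  smooth_near x f -> nbhs x U ->
  exists U' : set V, [/\ open U', U' x, U' `<=` U & smooth_on U' f].
Proof.
move=> [U1 [oU1 U1x sf]] nU; exists (U1 `&` interior U); split.
- by apply: openI => //; exact: open_interior.
- by split.
- by move=> y [_ /interior_subset].
- by move=> k; apply: Ck_sub (sf k) => y [].
Qed.

Lemma smooth_near_ext V W (x : V) (f g : V -> W) :
  (\forall y \near x, f y = g y) -> smooth_near x f -> smooth_near x g.
Proof.
move=> fg sf; have [U [oU Ux Ufg sfU]] := smooth_near_open sf fg.
by exists U; split => // k; apply: Ck_ext (sfU k).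
Qed.

Lemma smooth_near_eq V W (x : V) (f g : V -> W) :
  f =1 g -> smooth_near x f -> smooth_near x g.
Proof. by move=> /funext ->. Qed.

Lemma smooth_near_near V W (x : V) (f : V -> W) :
  smooth_near x f -> \forall y \near x, smooth_near y f.
Proof.
move=> [U [oU Ux sf]]; apply: filterS (open_nbhs_nbhs (conj oU Ux)) => y Uy.
by exists U.
Qed.

Lemma smooth_near_continuous V W (x : V) (f : V -> W) :
  smooth_near x f -> {for x, continuous f}.
Proof. by move=> [U [oU Ux sf]]; exact: Ck_cont (sf 0) Ux. Qed.

Lemma smooth_near_derivable V W (x : V) (f : V -> W) v :
  smooth_near x f -> derivable f x v.
Proof. by move=> [U [oU Ux sf]]; exact: Ck_derivable (sf 1) Ux. Qed.

Lemma smooth_near_derive V W (x : V) (f : V -> W) v :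
  smooth_near x f -> smooth_near x (fun y => 'D_v f y).
Proof.
by move=> [U [oU Ux sf]]; exists U; split=> // k; exact: Ck_derive.
Qed.

Lemma smooth_near_fin V W (I : finType) (x : V) (f : I -> V -> W) :
  (forall i, smooth_near x (f i)) ->
  exists U : set V, [/\ open U, U x & forall i, smooth_on U (f i)].
Proof.
move=> /choice [U UP].
have nU : nbhs x [set y | forall i, U i y].
  apply: filter_forall => i; have [oU Ux _] := UP i.
  exact: open_nbhs_nbhs.
exists (interior [set y | forall i, U i y]); split => //.
- exact: open_interior.
- move=> i k; have [_ _ sf] := UP i.
  by apply: Ck_sub (sf k) => y /interior_subset; exact.
Qed.

Lemma smooth_near2 V W W' (x : V) (f : V -> W) (g : V -> W') :
  smooth_near x f -> smooth_near x g ->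
  exists U : set V, [/\ open U, U x, smooth_on U f & smooth_on U g].
Proof.
move=> sf [U1 [oU1 U1x sg]].
have [U [oU Ux UU1 sfU]] := smooth_near_open sf (open_nbhs_nbhs (conj oU1 U1x)).
by exists U; split=> // k; exact: Ck_sub (sg k).
Qed.

Lemma smooth_near_cst V W (x : V) (a : W) : smooth_near x (fun _ => a).
Proof. by exists setT; split=> // [|k]; [exact: openT|exact/Ck_cst/openT]. Qed.

Lemma smooth_nearD V W (x : V) (f g : V -> W) :
  smooth_near x f -> smooth_near x g -> smooth_near x (fun y => f y + g y).
Proof.
move=> sf sg; have [U [oU Ux sfU sgU]] := smooth_near2 sf sg.
by exists U; split=> // k; exact: CkD.
Qed.

Lemma smooth_nearZ V W (x : V) (f : V -> W) (a : R) :
  smooth_near x f -> smooth_near x (fun y => a *: f y).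
Proof. by move=> [U [oU Ux sf]]; exists U; split=> // k; exact: CkZ. Qed.

Lemma smooth_nearN V W (x : V) (f : V -> W) :
  smooth_near x f -> smooth_near x (fun y => - f y).
Proof.
move=> /(smooth_nearZ (-1)); apply: smooth_near_eq.
by move=> y; rewrite scaleN1r.
Qed.

Lemma smooth_nearB V W (x : V) (f g : V -> W) :
  smooth_near x f -> smooth_near x g -> smooth_near x (fun y => f y - g y).
Proof. by move=> sf sg; apply: smooth_nearD => //; exact: smooth_nearN. Qed.

Lemma smooth_nearM V (x : V) (f g : V -> R) :
  smooth_near x f -> smooth_near x g -> smooth_near x (fun y => f y * g y).
Proof.
move=> sf sg; have [U [oU Ux sfU sgU]] := smooth_near2 sf sg.
by exists U; split=> // k; exact: CkM.
Qed.

Lemma smooth_near_neq0 V (x : V) (f : V -> R) :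
  {for x, continuous f} -> f x != 0 -> \forall y \near x, f y != 0.
Proof.
move=> cf f0; have : \forall z \near f x, z != 0.
  exact: (open_nbhs_nbhs (conj (@open_neq R 0) f0)).
exact: cf.
Qed.

Lemma smooth_near_sum V W (x : V) (I : finType) (f : I -> V -> W) :
  (forall i, smooth_near x (f i)) -> smooth_near x (fun y => \sum_i f i y).
Proof.
move=> /smooth_near_fin [U [oU Ux sf]].
by exists U; split=> // k; apply: Ck_sum => // i; exact: sf.
Qed.

Lemma smooth_near_mxP V m n (x : V) (f : V -> 'M[R]_(m, n)) :
  smooth_near x f <-> forall i j, smooth_near x (fun y => f y i j).
Proof.
split=> [[U [oU Ux sf]] i j|sf].
  by exists U; split=> // k; move: i j; apply/Ck_mxP.
have [U [oU Ux {}sf]] := @smooth_near_fin V R ('I_m * 'I_n)%type x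
  (fun ij y => f y ij.1 ij.2) (fun ij => sf ij.1 ij.2).
by exists U; split=> // k; apply/Ck_mxP => // i j; exact: (sf (i, j)).
Qed.

(** The composition rule for C^k enters as a hypothesis, so that one argument serves real and matrix
    values. *)
Lemma smooth_near_comp V n W (x : V) (f : V -> 'rV[R]_n) (g : 'rV[R]_n -> W) :
  (forall U U' k, open U -> open U' -> (forall x, U x -> U' (f x)) -> Ck k U f -> Ck k U' g ->
    Ck k U (g \o f)) ->
  smooth_near x f -> smooth_near (f x) g -> smooth_near x (fun y => g (f y)).
Proof.
move=> compW sf [U' [oU' U'fx sg]].
have nU' : nbhs x (f @^-1` U').
  by apply: (smooth_near_continuous sf); exact: open_nbhs_nbhs.
have [U [oU Ux UU' sfU]] := smooth_near_open sf nU'.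
by exists U; split=> // k; exact: (compW U U').
Qed.

Lemma smooth_near_compR V n (x : V) (f : V -> 'rV[R]_n) (g : 'rV[R]_n -> R) :
  smooth_near x f -> smooth_near (f x) g -> smooth_near x (fun y => g (f y)).
Proof.
by apply: smooth_near_comp => U U' k oU oU' UU'; exact: Ck_comp.
Qed.

Lemma smooth_near_comp_mx V n p q (x : V) (f : V -> 'rV[R]_n)
    (g : 'rV[R]_n -> 'M[R]_(p, q)) :
  smooth_near x f -> smooth_near (f x) g -> smooth_near x (fun y => g (f y)).
Proof.
by apply: smooth_near_comp => U U' k oU oU' UU'; exact: Ck_comp_mx.
Qed.

(** [Ck_comp] asks for an inner map into row vectors. A continuous linear inner map between
    arbitrary spaces needs no chain rule: difference quotients along [v] are difference quotients
    along [L v]. *)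
Lemma smooth_near_lin_comp V V' W (L : {linear V' -> V}) (x : V') (g : V -> W) :
  continuous L -> smooth_near (L x) g -> smooth_near x (fun y => g (L y)).
Proof.
move=> cL [U [oU Ux sg]]; exists (L @^-1` U); split=> //.
  by move/continuousP : cL; exact.
have oU' : open (L @^-1` U) by move/continuousP : cL; exact.
have cgL k (h : V -> W) : Ck k U h -> forall y, (L @^-1` U) y ->
    {for y, continuous (fun y => h (L y))}.
  move=> ch y Uy; apply: (@continuous_comp _ _ _ L h); first exact: cL.
  exact: Ck_cont ch Uy.
move=> k; elim: k g {sg} (sg k) => [|k IH] h ch.
  by split=> // y Uy; exact: cgL ch _ Uy.
apply: (@CkS_intro _ _ _ _ _ _ (fun v y => 'D_(L v) h (L y))) => //.
- by move=> y Uy; exact: cgL ch _ Uy.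
- move=> v y Uy.
  have E : (fun t : R => t^-1 *: (((fun y => h (L y)) \o shift y) (t *: v)
      - h (L y))) =
   (fun t : R => t^-1 *: ((h \o shift (L y)) (t *: L v) - h (L y))).
    by apply/funext => t /=; rewrite linearP.
  have := @Ck_derivable _ _ _ _ _ _ _ (L v) ch Uy.
  by split; rewrite /derivable /derive E.
- by move=> v; exact: (IH _ (Ck_derive _ ch)).
Qed.

Lemma is_derive_lin V W (L : {linear V -> W}) x v : continuous L ->
  is_derive x v L (L v).
Proof.
move=> cL; have dL := @linear_differentiable _ _ _ L x cL.
split; first exact: diff_derivable.
by rewrite deriveE // diff_lin.
Qed.

Lemma derive_lin_comp V V' W (L : {linear V' -> W}) (f : V -> V') x v :
  continuous L -> derivable f x v -> 'D_v (fun y => L (f y)) x = L ('D_v f x).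
Proof.
move=> cL df; apply: cvg_lim => //.
have -> : (fun h : R => h^-1 *: (((fun y => L (f y)) \o shift x) (h *: v) - L (f x)))
   = L \o (fun h : R => h^-1 *: ((f \o shift x) (h *: v) - f x)).
  by apply/funext => h /=; rewrite -(linearB L) linearZ_LR.
exact: (@cvg_comp _ _ _ (fun h : R => h^-1 *: ((f \o shift x) (h *: v) - f x)) L
  _ _ _ df (cL _)).
Qed.

Lemma smooth_near_lin V W (L : {linear V -> W}) (x : V) :
  continuous L -> smooth_near x L.
Proof.
move=> cL; exists setT; split=> //; first exact: openT.
have DL v y : is_derive y v L (L v) by exact: is_derive_lin.
case=> [|k]; first by split=> // y _; exact: cL.
apply: (@CkS_intro _ _ _ _ _ _ (fun v _ => L v)) => //.
- exact: openT.
- by move=> y _; exact: cL.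
- by move=> v; apply: Ck_cst; exact: openT.
Qed.

(** The product is replaced by row vectors of length [m + n], where the composition rule applies. *)
Lemma smooth_near_pair V m n (x : V) (f : V -> 'rV[R]_m) (g : V -> 'rV[R]_n)
    (h : 'rV[R]_m * 'rV[R]_n -> R) :
  smooth_near x f -> smooth_near x g -> smooth_near (f x, g x) h ->
  smooth_near x (fun y => h (f y, g y)).
Proof.
move=> sf sg sh.
pose L (z : 'rV[R]_(m + n)) := (lsubmx z, rsubmx z).
have linL : linear L by move=> a u v; rewrite /L !linearP.
pose LL : {linear 'rV[R]_(m + n) -> ('rV[R]_m * 'rV[R]_n)%type} :=
  HB.pack L (GRing.isLinear.Build _ _ _ _ _ linL).
have cL : continuous LL.
  move=> z; have c1 := @continuous_lsubmx R 1 m n z.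
  have c2 := @continuous_rsubmx R 1 m n z.
  exact: (cvg_pair c1 c2).
have LE y : LL (row_mx (f y) (g y)) = (f y, g y).
  by rewrite /= /L row_mxKl row_mxKr.
have shL : smooth_near (row_mx (f x) (g x)) (fun z => h (LL z)).
  by apply: smooth_near_lin_comp; rewrite ?LE.
have srow : smooth_near x (fun y => row_mx (f y) (g y)).
  apply/smooth_near_mxP => i j; have [[k ->]|[k ->]] : (exists k, j = lshift n k) \/ (exists k, j = rshift m k).
  - by case: (split_ordP j) => k ->; [left|right]; exists k.
  - have := (smooth_near_mxP x f).1 sf i k; apply: smooth_near_eq.
    by move=> y; rewrite row_mxEl.
  - have := (smooth_near_mxP x g).1 sg i k; apply: smooth_near_eq.
    by move=> y; rewrite row_mxEr.
have := smooth_near_compR srow shL; apply: smooth_near_eq.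
by move=> y; rewrite LE.
Qed.

Lemma Ck_det V n k (U : set V) (M : V -> 'M[R]_n) : open U ->
  (forall i j, Ck k U (fun y => M y i j)) -> Ck k U (fun y => \det (M y)).
Proof.
move=> oU sM; apply: Ck_sum => // s; apply: CkM => //; first exact: Ck_cst.
by apply: Ck_prod.
Qed.

(** Cramer's rule: the entries are polynomials in those of [M] divided by the determinant. *)
Lemma Ck_invmx V n k (U : set V) (M : V -> 'M[R]_n) i j : open U ->
  (forall i j, Ck k U (fun y => M y i j)) -> (forall y, U y -> M y \in unitmx) ->
  Ck k U (fun y => invmx (M y) i j).
Proof.
case: n M i j => [|n] M i j; first by case: i.
move=> oU sM uM.
apply: (@Ck_ext _ _ _ _ _ (fun y => (\det (M y))^-1 * (\adj (M y)) i j)) => //.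
  by move=> y Uy; rewrite /invmx uM // [RHS]mxE.
apply: CkM => //.
  apply: CkV => //; last exact: Ck_det.
  by move=> y /uM; rewrite unitmxE unitfE.
under eq_fun do rewrite mxE.
apply: CkM => //; first exact: Ck_cst.
by apply: Ck_det => // k' l; under eq_fun do rewrite !mxE; exact: sM.
Qed.

Lemma smooth_near_invmx V n (x : V) (M : V -> 'M[R]_n) :
  (forall i j, smooth_near x (fun y => M y i j)) -> M x \in unitmx ->
  forall i j, smooth_near x (fun y => invmx (M y) i j).
Proof.
move=> sM; rewrite unitmxE unitfE => d0 i j.
have /smooth_near_mxP [U [oU Ux sMU]] := sM.
have sMij i' j' k : Ck k U (fun y => M y i' j').
  by have /Ck_mxP := sMU k; apply.
have cd : {for x, continuous (fun y => \det (M y))}.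
  by apply: (Ck_cont (@Ck_det V n 0 U M oU _) Ux).
have nU := smooth_near_neq0 cd d0.
exists (U `&` interior [set y | \det (M y) != 0]); split.
- by apply: openI => //; exact: open_interior.
- by split.
- move=> k; apply: Ck_invmx.
  + by apply: openI => //; exact: open_interior.
  + by move=> i' j'; apply: Ck_sub (sMij i' j' k) => y [].
  + by move=> y [_ /interior_subset]; rewrite unitmxE unitfE.
Qed.

Lemma smooth_near_comm V (g : V -> R) x u v : smooth_near x g ->
  'D_v ('D_u g) x = 'D_u ('D_v g) x.
Proof. by move=> [U [oU Ux sg]]; exact: derive_comm (sg 2). Qed.

Lemma smooth_near_dirP V (g : V -> R) x (a : R) u v : smooth_near x g ->
  'D_(a *: u + v) g x = a * 'D_u g x + 'D_v g x.
Proof.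
move=> sg; have [U [oU Ux sgU]] := sg.
rewrite (derive_dirD _ _ oU Ux (sgU 1)).
by have [_ ->] := is_derive_scale a (@smooth_near_derivable _ _ _ _ u sg).
Qed.

Lemma smooth_near_dir_sum n (g : 'rV[R]_n -> R) x h : smooth_near x g ->
  'D_h g x = \sum_j h 0 j * 'D_(ev j) g x.
Proof. by move=> [U [oU Ux sg]]; exact: derive_dir_sum (sg 1). Qed.

Lemma smooth_near_chain V n (g : 'rV[R]_n -> R) (f : V -> 'rV[R]_n) x v :
  smooth_near (f x) g -> derivable f x v ->
  is_derive x v (fun y => g (f y)) (\sum_j 'D_v f x 0 j * 'D_(ev j) g (f x)).
Proof. by move=> [U [oU Ux sg]]; exact: chain_rule (sg 1). Qed.

Lemma smooth_near_approx n (g : 'rV[R]_n -> R) x (e : R) : smooth_near x g ->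
  0 < e -> \forall h \near (0 : 'rV[R]_n),
  `|g (h + x) - (g x + \sum_j h 0 j * 'D_(ev j) g x)| <= e * `|h|.
Proof. by move=> [U [oU Ux sg]]; exact: C1_approx (sg 1). Qed.

Lemma smooth_near_coord m n i j (M : 'M[R]_(m, n)) :
  smooth_near M (fun N : 'M[R]_(m, n) => N i j).
Proof.
have linL : linear (fun N : 'M[R]_(m, n) => N i j) by move=> a u v; rewrite !mxE.
pose LL : {linear 'M[R]_(m, n) -> R} :=
  HB.pack (fun N : 'M[R]_(m, n) => N i j) (GRing.isLinear.Build _ _ _ _ _ linL).
by apply: (@smooth_near_lin _ _ LL); exact: coord_continuous.
Qed.

Lemma smooth_near_mulmx V m n p (x : V) (f : V -> 'M[R]_(m, n)) (g : V -> 'M[R]_(n, p)) :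
  smooth_near x f -> smooth_near x g -> smooth_near x (fun y => f y *m g y).
Proof.
move=> /smooth_near_mxP sf /smooth_near_mxP sg; apply/smooth_near_mxP => i j.
under eq_fun do rewrite mxE.
by apply: smooth_near_sum => k; exact: smooth_nearM.
Qed.

End SmoothNear.

(** * The inverse function theorem *)

(* Lets HB join the normed and the complete structures of matrices. *)
HB.instance Definition _ (R : realType) (m n : nat) :=
  Uniform_isComplete.Build 'M[R]_(m, n) (@cauchy_cvg 'M[R]_(m, n)).

Lemma lipschitz_at_continuous (R : realType) (V W : normedModType R) (U : set V)
    (h : V -> W) (C : R) y :
  open U -> U y -> 0 <= C -> (forall z, U z -> `|h z - h y| <= C * `|z - y|) ->
  {for y, continuous h}.
Proof.
move=> oU Uy C0 lh; apply/cvgrPdist_le => e e0.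
have C1 : 0 < C + 1 by rewrite ltr_wpDl.
near=> z.
have Uz : U z by near: z; exact: open_nbhs_nbhs.
have yz : `|y - z| <= e / (C + 1).
  near: z; have /cvgrPdist_le := @cvg_id _ (nbhs y); apply.
  by rewrite divr_gt0.
rewrite distrC; apply: le_trans (lh _ Uz) _; rewrite distrC.
apply: le_trans (_ : (C + 1) * `|y - z| <= _); first by rewrite ler_wpM2r // lerDl.
by rewrite mulrC -ler_pdivlMr.
Unshelve. all: by end_near. Qed.

Section InverseFunction.
Context {R : realType} {n : nat}.
Implicit Types f : 'rV[R]_n -> 'rV[R]_n.

(** Vectors are rows acting from the left, so this is the transpose of the usual Jacobian matrix. *)
Definition jacobian_mx f x : 'M[R]_n := \matrix_(i, j) 'D_(ev i) f x 0 j.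

Lemma norm_sub_continuous (x0 : 'rV[R]_n) : continuous (fun x : 'rV[R]_n => `|x - x0|).
Proof.
move=> x; apply: (@continuous_comp _ _ _ (fun x : 'rV[R]_n => x - x0) Num.norm).
  by apply: (@continuousB _ _ _ id (cst x0)); [exact: cvg_id|exact: cst_continuous].
exact: norm_continuous.
Qed.

Lemma closed_ball_norm (x0 : 'rV[R]_n) (r : R) : closed [set x : 'rV[R]_n | `|x - x0| <= r].
Proof.
have -> : [set x : 'rV[R]_n | `|x - x0| <= r] = (fun x : 'rV[R]_n => `|x - x0|) @^-1` [set y | y <= r] by [].
apply: preimage_closed; last exact: closed_le.
move=> x _; exact: norm_sub_continuous.
Qed.

Lemma open_ball_norm (x0 : 'rV[R]_n) (r : R) : open [set x : 'rV[R]_n | `|x - x0| < r].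
Proof.
have -> : [set x : 'rV[R]_n | `|x - x0| < r] = (fun x : 'rV[R]_n => `|x - x0|) @^-1` [set y | y < r] by [].
apply: open_comp; last exact: open_lt.
move=> x _; exact: norm_sub_continuous.
Qed.

Lemma fixed_point_ball (T : 'rV[R]_n -> 'rV[R]_n) x0 (r : R) : 0 <= r ->
  (forall x, `|x - x0| <= r -> `|T x - x0| <= r) ->
  (forall x y, `|x - x0| <= r -> `|y - x0| <= r -> `|T x - T y| <= 2^-1 * `|x - y|) ->
  exists2 x, `|x - x0| <= r & T x = x.
Proof.
move=> r0 Tr cT; pose B := [set x : 'rV[R]_n | `|x - x0| <= r].
have fT : set_fun B B T by move=> x; exact: Tr.
have h2 : 0 <= 2^-1 :> R by rewrite invr_ge0.
have [||| x Bx xT] := @banach_fixed_point R ('rV[R]_n) B (mkfun_fun fT).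
- exists (NngNum h2); split; first by rewrite /= invf_lt1 // ltr1n.
  by move=> [x y] [/= Bx By]; exact: cT.
- exact: closed_ball_norm.
- by exists x0; rewrite /B /= subrr normr0.
- by exists x.
Qed.

(** The norm is the largest coordinate, and each coordinate of the increment is a sum of [n] terms:
    hence the factor [n]. The segment stays in the ball by convexity. *)
Lemma ball_lipschitz f U x0 (r c : R) : open U -> Ck 1 U f -> 0 <= c ->
  (forall x, `|x - x0| <= r -> U x /\ forall i j,
    `|'D_(ev i) (fun x => f x 0 j) x| <= c) ->
  forall x y, `|x - x0| <= r -> `|y - x0| <= r ->
     `|f x - f y| <= n%:R * c * `|x - y|.
Proof.
move=> oU cf c_ge0 rP x y xr yr.
have cfj j : Ck 1 U (fun x => f x 0 j).
  by move/(Ck_mxP _ _ oU): cf; exact.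
apply: mx_norm_le => [|i j].
  by rewrite !mulr_ge0.
rewrite mxE [X in _ + X]mxE ord1 {i}.
pose h := x - y.
have Bs (s : R) : 0 <= s <= 1 -> `|y + (s * 1) *: h - x0| <= r.
  move=> /andP[s0 s1]; rewrite mulr1.
  have -> : y + s *: h - x0 = (1 - s) *: (y - x0) + s *: (x - x0).
    by apply/matrixP => i k; rewrite !mxE; ring.
  apply: le_trans (ler_normD _ _) _; rewrite !normrZ (ger0_norm s0).
  rewrite ger0_norm ?subr_ge0 //.
  have -> : r = (1 - s) * r + s * r by rewrite -mulrDl subrK mul1r.
  by rewrite lerD // ler_wpM2l // subr_ge0.
have [s s01|s /andP[s0 s1]] := @mvt_dir _ _ (fun x => f x 0 j) y h 1.
  by apply: (Ck_derivable (cfj j)); case: (rP _ (Bs _ s01)).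
rewrite scale1r mul1r (_ : y + h = x); last by rewrite /h addrC subrK.
have s01 : 0 <= s <= 1 by rewrite !ltW.
have [Us Ds] := rP _ (Bs s s01).
move=> ->; rewrite (derive_dir_sum h oU Us (cfj j)).
apply: le_trans (ler_norm_sum _ _ _) _.
apply: (@le_trans _ _ (\sum_(i < n) `|h| * c)).
  by apply: ler_sum => i _; rewrite normrM ler_pM ?mx_norm_coord.
rewrite sumr_const card_ord -[_ *+ n]mulr_natr -/h.
by have -> : `|h| * c * n%:R = n%:R * c * `|h| by ring.
Qed.

Lemma near_id_contraction f U x0 : open U -> U x0 -> Ck 1 U f ->
  jacobian_mx f x0 = 1%:M ->
  exists2 r : R, 0 < r & (forall x, `|x - x0| <= r -> U x) /\
   forall x y, `|x - x0| <= r -> `|y - x0| <= r ->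
     `|(x - f x) - (y - f y)| <= 2^-1 * `|x - y|.
Proof.
move=> oU Ux cf J1; pose phi x := x + -1 *: f x.
have cphi : Ck 1 U phi.
  exact: (@CkD _ _ _ 1 U (fun x => x) (fun x => -1 *: f x) oU (Ck_id 1 oU) (CkZ (-1) oU cf)).
have cphij j : Ck 1 U (fun x => phi x 0 j).
  by move/(Ck_mxP _ _ oU): cphi; exact.
have Dphi0 i j : 'D_(ev i) (fun x => phi x 0 j) x0 = 0.
  have d1 := @Ck_derivable _ _ _ _ _ _ _ (ev i) cphi Ux.
  have -> : 'D_(ev i) (fun x => phi x 0 j) x0 = 'D_(ev i) phi x0 0 j.
    by rewrite (derive_mx d1) mxE.
  have df := derivableP (@Ck_derivable _ _ _ _ _ _ _ (ev i) cf Ux).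
  have [_ ->] := is_deriveD (is_derive_id x0 (ev i)) (is_deriveZ (-1) df).
  have /matrixP /(_ i j) := J1; rewrite !mxE => ->.
  by rewrite eqxx /= mulN1r (eq_sym j) subrr.
(* With this bound on the partial derivatives of [phi], the Lipschitz constant given by
   [ball_lipschitz] is at most 1/2. *)
have c0 : 0 < (2 * n.+1%:R)^-1 :> R by rewrite invr_gt0 mulr_gt0.
have nU : \forall x \near x0, U x /\ forall ij : 'I_n * 'I_n,
    `|'D_(ev ij.1) (fun x => phi x 0 ij.2) x| <= (2 * n.+1%:R)^-1.
  apply: filterI; first exact: open_nbhs_nbhs.
  near=> x; move=> ij; move: ij; near: x; apply: filter_forall => -[i j] /=.
  have /cvgrPdist_le := Ck_cont (Ck_derive (ev i) (cphij j)) Ux.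
  move=> /(_ _ c0); apply: filterS => x.
  by rewrite Dphi0 sub0r normrN.
have /nbhs_normP [r /= r0 rP] := nU.
have r2 : 0 < r / 2 by rewrite divr_gt0.
have rP' x : `|x - x0| <= r / 2 -> U x /\ forall i j,
    `|'D_(ev i) (fun x => phi x 0 j) x| <= (2 * n.+1%:R)^-1.
  move=> xr; have [|Ux' Dx] := rP x.
    rewrite /= distrC; apply: le_lt_trans xr _.
    by rewrite ltr_pdivrMr // ltr_pMr // ltr1n.
  by split=> // i j; exact: (Dx (i, j)).
exists (r / 2) => //; split; first by move=> x /rP' [].
move=> x y xr yr.
have -> : x - f x - (y - f y) = phi x - phi y by rewrite /phi !scaleN1r.
apply: le_trans (ball_lipschitz oU cphi (ltW c0) rP' xr yr) _.
rewrite ler_wpM2r // invfM mulrCA ler_piMr // ?invr_ge0 //.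
by rewrite ler_pdivrMr // mul1r ler_nat.
Unshelve. all: by end_near. Qed.

Lemma jacobian_mx_smooth f x : smooth_near x f ->
  forall i j, smooth_near x (fun y => jacobian_mx f y i j).
Proof.
move=> sf i j; have /smooth_near_mxP /(_ 0 j) := @smooth_near_derive _ _ _ _ _ (ev i) sf.
by apply: smooth_near_eq => y; rewrite mxE.
Qed.

Lemma jacobian_mx_unit f x : smooth_near x f -> jacobian_mx f x \in unitmx ->
  \forall y \near x, jacobian_mx f y \in unitmx.
Proof.
move=> sf; rewrite unitmxE unitfE => d0.
have /smooth_near_mxP [U [oU Ux sJ]] := jacobian_mx_smooth sf.
have cd : {for x, continuous (fun y => \det (jacobian_mx f y))}.
  apply: (Ck_cont (@Ck_det R _ n 0 U (jacobian_mx f) oU _) Ux).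
  by have /Ck_mxP := sJ 0; apply.
by apply: filterS (smooth_near_neq0 cd d0) => y; rewrite unitmxE unitfE.
Qed.

(* Differentiate f (h z) = z along z = y + t v. *)
Lemma inverse_is_derive f (h : 'rV[R]_n -> 'rV[R]_n) (V : set 'rV[R]_n) (C : R) y v :
  open V -> V y -> smooth_near (h y) f -> jacobian_mx f (h y) \in unitmx ->
  (forall z, V z -> f (h z) = z) -> 0 <= C ->
  (forall z, V z -> `|h z - h y| <= C * `|z - y|) ->
  is_derive y v h (v *m invmx (jacobian_mx f (h y))).
Proof.
move=> oV Vy sf uJ fh C0 lh; set J := jacobian_mx _ _ in uJ *.
pose q (t : R) := t^-1 *: (h (t *: v + y) - h y).
have nV : \forall t \near (0 : R), V (y + t *: v).
  by apply: near_line; exact: open_nbhs_nbhs.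
have Cv0 : 0 < C * `|v| + 1 by rewrite ltr_wpDl ?mulr_ge0.
have qJ : q t *m J @[t --> 0^'] --> v.
  apply/cvgrPdist_le => e e0.
  (* The displacement of [h] is at most [C * |v| + 1] times that of [t], so a relative error [e1] in
     the displacement becomes an error [e] in the quotient. *)
  pose e1 := e / (C * `|v| + 1).
  have e10 : 0 < e1 by rewrite divr_gt0.
  have napp : \forall d \near (0 : 'rV[R]_n), forall j : 'I_n,
      `|f (d + h y) 0 j - (f (h y) 0 j + \sum_i d 0 i * J i j)| <= e1 * `|d|.
    near=> d; move=> j; move: j; near: d; apply: filter_forall => j.
    have sfj : smooth_near (h y) (fun x => f x 0 j) by have /smooth_near_mxP := sf; apply.
    apply: filterS (smooth_near_approx sfj e10) => d.
    congr (`| _ - (_ + _)| <= _); apply: eq_bigr => i _; congr (_ * _).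
    by rewrite /J mxE (derive_mx (@smooth_near_derivable _ _ _ _ _ _ sf)) mxE.
  have /nbhs_normP [r /= r0 rP] := napp.
  near=> t.
  have t0 : t != 0 by near: t; exact: nbhs_dnbhs_neq.
  have Vt : V (y + t *: v) by near: t; exact: cvg_within.
  have tr : `|t| < r / (C * `|v| + 1) by near: t; apply: dnbhs0_lt; rewrite divr_gt0.
  have dt : `|h (y + t *: v) - h y| <= (C * `|v| + 1) * `|t|.
    apply: le_trans (lh _ Vt) _; rewrite addrAC subrr add0r normrZ.
    by rewrite mulrCA mulrC ler_wpM2r // lerDl.
  have dr : `|h (y + t *: v) - h y| < r.
    by apply: le_lt_trans dt _; rewrite mulrC -ltr_pdivlMr.
  have fyt := fh _ Vt; have fy := fh _ Vy.
  set d := h (y + t *: v) - h y in dt dr *.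
  have hd : h (y + t *: v) = d + h y by rewrite /d subrK.
  have qE : q t = t^-1 *: d by rewrite /q /d (addrC y).
  apply: mx_norm_le => [|i j]; first exact: ltW.
  have := rP d; rewrite /= sub0r normrN => /(_ dr j).
  rewrite -hd fyt fy => appj.
  rewrite ord1 {i} mxE [X in _ + X]mxE qE.
  have -> : v 0 j - (t^-1 *: d *m J) 0 j =
     t^-1 * ((y + t *: v) 0 j - (y 0 j + \sum_i d 0 i * J i j)).
    rewrite !mxE [y 0 j + t * _]addrC addrKA mulrBr mulKf //.
    by congr (_ - _); rewrite mulr_sumr; apply: eq_bigr => i _; rewrite !mxE mulrA.
  rewrite normrM normfV ler_pdivrMl ?normr_gt0 //; apply: le_trans appj _.
  apply: le_trans (_ : e1 * ((C * `|v| + 1) * `|t|) <= _).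
    by rewrite ler_wpM2l // ltW.
  by rewrite mulrA /e1 divfK ?gt_eqF // mulrC.
have qc : q t @[t --> 0^'] --> v *m invmx J.
  have -> : q = (fun t => (q t *m J) *m invmx J).
    by apply/funext => t; rewrite mulmxK.
  have cm : {for v, continuous (fun w : 'rV[R]_n => w *m invmx J)}.
    apply: smooth_near_continuous; apply: smooth_near_mulmx.
      by apply/smooth_near_mxP => i j; exact: smooth_near_coord.
    exact: smooth_near_cst.
  exact: (@cvg_comp _ _ _ (fun t => q t *m J) (fun w : 'rV[R]_n => w *m invmx J)
    _ _ _ qJ cm).
split; first by apply/cvg_ex; exists (v *m invmx J).
exact: (cvg_lim _ qc).
Unshelve. all: by end_near. Qed.

(** Bootstrapping: the derivative of [h] is the inverse Jacobian taken at [h y], which is C^k as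
    soon as [h] is. *)
Lemma inverse_smooth f (h : 'rV[R]_n -> 'rV[R]_n) U V (C : R) :
  open U -> open V -> smooth_on U f ->
  (forall x, U x -> jacobian_mx f x \in unitmx) ->
  (forall y, V y -> U (h y) /\ f (h y) = y) -> 0 <= C ->
  (forall y z, V y -> V z -> `|h z - h y| <= C * `|z - y|) ->
  smooth_on V h.
Proof.
move=> oU oV sf uJ hP C0 lh.
have ch y : V y -> {for y, continuous h}.
  by move=> Vy; apply: (lipschitz_at_continuous oV Vy C0) => z Vz; exact: lh.
case=> [|k]; first by split.
elim: k.+1 => [|{}k IH]; first by split.
apply: (@CkS_intro _ _ _ _ _ _ (fun v y => v *m invmx (jacobian_mx f (h y)))) => //.
- move=> v y Vy; have [Uhy _] := hP _ Vy.
  apply: (@inverse_is_derive f h V C) => //.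
  + by exists U.
  + exact: uJ.
  + by move=> z /hP [].
  + by move=> z Vz; exact: lh.
- move=> v; apply/Ck_mxP => // i j; under eq_fun do rewrite mxE.
  apply: Ck_sum => // l; apply: CkM => //; first exact: Ck_cst.
  apply: Ck_invmx => // [i' j'|y Vy]; last by apply: uJ; case: (hP _ Vy).
  have cfj : Ck k U (fun x => jacobian_mx f x i' j').
    have /Ck_mxP := Ck_derive (ev i') (sf k.+1); move=> /(_ oU 0 j').
    by apply: Ck_ext => // x _; rewrite mxE.
  by apply: (Ck_comp oV oU _ IH cfj) => y /hP [].
Qed.

(** Solving [f x = y] means finding a fixed point of the map sending [x] to [y + (x - f x)], a
    contraction of factor 1/2 near [x0]. The same contraction bounds [|x - y|] by [2 * |f x - f y|],
    which gives injectivity and a Lipschitz inverse. *)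
Lemma inverse_function_id f x0 : smooth_near x0 f -> jacobian_mx f x0 = 1%:M ->
  exists U V h, [/\ open U, U x0, open V & V (f x0)] /\
    [/\ f @` U = V, forall x, U x -> h (f x) = x, smooth_on U f & smooth_on V h].
Proof.
move=> sf J1.
have nJ : \forall y \near x0, jacobian_mx f y \in unitmx.
  by apply: jacobian_mx_unit => //; rewrite J1 unitmx1.
have [U1 [oU1 U1x U1J sf1]] := smooth_near_open sf nJ.
have [r r0 [BU1 ctr]] := near_id_contraction oU1 U1x (sf1 1) J1.
(* Half of the radius is left for [y - f x0] and half for the contraction, so the ball of radius [r]
   is mapped into itself. *)
pose V := [set y : 'rV[R]_n | `|y - f x0| < r / 2].
(* The intersection with the preimage makes the image of [U] exactly [V]. *)
pose U := [set x : 'rV[R]_n | `|x - x0| < r] `&` f @^-1` V.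
have r2 : 0 < r / 2 by rewrite divr_gt0.
have inj x y : `|x - x0| <= r -> `|y - x0| <= r -> `|x - y| <= 2 * `|f x - f y|.
  move=> xr yr; have := ctr x y xr yr.
  have -> : x - f x - (y - f y) = (x - y) - (f x - f y).
    by apply/matrixP => i j; rewrite !mxE; ring.
  have := ler_normB (x - y) (f x - f y).
  have : `|x - y| <= `|x - y - (f x - f y)| + `|f x - f y|.
    by have := ler_normD (x - y - (f x - f y)) (f x - f y); rewrite subrK.
  by lra.
have surj y : V y -> exists x, [/\ `|x - x0| < r & f x = y].
  move=> Vy.
  have Tr x : `|x - x0| <= r -> `|(y + (x - f x)) - x0| < r.
    move=> xr; have := ctr x x0 xr; rewrite subrr normr0 => /(_ (ltW r0)) c.
    have -> : y + (x - f x) - x0 = (y - f x0) + (x - f x - (x0 - f x0)).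
      by apply/matrixP => i j; rewrite !mxE; ring.
    apply: le_lt_trans (ler_normD _ _) _; move: Vy; rewrite /V /=.
    by move: c xr; lra.
  have [|x z xr zr|x xr xE] := @fixed_point_ball (fun x => y + (x - f x)) x0 r (ltW r0).
  - by move=> x /Tr /ltW.
  - have -> : y + (x - f x) - (y + (z - f z)) = x - f x - (z - f z).
      by rewrite opprD addrACA subrr add0r.
    exact: ctr.
  - exists x; split; first by rewrite -xE; exact: Tr.
    move: xE; rewrite addrA addrAC -[RHS]add0r => /addIr /eqP.
    by rewrite subr_eq0 => /eqP.
pose h y := xget x0 [set x | `|x - x0| < r /\ f x = y].
have hP y : V y -> `|h y - x0| < r /\ f (h y) = y.
  by move=> /surj [x [xr xy]]; apply: (@xgetPex _ x0 [set x | `|x - x0| < r /\ f x = y]); exists x.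
have oB := @open_ball_norm x0 r.
have oV : open V by exact: open_ball_norm.
have Vx0 : V (f x0) by rewrite /V /= subrr normr0.
have oU : open U.
  rewrite openE => x [xr Vfx]; apply: filterI; first exact: open_nbhs_nbhs.
  have cf : {for x, continuous f} by apply: (Ck_cont (sf1 0)); apply: BU1; exact: ltW.
  by apply: cf; exact: open_nbhs_nbhs.
exists U, V, h; split; split => //.
- by split => //=; rewrite subrr normr0.
- apply/seteqP; split=> [_ [x [_ Vfx] <-] //|y Vy].
  have [hr fh] := hP _ Vy; exists (h y) => //; split=> //=.
  by rewrite /preimage /= fh.
- move=> x [xr Vfx]; have [hr fh] := hP _ Vfx.
  have := inj (h (f x)) x (ltW hr) (ltW xr); rewrite fh subrr normr0 mulr0.
  by rewrite normr_le0 subr_eq0 => /eqP.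
- by move=> k; apply: Ck_sub (sf1 k) => x [xr _]; apply: BU1; exact: ltW.
- apply: (@inverse_smooth f h U1 V 2) => //.
  + by move=> y /hP [hr fh]; split=> //; apply: BU1; exact: ltW.
  + move=> y z /hP [yr fy] /hP [zr fz].
    by have := inj _ _ (ltW zr) (ltW yr); rewrite fy fz.
Qed.

Lemma derive_mulmx f (A : 'M[R]_n) x v : derivable f x v ->
  'D_v (fun y => f y *m A) x = 'D_v f x *m A.
Proof.
move=> df; have cA : continuous (mulmxr A : 'rV[R]_n -> 'rV[R]_n).
  move=> y; apply: smooth_near_continuous; apply: smooth_near_mulmx.
    by apply/smooth_near_mxP => i j; exact: smooth_near_coord.
  exact: smooth_near_cst.
exact: (@derive_lin_comp R _ _ _ (mulmxr A) f x v cA df).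
Qed.

(** Multiplying the values of [f] by the constant matrix [invmx A] normalizes the Jacobian to 1. *)
Lemma inverse_function f x0 : smooth_near x0 f -> jacobian_mx f x0 \in unitmx ->
  exists U V h, [/\ open U, U x0, open V & V (f x0)] /\
    [/\ f @` U = V, forall x, U x -> h (f x) = x, smooth_on U f & smooth_on V h].
Proof.
move=> sf uJ; set A := jacobian_mx f x0 in uJ.
pose g x := f x *m invmx A.
have smul (B : 'M[R]_n) y : smooth_near y (fun z : 'rV[R]_n => z *m B).
  apply: smooth_near_mulmx; last exact: smooth_near_cst.
  by apply/smooth_near_mxP => i j; exact: smooth_near_coord.
have sg : smooth_near x0 g by apply: smooth_near_comp_mx (smul _ _).
have Jg : jacobian_mx g x0 = 1%:M.
  rewrite -(mulmxV uJ); apply/matrixP => i j; rewrite !mxE.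
  rewrite derive_mulmx; last exact: smooth_near_derivable.
  by rewrite mxE; apply: eq_bigr => k _; rewrite !mxE.
have [U [V [h [[oU Ux oV Vx] [gU hg sgU shV]]]]] := inverse_function_id sg Jg.
have cmul y : {for y, continuous (fun z : 'rV[R]_n => z *m invmx A)}.
  exact: smooth_near_continuous (smul _ _).
exists U, ((fun z : 'rV[R]_n => z *m invmx A) @^-1` V), (fun y => h (y *m invmx A)).
have oV' : open ((fun z : 'rV[R]_n => z *m invmx A) @^-1` V).
  by apply: open_comp => // z _; exact: cmul.
have cmulk k (B : 'M[R]_n) (U' : set 'rV[R]_n) : open U' ->
    Ck k U' (fun z : 'rV[R]_n => z *m B).
  move=> oU'; apply/Ck_mxP => // i j; under eq_fun do rewrite mxE.
  apply: Ck_sum => // l; apply: CkM => //; last exact: Ck_cst.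
  by have /Ck_mxP := Ck_id k oU'; apply.
split; split => //.
- apply/seteqP; split=> [_ [x Ux' <-]|y Vy].
    by rewrite /preimage /= -gU; exists x.
  have : (g @` U) (y *m invmx A) by rewrite gU.
  move=> [x Ux' gxy]; exists x => //.
  by rewrite -[LHS](mulmxKV uJ) -[f x *m _]/(g x) gxy mulmxKV.
- move=> k; have : Ck k U (fun x => g x *m A).
    exact: (Ck_comp_mx oU openT _ (sgU k) (cmulk k _ _ openT)).
  by apply: Ck_ext => // x _; rewrite mulmxKV.
- move=> k; exact: (Ck_comp_mx oV' oV _ (cmulk k _ _ oV') (shV k)).
Qed.

End InverseFunction.

(** * Ordinary differential equations *)

Section ODE.
Context {R : realType}.

Lemma derive0_eq (D : R -> R) (N x : R) : `|x| < N ->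
  (forall s, `|s| < N -> is_derive s (1 : R) D 0) -> D x = D 0.
Proof.
move=> xN D0.
have Ds (s : R) : 0 <= s <= 1 -> `|0 + (s * x) *: (1 : R)| < N.
  move=> /andP[s0 s1]; rewrite add0r [_ *: _]mulr1 normrM (ger0_norm s0).
  by apply: le_lt_trans xN; rewrite ler_piMl.
have [s s01|s /andP[s0 s1]] := @mvt_dir R R D 0 1 x.
  by have [] := D0 _ (Ds s s01).
have s01 : 0 <= s <= 1 by rewrite !ltW.
have [_ ->] := D0 _ (Ds s s01).
by rewrite mulr0 add0r [_ *: _]mulr1 => /eqP; rewrite subr_eq0 => /eqP.
Qed.

Lemma local_antiderivative (f : R -> R) (N : R) : 0 < N -> continuous f ->
  exists F : R -> R, F 0 = 0 /\ forall x, `|x| < N -> is_derive x (1 : R) F (f x).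
Proof.
move=> N0 cf.
(* The lower end is [- N], not 0, so that it lies strictly to the left of every [x] considered;
   subtracting [G 0] normalizes afterwards. *)
pose G (x : R) : R := (\int[lebesgue_measure]_(t in [set` `[- N, x]]) f t)%R.
have DG x : `|x| < N -> derivable G x 1 /\ (G^`())%classic x = f x.
  rewrite ltr_norml => /andP[Nx xN].
  apply: (@continuous_FTC1_closed R f (- N) x N) => //.
    apply: continuous_compact_integrable; first exact: segment_compact.
    exact: continuous_subspaceT.
  exact: cf.
exists (fun x => G x - G 0); split; first by rewrite subrr.
move=> x /DG [dG GE].
have dc : is_derive x (1 : R) (fun _ : R => G 0) 0 by exact: is_derive_cst.
have dGx : is_derive x (1 : R) G (f x) by split; [exact: dG|rewrite -derive1E; exact: GE].
have := is_deriveB dGx dc; rewrite subr0; exact.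
Qed.

(** The primitives on the intervals of radius [k.+1] all vanish at 0, so they agree on common
    intervals and glue along the index [N x]. *)
Lemma antiderivative (f : R -> R) : continuous f ->
  exists F : R -> R, F 0 = 0 /\ forall x, is_derive x (1 : R) F (f x).
Proof.
move=> cf.
have /choice [F FP] : forall k : nat, exists F : R -> R, F 0 = 0 /\
    forall x, `|x| < k.+1%:R -> is_derive x (1 : R) F (f x).
  by move=> k; apply: local_antiderivative.
pose N (x : R) := Num.truncn `|x|.
have NP x : `|x| < (N x).+1%:R by exact: truncnS_gt.
have FE k l x : (k <= l)%N -> `|x| < k.+1%:R -> F k x = F l x.
  move=> kl xk; apply/eqP; rewrite -subr_eq0; apply/eqP.
  have [Fk0 DFk] := FP k; have [Fl0 DFl] := FP l.
  have D0 s : `|s| < k.+1%:R -> is_derive s (1 : R) (fun x => F k x - F l x) 0.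
    move=> sk; rewrite -(subrr (f s)).
    have sl : `|s| < l.+1%:R by apply: lt_le_trans sk _; rewrite ler_nat.
    exact: (is_deriveB (DFk _ sk) (DFl _ sl)).
  by have := derive0_eq xk D0; rewrite /= Fk0 Fl0 subrr.
exists (fun x => F (N x) x); split; first by have [] := FP (N 0).
move=> x; have [_ /(_ x)] := FP (N x).+1.
have xN1 : `|x| < (N x).+2%:R by apply: lt_le_trans (NP x) _; rewrite ler_nat.
move=> /(_ xN1); apply: near_eq_is_derive.
have : \forall y \near x, `|y| < (N x).+2%:R.
  have c := @norm_continuous R R x; apply: (c [set y | y < (N x).+2%:R]).
  exact: (open_nbhs_nbhs (conj (@open_lt R _) xN1)).
apply: filterS => y yN; have [Nle|Nle] := leqP (N y) (N x).+1.
  by rewrite (FE _ _ _ Nle).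
by rewrite -(FE _ _ _ (ltnW Nle)).
Qed.

Lemma vector_antiderivative n (f : R -> 'rV[R]_n) : continuous f ->
  exists F : R -> 'rV[R]_n, F 0 = 0 /\ forall x, is_derive x (1 : R) F (f x).
Proof.
move=> cf.
have /choice [F FP] : forall j : 'I_n, exists F : R -> R, F 0 = 0 /\
    forall x, is_derive x (1 : R) F (f x 0 j).
  move=> j; apply: antiderivative => x.
  exact: (iffLR (@continuous_mxP R R 1 n f x) (cf x) 0 j).
exists (fun x => \row_j F j x); split.
  by apply/rowP => j; rewrite !mxE; have [] := FP j.
move=> x; have d : derivable (fun x => \row_j F j x) x (1 : R).
  apply/derivable_mxP => i j; under eq_fun do rewrite mxE.
  by have [_ /(_ x) []] := FP j.
split=> //; rewrite derive_mx //; apply/rowP => j; rewrite !mxE.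
by under eq_fun do rewrite mxE; have [_ /(_ x) [_ ->]] := FP j.
Qed.

Lemma mvt_vec m n (g g' : R -> 'M[R]_(m, n)) (a b C : R) : 0 <= C ->
  (forall s, 0 <= s <= 1 -> is_derive (a + s * (b - a)) (1 : R) g (g' (a + s * (b - a)))) ->
  (forall s, 0 <= s <= 1 -> `|g' (a + s * (b - a))| <= C) ->
  `|g b - g a| <= C * `|b - a|.
Proof.
move=> C0 dg gC; apply: mx_norm_le => [|i j]; first by rewrite mulr_ge0.
have dgj (s : R) : 0 <= s <= 1 -> is_derive (a + s * (b - a)) (1 : R)
    (fun t => g t i j) (g' (a + s * (b - a)) i j).
  move=> s01; have [d D] := dg _ s01.
  split; first by move/derivable_mxP : d; exact.
  by rewrite -D derive_mx // mxE.
have [s s01|s /andP[s0 s1]] := @mvt_dir R R (fun t => g t i j) a 1 (b - a).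
  by rewrite [_ *: _]mulr1; have [] := dgj _ s01.
have s01 : 0 <= s <= 1 by rewrite !ltW.
rewrite ![_ *: _]mulr1 (addrC a (b - a)) subrK.
have [_ ->] := dgj _ s01.
rewrite !mxE => ->.
rewrite normrM mulrC ler_wpM2r //.
exact: le_trans (mx_norm_coord _ _ _) (gC _ s01).
Qed.

Lemma half_pow_lt (D e : R) : 0 < e -> exists k : nat, D * (2^-1) ^+ k < e.
Proof.
move=> e0; exists (Num.truncn (`|D| / e)).+1.
set k := (Num.truncn _).+1.
have Dk : `|D| / e < k%:R by exact: truncnS_gt.
rewrite exprVn ltr_pdivrMr ?exprn_gt0 //.
apply: le_lt_trans (ler_norm _) _.
rewrite mulrC -ltr_pdivrMr //; apply: lt_trans Dk _.
by rewrite -natrX ltr_nat ltn_expl.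
Qed.

Lemma le_half_pow (A B D : R) : (forall k : nat, A <= B + D * (2^-1) ^+ k) -> A <= B.
Proof.
move=> AB; apply/ler_addgt0Pr => e e0; have [k kP] := half_pow_lt D e0.
by apply: le_trans (AB k) _; rewrite lerD2l ltW.
Qed.

(** The intervals of radius [2 * C * (2^-1) ^+ k] around [a k] are nested, and the supremum of their
    left ends lies in all of them. *)
Lemma half_pow_limit (a : nat -> R) (C : R) :
  (forall k, `|a k.+1 - a k| <= C * (2^-1) ^+ k) ->
  exists l, forall k, `|l - a k| <= 2 * C * (2^-1) ^+ k.
Proof.
move=> aC.
pose b k := a k - 2 * C * (2^-1) ^+ k; pose c k := a k + 2 * C * (2^-1) ^+ k.
have bS k : b k <= b k.+1.
  have := aC k; rewrite ler_norml /b exprS => /andP[H _].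
  have -> : 2 * C * (2^-1 * 2^-1 ^+ k) = C * 2^-1 ^+ k by field.
  by move: H; lra.
have cS k : c k.+1 <= c k.
  have := aC k; rewrite ler_norml /c exprS => /andP[_ H].
  have -> : 2 * C * (2^-1 * 2^-1 ^+ k) = C * 2^-1 ^+ k by field.
  by move: H; lra.
have bc k : b k <= c k.
  have : 0 <= C * (2^-1) ^+ k by apply: le_trans (aC k).
  by rewrite /b /c; lra.
have bm k m : b k <= b (k + m)%N.
  by elim: m => [|m IH]; rewrite ?addn0 // addnS; exact: le_trans (bS _).
have cm k m : c (k + m)%N <= c k.
  by elim: m => [|m IH]; rewrite ?addn0 // addnS; exact: le_trans (cS _) _.
have bcm k m : b k <= c m.
  apply: le_trans (bm k m) _; apply: le_trans (bc _) _.
  by rewrite addnC; exact: cm.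
have supb : has_sup (range b).
  by split; [exists (b 0), 0 | exists (c 0) => _ [k _ <-]].
exists (sup (range b)) => k; rewrite ler_distl; apply/andP; split.
  by apply: (ub_le_sup supb.2); exists k.
by apply: ge_sup => [|_ [m _ <-]]; [exact: supb.1|exact: bcm].
Qed.

Lemma half_pow_limit_vec n (a : nat -> 'rV[R]_n) (C : R) : 0 <= C ->
  (forall k, `|a k.+1 - a k| <= C * (2^-1) ^+ k) ->
  exists l, forall k, `|l - a k| <= 2 * C * (2^-1) ^+ k.
Proof.
move=> C0 aC.
have /choice [l lP] : forall j : 'I_n, exists l, forall k, `|l - a k 0 j| <= 2 * C * (2^-1) ^+ k.
  move=> j; apply: half_pow_limit => k; apply: le_trans (aC k).
  by have := mx_norm_coord (a k.+1 - a k) 0 j; rewrite !mxE.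
exists (\row_j l j) => k; apply: mx_norm_le => [|i j].
  by rewrite !mulr_ge0 // exprn_ge0.
by rewrite !mxE ord1; exact: lP.
Qed.

(** A quadratic bound on the remainder survives pointwise limits, which makes this the criterion for
    differentiating the limit of the Picard iterates. *)
Lemma is_derive_quadratic n (g : R -> 'rV[R]_n) t a (K d : R) : 0 < d -> 0 <= K ->
  (forall s, `|s| < d -> `|g (t + s) - g t - s *: a| <= K * `|s| * `|s|) ->
  is_derive t (1 : R) g a.
Proof.
move=> d0 K0 gP.
have cg : (fun h : R => h^-1 *: ((g \o shift t) (h *: (1 : R)) - g t)) @ 0^' --> a.
  apply/cvgrPdist_le => e e0; near=> s.
  have s0 : s != 0 by near: s; exact: nbhs_dnbhs_neq.
  have sd : `|s| < d by near: s; exact: dnbhs0_lt.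
  have se : `|s| < e / (K + 1) by near: s; apply: dnbhs0_lt; rewrite divr_gt0 // ltr_wpDl.
  have -> : a - s^-1 *: ((g \o shift t) (s *: (1 : R)) - g t) =
      - (s^-1 *: (g (t + s) - g t - s *: a)).
    by rewrite /= [s *: 1]mulr1 (addrC s) [in RHS]scalerBr scalerA mulVf // scale1r opprB.
  rewrite normrN normrZ normfV ler_pdivrMl ?normr_gt0 //.
  apply: le_trans (gP _ sd) _; rewrite mulrC ler_wpM2l //.
  apply: le_trans (_ : (K + 1) * `|s| <= _); first by rewrite ler_wpM2r // lerDl.
  by rewrite mulrC -ler_pdivlMr ?ltW // ltr_wpDl.
by split; [apply/cvg_ex; exists a|exact: cvg_lim cg].
Unshelve. all: by end_near. Qed.

Lemma is_deriveB_fun (V W : normedModType R) (f g : V -> W) x v df dg :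
  is_derive x v f df -> is_derive x v g dg ->
  is_derive x v (fun y => f y - g y) (df - dg).
Proof. exact: is_deriveB. Qed.

Lemma is_derive_scalel n (w : 'rV[R]_n) (t : R) :
  is_derive t (1 : R) (fun s : R => s *: w) w.
Proof.
apply: (@is_derive_quadratic n (fun s : R => s *: w) t w 0 1) => // s _.
by rewrite scalerDl addrAC addrK subrr normr0 !mul0r.
Qed.

(** The bound on [c t - x0] is part of the conclusion because [local_ode] uses it to keep the curve
    in the ball where the truncated field is the original one. *)
Lemma picard n (X : 'rV[R]_n -> 'rV[R]_n) x0 (L M : R) : 0 <= L -> 0 <= M ->
  (forall x y, `|X x - X y| <= L * `|x - y|) -> (forall x, `|X x| <= M) ->
  exists (c : R -> 'rV[R]_n) (d : R), [/\ 0 < d, c 0 = x0 &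
    forall t, `|t| < d -> is_derive t (1 : R) c (X (c t)) /\ `|c t - x0| <= M * `|t|].
Proof.
move=> L0 M0 lX bX.
have cX : continuous X.
  move=> x; exact: (@lipschitz_at_continuous R _ _ setT X L x openT I L0 (fun z _ => lX z x)).
pose Prim (f : R -> 'rV[R]_n) := xget (fun=> 0)
  [set F | F 0 = 0 /\ forall x, is_derive x (1 : R) F (f x)].
have PrimP f : continuous f ->
    Prim f 0 = 0 /\ forall x, is_derive x (1 : R) (Prim f) (f x).
  move=> /vector_antiderivative [F FP].
  exact: (@xgetPex _ _ [set F | F 0 = 0 /\ forall x, is_derive x (1 : R) F (f x)] (ex_intro _ F FP)).
pose u := fix u k : R -> 'rV[R]_n :=
  if k is k'.+1 then (fun t => x0 + Prim (fun s => X (u k' s)) t) else (fun=> x0).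
have deriv_cont (f f' : R -> 'rV[R]_n) : (forall t, is_derive t (1 : R) f (f' t)) -> continuous f.
  move=> df t; apply: differentiable_continuous; apply/derivable1_diffP.
  by have [] := df t.
have cXu k : continuous (u k) -> continuous (fun s => X (u k s)).
  by move=> cu t; apply: (@continuous_comp _ _ _ (u k) X); [exact: cu|exact: cX].
have uS k : continuous (u k) -> forall t, is_derive t (1 : R) (u k.+1) (X (u k t)).
  move=> cu t; have [_ /(_ t) D] := PrimP _ (cXu _ cu).
  rewrite -[X (u k t)]add0r.
  exact: (is_deriveD (is_derive_cst x0 t (1 : R)) D).
have cu k : continuous (u k).
  elim: k => [|k IH]; first exact: cst_continuous.
  exact: deriv_cont (uS k IH).
have {}uS k t : is_derive t (1 : R) (u k.+1) (X (u k t)) by exact: uS.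
have u0 k : u k 0 = x0.
  by case: k => // k /=; have [-> _] := PrimP _ (cXu _ (cu k)); rewrite addr0.
have uM k a b : `|u k b - u k a| <= M * `|b - a|.
  case: k => [|k]; first by rewrite /= subrr normr0 mulr_ge0.
  by apply: (@mvt_vec _ _ (u k.+1) (fun t => X (u k t))).
(* [L * d] is at most 1/2, so each step halves the distance between consecutive iterates; [+ 1]
   covers [L = 0]. *)
pose d := (2 * (L + 1))^-1.
have d0 : 0 < d by rewrite invr_gt0 mulr_gt0 // ltr_wpDl.
have Ld : L * d <= 2^-1.
  rewrite /d invfM mulrCA ler_piMr ?invr_ge0 // ler_pdivrMr ?ltr_wpDl // mul1r.
  by rewrite lerDl.
have uC k t : `|t| <= d -> `|u k.+1 t - u k t| <= M * d * (2^-1) ^+ k.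
  elim: k t => [|k IH] t td.
    rewrite expr0 mulr1; have := uM 1%N 0 t; rewrite u0 subr0.
    by move=> /le_trans; apply; rewrite ler_wpM2l.
  have := @mvt_vec _ _ (fun t => u k.+2 t - u k.+1 t)
    (fun t => X (u k.+1 t) - X (u k t)) 0 t (L * (M * d * (2^-1) ^+ k)).
  rewrite !u0 subrr !subr0.
  have c0 : 0 <= M * d * 2^-1 ^+ k by rewrite !mulr_ge0 ?exprn_ge0 ?(ltW d0).
  move=> H; apply: le_trans (H _ _ _) _.
  - by rewrite mulr_ge0.
  - move=> s /andP[s0 s1]; apply: le_trans (lX _ _) _; rewrite ler_wpM2l //.
    apply: IH; rewrite add0r normrM (ger0_norm s0) (le_trans _ td) //.
    by rewrite ler_piMl.
  - apply: le_trans (_ : L * (M * d * 2^-1 ^+ k) * d <= _).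
      by rewrite ler_wpM2l // mulr_ge0.
    rewrite exprS [leRHS]mulrCA.
    have -> : L * (M * d * 2^-1 ^+ k) * d = L * d * (M * d * 2^-1 ^+ k) by ring.
    exact: ler_wpM2r.
have /choice [c cP] : forall t, exists l, `|t| <= d -> forall k,
    `|l - u k t| <= 2 * (M * d) * (2^-1) ^+ k.
  move=> t; have [td|td] := leP `|t| d; last by exists 0.
  have [l lP] := @half_pow_limit_vec n (fun k => u k t) (M * d) (mulr_ge0 M0 (ltW d0)) (fun k => uC k t td).
  by exists l.
have Md0 : 0 <= 2 * (M * d) by rewrite !mulr_ge0 ?(ltW d0).
have c0 : c 0 = x0.
  apply/eqP; rewrite -subr_eq0 -normr_le0; apply: (@le_half_pow _ _ (2 * (M * d))) => k.
  by rewrite add0r -(u0 k); apply: cP; rewrite normr0 ltW.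
exists c, d; split => // t td; split; last first.
  apply: (@le_half_pow _ _ (2 * (M * d))) => k.
  have := ler_normD (c t - u k t) (u k t - u k 0); rewrite subrKA u0 => /le_trans; apply.
  rewrite addrC lerD ?cP ?(ltW td) //; have := uM k 0 t; rewrite u0 subr0; exact.
have dt0 : 0 < d - `|t| by rewrite subr_gt0.
(* The remainder is estimated on the iterate [u k.+1], whose derivative [X (u k r)] differs from
   [X (c t)] by at most [L * M * |s|] plus a multiple of 2^-k. Letting [k] grow leaves
   [L * M * |s| * |s|]. *)
apply: (@is_derive_quadratic _ c t _ (L * M) (d - `|t|)) => //; first exact: mulr_ge0.
move=> s sd.
have tsd : `|t + s| <= d.
  by apply: le_trans (ler_normD _ _) _; move: sd; rewrite ltrBrDl; exact: ltW.
apply: (@le_half_pow _ _ (`|s| * L * (2 * (M * d)) + 2 * (2 * (M * d)))) => k.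
have H := @mvt_vec _ _ (fun r => u k.+1 r - r *: X (c t)) (fun r => X (u k r) - X (c t))
  t (t + s) (L * (M * `|s| + 2 * (M * d) * (2^-1) ^+ k)).
have C0 : 0 <= 2 * (M * d) * (2^-1) ^+ k by rewrite mulr_ge0 // exprn_ge0.
have {H} : `|u k.+1 (t + s) - (t + s) *: X (c t) - (u k.+1 t - t *: X (c t))| <=
    L * (M * `|s| + 2 * (M * d) * (2^-1) ^+ k) * `|s|.
  rewrite (addrC t s) addrK (addrC s t) in H; apply: H.
  - by rewrite mulr_ge0 // addr_ge0 // mulr_ge0.
  - by move=> r _; exact: (is_deriveB_fun (uS k _) (is_derive_scalel _ _)).
  - move=> r /andP[r0 r1]; apply: le_trans (lX _ _) _; rewrite ler_wpM2l //.
    have := ler_normD (u k (t + r * s) - u k t) (u k t - c t); rewrite subrKA.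
    move=> /le_trans; apply; apply: lerD; last by rewrite distrC cP // ltW.
    apply: le_trans (uM _ _ _) _; rewrite ler_wpM2l // addrC addKr normrM (ger0_norm r0).
    by rewrite ler_piMl.
set A := u k.+1 (t + s) - _ - _.
have -> : A = (u k.+1 (t + s) - u k.+1 t) - s *: X (c t).
  by apply/rowP => j; rewrite /A !mxE; ring.
move=> H.
have e2 : `|c (t + s) - c t - s *: X (c t)| <=
    `|u k.+1 (t + s) - u k.+1 t - s *: X (c t)| +
    (`|c (t + s) - u k.+1 (t + s)| + `|c t - u k.+1 t|).
  have -> : c (t + s) - c t - s *: X (c t) =
    (u k.+1 (t + s) - u k.+1 t - s *: X (c t)) +
    ((c (t + s) - u k.+1 (t + s)) - (c t - u k.+1 t)).
    by apply/rowP => j; rewrite !mxE; ring.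
  by apply: le_trans (ler_normD _ _) _; rewrite lerD2l ler_normB.
have h1 : (2^-1) ^+ k.+1 <= (2^-1) ^+ k :> R.
  by rewrite exprS ler_piMl ?exprn_ge0 // invf_le1 // ler1n.
have h2 := cP _ tsd k.+1; have h3 := cP _ (ltW td) k.+1.
have h4 : 2 * (M * d) * (2^-1) ^+ k.+1 <= 2 * (M * d) * (2^-1) ^+ k by rewrite ler_wpM2l.
apply: le_trans e2 _.
have -> : L * M * `|s| * `|s| +
    (`|s| * L * (2 * (M * d)) + 2 * (2 * (M * d))) * 2^-1 ^+ k =
    L * (M * `|s| + 2 * (M * d) * 2^-1 ^+ k) * `|s| +
    (2 * (M * d) * 2^-1 ^+ k + 2 * (M * d) * 2^-1 ^+ k) by ring.
apply: lerD => //; apply: lerD; [exact: le_trans h2 h4|exact: le_trans h3 h4].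
Qed.

(* Composing with clamp makes a field that is Lipschitz on the ball of radius r
   around x0 globally Lipschitz. *)
Definition clamp n (x0 : 'rV[R]_n) (r : R) (x : 'rV[R]_n) : 'rV[R]_n :=
  \row_j Num.max (x0 0 j - r) (Num.min (x0 0 j + r) (x 0 j)).

Lemma clamp_ball n (x0 : 'rV[R]_n) r x : 0 <= r -> `|clamp x0 r x - x0| <= r.
Proof.
move=> r0; apply: mx_norm_le => // i j; rewrite !mxE ord1.
by rewrite ler_distl le_max lexx /= ge_max ge_min lexx /= andbT; lra.
Qed.

Lemma max_lipschitz (a x y : R) : `|Num.max a x - Num.max a y| <= `|x - y|.
Proof.
have := ler_norm (x - y); have := ler_norm (y - x).
rewrite (distrC y) => A1 A2; rewrite ler_norml.
by case: (leP a x) => H1; case: (leP a y) => H2; apply/andP; split;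
  move: A1 A2 H1 H2; lra.
Qed.

Lemma min_lipschitz (a x y : R) : `|Num.min a x - Num.min a y| <= `|x - y|.
Proof.
have := ler_norm (x - y); have := ler_norm (y - x).
rewrite (distrC y) => A1 A2; rewrite ler_norml.
by case: (leP a x) => H1; case: (leP a y) => H2; apply/andP; split;
  move: A1 A2 H1 H2; lra.
Qed.

Lemma clamp_lipschitz n (x0 : 'rV[R]_n) r x y :
  `|clamp x0 r x - clamp x0 r y| <= `|x - y|.
Proof.
apply: mx_norm_le => // i j; rewrite !mxE.
have := mx_norm_coord (x - y) i j; rewrite !mxE ord1; apply: le_trans.
exact: le_trans (max_lipschitz _ _ _) (min_lipschitz _ _ _).
Qed.

Lemma clamp_id n (x0 : 'rV[R]_n) r x : `|x - x0| <= r -> clamp x0 r x = x.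
Proof.
move=> xr; apply/rowP => j; rewrite mxE.
have := le_trans (mx_norm_coord _ 0 j) xr; rewrite !mxE ler_distl => /andP[A1 A2].
by rewrite min_r // max_r.
Qed.

(** Bootstrapping: if [c] is C^k, so is its derivative [X (c t)]. *)
Lemma integral_curve_smooth n (X : 'rV[R]_n -> 'rV[R]_n) U (c : R -> 'rV[R]_n) (I : set R) :
  open U -> smooth_on U X -> open I ->
  (forall t, I t -> U (c t) /\ is_derive t (1 : R) c (X (c t))) -> smooth_on I c.
Proof.
move=> oU sX oI cP.
have cc t : I t -> {for t, continuous c}.
  move=> /cP [_ [d _]].
  by apply: differentiable_continuous; apply/derivable1_diffP.
case=> [|k]; first by split.
elim: k.+1 => [|{}k IH]; first by split.
apply: (@CkS_intro R R _ k I c (fun v t : R => v *: X (c t))) => //.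
- move=> v t It; have [Uct [d <-]] := cP _ It.
  have := is_derive_scale v d; rewrite [v *: 1]mulr1; exact.
- move=> v; apply: CkZ => //.
  apply: (Ck_comp_mx oI oU _ IH (sX k)) => t It; by have [] := cP _ It.
Qed.

Lemma local_ode n (X : 'rV[R]_n -> 'rV[R]_n) U x0 : open U -> U x0 -> smooth_on U X ->
  exists (c : R -> 'rV[R]_n) (d : R), [/\ 0 < d, c 0 = x0 &
    forall t, `|t| < d -> [/\ U (c t), is_derive t (1 : R) c (X (c t)) &
      smooth_near t c]].
Proof.
move=> oU Ux sX.
have sXij j : smooth_near x0 (fun x => X x 0 j).
  have : smooth_near x0 X by exists U.
  by move/smooth_near_mxP; exact.
(* One constant for all partial derivatives: near [x0] each exceeds its absolute value at [x0] by at
   most 1. *)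
pose B : R := \sum_i \sum_j `|'D_(delta_mx 0 i) (fun x => X x 0 j) x0| + 1.
have near1 (g : 'rV[R]_n -> R) : {for x0, continuous g} ->
    \forall x \near x0, `|g x| <= `|g x0| + 1.
  move=> /cvgrPdist_le /(_ 1 ltr01); apply: filterS => x.
  have := ler_normB (g x0) (g x0 - g x); rewrite opprB addrC subrK.
  by move=> H1 H2; apply: le_trans H1 _; rewrite lerD2l.
have nD : \forall x \near x0, forall ij : 'I_n * 'I_n,
    `|'D_(delta_mx 0 ij.1) (fun x => X x 0 ij.2) x| <= B.
  near=> x; move=> ij; move: ij; near: x; apply: filter_forall => -[i j] /=.
  have := near1 _ (smooth_near_continuous (@smooth_near_derive _ _ _ _ _ (delta_mx 0 i) (sXij j))).
  apply: filterS => x /le_trans; apply; rewrite lerD2r.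
  rewrite (bigD1 i) //= (bigD1 j) //= -addrA lerDl addr_ge0 ?sumr_ge0 // => k _.
  exact: sumr_ge0.
have nX : \forall x \near x0, `|X x| <= `|X x0| + 1.
  have : smooth_near x0 X by exists U.
  move=> /smooth_near_continuous /cvgrPdist_le /(_ 1 ltr01); apply: filterS => x.
  have := ler_normB (X x0) (X x0 - X x); rewrite opprB addrC subrK.
  by move=> H1 H2; apply: le_trans H1 _; rewrite lerD2l.
have nU : \forall x \near x0, [/\ U x, `|X x| <= `|X x0| + 1 & forall ij : 'I_n * 'I_n,
    `|'D_(delta_mx 0 ij.1) (fun x => X x 0 ij.2) x| <= B].
  by apply: filterS3 (open_nbhs_nbhs (conj oU Ux)) nX nD => x; split.
have /nbhs_normP [r' /= r'0 r'P] := nU.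
pose r := r' / 2; have r0 : 0 < r by rewrite divr_gt0.
have rP x : `|x - x0| <= r -> [/\ U x, `|X x| <= `|X x0| + 1 & forall ij : 'I_n * 'I_n,
    `|'D_(delta_mx 0 ij.1) (fun x => X x 0 ij.2) x| <= B].
  move=> xr; apply: r'P; rewrite /= distrC; apply: le_lt_trans xr _.
  by rewrite /r ltr_pdivrMr // ltr_pMr // ltr1n.
have B0 : 0 <= B by rewrite addr_ge0 // sumr_ge0 // => i _; exact: sumr_ge0.
have lX : forall x y, `|x - x0| <= r -> `|y - x0| <= r -> `|X x - X y| <= n%:R * B * `|x - y|.
  apply: (ball_lipschitz oU (sX 1) B0) => x /rP [Ux' _ D].
  by split=> // i j; exact: (D (i, j)).
pose XX x := X (clamp x0 r x).
have lXX x y : `|XX x - XX y| <= n%:R * B * `|x - y|.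
  apply: le_trans (lX _ _ _ _) _; rewrite ?clamp_ball ?(ltW r0) //.
  by rewrite ler_wpM2l ?mulr_ge0 // clamp_lipschitz.
have bXX x : `|XX x| <= `|X x0| + 1.
  by have [|_ + _] := rP (clamp x0 r x); first by rewrite clamp_ball // ltW.
have M0 : 0 < `|X x0| + 1 by rewrite ltr_wpDl.
have nB0 : 0 <= n%:R * B by rewrite mulr_ge0.
have [c [d [d0 c0 cP]]] := @picard n XX x0 _ _ nB0 (ltW M0) lXX bXX.
(* At speed at most [|X x0| + 1] the curve does not leave the ball of radius [r] in this time, and
   there [clamp] is the identity. *)
pose d' := Num.min d (r / (`|X x0| + 1)).
have d'0 : 0 < d' by rewrite lt_min d0 divr_gt0.
have cP' t : `|t| < d' -> U (c t) /\ is_derive t (1 : R) c (X (c t)).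
  rewrite lt_min => /andP[td tr]; have [Dc bc] := cP _ td.
  have cr : `|c t - x0| <= r.
    by apply: le_trans bc _; rewrite mulrC -ler_pdivlMr // ltW.
  have [Uc _ _] := rP _ cr; split=> //.
  by move: Dc; rewrite /XX clamp_id.
have oI : open [set t : R | `|t| < d'].
  have -> : [set t : R | `|t| < d'] = (fun t : R => `|t|) @^-1` [set u | u < d'] by [].
  by apply: open_comp; [move=> x _; exact: norm_continuous|exact: open_lt].
exists c, d'; split => // t td; have [Uc Dc] := cP' _ td; split=> //.
exists [set t : R | `|t| < d']; split=> //.
by apply: integral_curve_smooth oI _; [exact: oU|exact: sX|exact: cP'].
Unshelve. all: by end_near. Qed.

(* With K = n |C|, on |t| <= e with e (K + 1) <= 1/2 the supremum norm of a
   solution starting at 0 is at most half of itself. *)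
Lemma linear_ode_unique n (C : 'M[R]_n) (D : R -> 'M[R]_n) (d : R) : 0 < d -> D 0 = 0 ->
  (forall t, `|t| < d -> is_derive t (1 : R) D (D t *m C)) ->
  exists2 e, 0 < e & forall t, `|t| < e -> D t = 0.
Proof.
move=> d0 D0 DD.
have cD : {for (0 : R), continuous D}.
  apply: differentiable_continuous; apply/derivable1_diffP.
  by have [|] := DD 0; rewrite ?normr0.
pose K := n%:R * `|C|.
have K0 : 0 <= K by rewrite mulr_ge0.
have DK t : `|D t *m C| <= K * `|D t|.
  apply: mx_norm_le => [|i j]; first by rewrite mulr_ge0.
  rewrite mxE; apply: le_trans (ler_norm_sum _ _ _) _.
  apply: (@le_trans _ _ (\sum_(k < n) `|D t| * `|C|)).
    by apply: ler_sum => k _; rewrite normrM ler_pM // mx_norm_coord.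
  rewrite sumr_const card_ord -[_ *+ n]mulr_natr.
  by have -> : `|D t| * `|C| * n%:R = K * `|D t| by rewrite /K; ring.
have : \forall t \near (0 : R), `|D t| <= 1.
  have /cvgrPdist_le /(_ 1 ltr01) := cD; apply: filterS => t.
  by rewrite D0 sub0r normrN.
move=> /nbhs_normP [r /= r0 rP].
pose e := Num.min (Num.min d r) (2 * (K + 1))^-1.
have K1 : 0 < K + 1 by rewrite ltr_wpDl.
have e0 : 0 < e by rewrite !lt_min d0 r0 invr_gt0 mulr_gt0.
exists e => // t te; apply/eqP; rewrite -normr_le0.
apply: (@le_half_pow _ _ 1) => k; rewrite add0r mul1r.
elim: k t te => [|k IH] t te.
  rewrite expr0; apply: rP; rewrite /= sub0r normrN.
  by move: te; rewrite !lt_min => /andP[/andP[]].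
have te' (s : R) : 0 <= s <= 1 -> `|s * t| < e.
  move=> /andP[s0 s1]; rewrite normrM (ger0_norm s0) (le_lt_trans _ te) //.
  by rewrite ler_piMl.
have := @mvt_vec _ _ D (fun t => D t *m C) 0 t (K * (2^-1) ^+ k).
rewrite D0 !subr0 => H; apply: le_trans (H _ _ _) _.
- by rewrite mulr_ge0 // exprn_ge0.
- move=> s s01; rewrite add0r; apply: DD.
  by have := te' s s01; rewrite !lt_min => /andP[/andP[]].
- move=> s s01; apply: le_trans (DK _) _; rewrite ler_wpM2l //.
  by apply: IH; rewrite add0r; exact: te'.
- rewrite exprS mulrAC ler_wpM2r ?exprn_ge0 //.
  have te2 : `|t| <= (2 * (K + 1))^-1.
    by move: te; rewrite !lt_min => /andP[_ /ltW].
  apply: le_trans (_ : (K + 1) * `|t| <= _); first by rewrite ler_wpM2r // lerDl.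
  apply: le_trans (_ : (K + 1) * (2 * (K + 1))^-1 <= _); first by rewrite ler_wpM2l // ltW.
  by rewrite invfM mulrCA divff ?gt_eqF // mulr1.
Qed.

End ODE.

(** * Charts and tangent vectors *)

Section Charts.
Context {R : realType} {M : manifold4Type R}.
Implicit Types (p q : M) (c d : chart R M) (f g : M -> R).

Lemma chart_exists p : exists c : chart R M, chart_at p c.
Proof. by have [c ac cp] := @atlas_cover R M p; exists c. Qed.

Lemma chart_at_near p c : chart_at p c -> \forall q \near p, chart_at q c.
Proof.
move=> [ac cp]; apply: filterS (open_nbhs_nbhs (conj (@cdom_open _ _ c) cp)) => q cq.
by split.
Qed.

Lemma near_cinv p c (P : M -> Prop) : chart_at p c -> (\forall q \near p, P q) ->
  \forall x \near cfun c p, P (cinv c x).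
Proof.
move=> [_ cp]; rewrite -{1}(cfunK cp) => nP.
by apply: (@cinv_continuous _ _ c (cfun c p)); [exists p|].
Qed.

Lemma near_cfun p c (P : 'rV[R]_4 -> Prop) : chart_at p c ->
  (\forall x \near cfun c p, P x) -> \forall q \near p, P (cfun c q).
Proof. by move=> [_ cp] nP; exact: (@cfun_continuous _ _ c p cp). Qed.

Lemma cinvK_near p c : chart_at p c ->
  \forall x \near cfun c p, cdom c (cinv c x) /\ cfun c (cinv c x) = x.
Proof.
move=> [_ cp].
have : nbhs (cfun c p) (cfun c @` cdom c).
  by apply: open_nbhs_nbhs; split; [exact: cimg_open|exists p].
by apply: filterS => _ [q cq <-]; rewrite cfunK.
Qed.

Lemma smooth_transition p c d : chart_at p c -> chart_at p d ->
  smooth_near (cfun c p) (fun x => cfun d (cinv c x)).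
Proof.
(* The interior is open by construction; it remains to see that the image of the overlap is a
   neighbourhood of [cfun c p]. *)
move=> cp dp; exists (interior (cfun c @` (cdom c `&` cdom d))).
split; first exact: open_interior.
  have nd : \forall q \near p, cdom d q.
    by apply: filterS (chart_at_near dp) => q [].
  apply: filterS2 (cinvK_near cp) (near_cinv cp nd) => x [cx xE] dx.
  by exists (cinv c x).
move=> k; apply: (Ck_sub _ (atlas_compat _ _ cp.1 dp.1 k)).
exact: interior_subset.
Qed.

(** [smooth_fun_at] quantifies over all charts at [p]; the transition maps reduce it to one. *)
Lemma smooth_fun_chart p c f : chart_at p c -> smooth_near (cfun c p) (fun x => f (cinv c x)) ->
  smooth_fun_at p f.
Proof.
move=> cp sf d dp.
have : smooth_near (cfun d p) (fun x => (fun x => f (cinv c x)) (cfun c (cinv d x))).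
  apply: (@smooth_near_compR R _ 4 (cfun d p) (fun x => cfun c (cinv d x))
      (fun x => f (cinv c x))).
    exact: smooth_transition.
  by rewrite cfunK //; case: dp.
apply: smooth_near_ext.
have nc : \forall q \near p, cdom c q by apply: filterS (chart_at_near cp) => q [].
by apply: filterS (near_cinv dp nc) => x cx /=; rewrite cfunK.
Qed.

Lemma smooth_fun_ext p f g : (\forall q \near p, f q = g q) ->
  smooth_fun_at p f -> smooth_fun_at p g.
Proof.
move=> fg sf c cp; apply: smooth_near_ext (sf c cp).
exact: (near_cinv cp fg).
Qed.

Lemma smooth_fun_near p f : smooth_fun_at p f -> \forall q \near p, smooth_fun_at q f.
Proof.
move=> sf; have [c cp] := chart_exists p.
have := near_cfun cp (smooth_near_near (sf c cp)).
by apply: filterS2 (chart_at_near cp) => q cq; exact: smooth_fun_chart.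
Qed.

Lemma smooth_fun_cst p (a : R) : smooth_fun_at p (fun=> a).
Proof. by move=> c cp; exact: smooth_near_cst. Qed.

Lemma smooth_funD p f g : smooth_fun_at p f -> smooth_fun_at p g ->
  smooth_fun_at p (fun q => f q + g q).
Proof. by move=> sf sg c cp; apply: smooth_nearD; [exact: sf|exact: sg]. Qed.

Lemma smooth_funB p f g : smooth_fun_at p f -> smooth_fun_at p g ->
  smooth_fun_at p (fun q => f q - g q).
Proof. by move=> sf sg c cp; apply: smooth_nearB; [exact: sf|exact: sg]. Qed.

Lemma smooth_funM p f g : smooth_fun_at p f -> smooth_fun_at p g ->
  smooth_fun_at p (fun q => f q * g q).
Proof. by move=> sf sg c cp; apply: smooth_nearM; [exact: sf|exact: sg]. Qed.

Lemma smooth_funZ p (a : R) f : smooth_fun_at p f -> smooth_fun_at p (fun q => a * f q).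
Proof. by move=> sf; apply: smooth_funM => //; exact: smooth_fun_cst. Qed.

Lemma smooth_fun_sum p (I : finType) (f : I -> M -> R) :
  (forall i, smooth_fun_at p (f i)) -> smooth_fun_at p (fun q => \sum_i f i q).
Proof. by move=> sf c cp; apply: smooth_near_sum => i; exact: sf. Qed.

Lemma smooth_fun_invmx p n (A : M -> 'M[R]_n) i j :
  (forall i j, smooth_fun_at p (fun q => A q i j)) -> A p \in unitmx ->
  smooth_fun_at p (fun q => invmx (A q) i j).
Proof.
move=> sA uA c cp; apply: (@smooth_near_invmx _ _ _ _ (fun x => A (cinv c x))).
  by move=> k l; exact: sA.
by rewrite cfunK //; case: cp.
Qed.

Definition chart_coord c (j : 'I_4) : M -> R := fun q => cfun c q 0 j.

Lemma smooth_fun_coord p c j : chart_at p c -> smooth_fun_at p (chart_coord c j).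
Proof.
move=> cp; apply: (smooth_fun_chart cp).
apply: smooth_near_ext (smooth_near_coord 0 j (cfun c p)).
by apply: filterS (cinvK_near cp) => x [_ xE]; rewrite /chart_coord xE.
Qed.

Definition chart_vec p c (xi : 'rV[R]_4) : operator R M :=
  at_germs p (fun f => 'D_xi (fun x => f (cinv c x)) (cfun c p)).

Lemma at_germsE p (v : operator R M) f : smooth_fun_at p f -> at_germs p v f = v f.
Proof. by move=> sf; rewrite /at_germs asboolT. Qed.

Lemma at_germs_out p (v : operator R M) f : ~ smooth_fun_at p f -> at_germs p v f = 0.
Proof. by move=> sf; rewrite /at_germs asboolF. Qed.

Lemma at_germs_eq p (v w : operator R M) : (forall f, smooth_fun_at p f -> v f = w f) ->
  at_germs p v = at_germs p w.
Proof.
move=> vw; apply/funext => f; have [sf|sf] := pselect (smooth_fun_at p f).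
  by rewrite !at_germsE ?vw.
by rewrite !at_germs_out.
Qed.

Lemma chart_vec_tangent p c xi : chart_at p c -> tangent p (chart_vec p c xi).
Proof. by move=> cp; exists c, xi. Qed.

Lemma chart_vec_coord p c xi j : chart_at p c -> chart_vec p c xi (chart_coord c j) = xi 0 j.
Proof.
move=> cp; rewrite /chart_vec at_germsE; last exact: smooth_fun_coord.
pose L : {linear 'rV[R]_4 -> R} := HB.pack (fun x : 'rV[R]_4 => x 0 j)
  (GRing.isLinear.Build _ _ _ _ (fun x : 'rV[R]_4 => x 0 j)
     (fun a u v => (etrans (mxE _ _ _ _) (congr1 (fun z => z + v 0 j) (mxE _ _ _ _))))).
have [_ DL] := @is_derive_lin R _ _ L (cfun c p) xi (@coord_continuous _ _ _ 0 j).
rewrite -[RHS]/(L xi) -DL; apply: near_eq_derive; apply: filterS (cinvK_near cp) => x [_ xE].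
by rewrite /chart_coord xE.
Qed.

Lemma tangent_chart_vec p c v : chart_at p c -> tangent p v ->
  v = chart_vec p c (\row_j v (chart_coord c j)).
(* The chain rule for the transition map converts components in the chart [d] into components in
   [c]. Hence four values determine a tangent vector, and a chart can be fixed independently of the
   vector. *)
Proof.
move=> cp [d [xi [dp ->]]]; rewrite -/(chart_vec p d xi).
set eta := \row_j _.
apply/at_germs_eq => f sf.
have sfc := sf c cp.
have st := smooth_transition dp cp.
have sfc' : smooth_near ((fun x => cfun c (cinv d x)) (cfun d p)) (fun x => f (cinv c x)).
  by rewrite cfunK //; case: dp.
have [_ D] := smooth_near_chain sfc' (@smooth_near_derivable R _ _ _ _ xi st).
have -> : 'D_xi (fun x => f (cinv d x)) (cfun d p) =
    'D_xi (fun y => (fun x => f (cinv c x)) (cfun c (cinv d y))) (cfun d p).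
  apply: near_eq_derive.
  have nc : \forall q \near p, cdom c q by apply: filterS (chart_at_near cp) => q [].
  by apply: filterS (near_cinv dp nc) => x cx /=; rewrite cfunK.
rewrite {}D cfunK; last by case: dp.
rewrite (smooth_near_dir_sum eta sfc); apply: eq_bigr => j _; congr (_ * _).
rewrite /eta mxE /chart_vec at_germsE; last exact: smooth_fun_coord.
by rewrite derive_mx ?mxE //; exact: smooth_near_derivable.
Qed.

Lemma chart_vecE p c xi f : smooth_fun_at p f ->
  chart_vec p c xi f = 'D_xi (fun x => f (cinv c x)) (cfun c p).
Proof. by move=> sf; rewrite /chart_vec at_germsE. Qed.

Lemma chart_vec_lin p c (a : R) xi eta : chart_at p c ->
  chart_vec p c (a *: xi + eta) = a *: chart_vec p c xi + chart_vec p c eta.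
Proof.
move=> cp; apply/funext => f; rewrite -[RHS]/(a * chart_vec p c xi f + chart_vec p c eta f).
have [sf|sf] := pselect (smooth_fun_at p f).
  by rewrite !chart_vecE // smooth_near_dirP //; exact: sf.
by rewrite /chart_vec !at_germs_out // mulr0 addr0.
Qed.

Lemma tangent_out p v f : tangent p v -> ~ smooth_fun_at p f -> v f = 0.
Proof. by move=> [c [xi [_ ->]]] sf; rewrite at_germs_out. Qed.

Lemma tangent_lin p v w (a : R) : tangent p v -> tangent p w -> tangent p (a *: v + w).
Proof.
have [c cp] := chart_exists p => tv tw.
rewrite (tangent_chart_vec cp tv) (tangent_chart_vec cp tw) -chart_vec_lin //.
exact: chart_vec_tangent.
Qed.

Lemma tangent0 p : tangent p 0.
Proof.
have [c cp] := chart_exists p.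
suff -> : (0 : operator R M) = chart_vec p c 0 by exact: chart_vec_tangent.
apply/funext => f; have [sf|sf] := pselect (smooth_fun_at p f).
  by rewrite chart_vecE // derive0.
by rewrite /chart_vec at_germs_out.
Qed.

Lemma tangent_sum p (I : finType) (a : I -> R) (v : I -> operator R M) :
  (forall i, tangent p (v i)) -> tangent p (\sum_i a i *: v i).
Proof.
move=> tv; elim/big_ind : _ => [|u w tu tw|i _]; first exact: tangent0.
  by have := tangent_lin 1 tu tw; rewrite scale1r.
by have := tangent_lin (a i) (tv i) (tangent0 p); rewrite addr0.
Qed.

(** No smoothness is assumed: it depends on the germ only, so [f] and [g] are either both smooth at
    [p] or both sent to 0. *)
Lemma tangent_local p v f g : tangent p v -> (\forall q \near p, f q = g q) -> v f = v g.
Proof.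
move=> tv fg; have [c cp] := chart_exists p; rewrite (tangent_chart_vec cp tv).
have [sf|sf] := pselect (smooth_fun_at p f).
  rewrite !chart_vecE //; last exact: smooth_fun_ext sf.
  by apply: near_eq_derive; exact: (near_cinv cp fg).
rewrite /chart_vec !at_germs_out // => sg; apply: sf; apply: smooth_fun_ext sg.
by apply: filterS fg.
Qed.

Lemma tangent_fun_lin p v f g (a : R) : tangent p v -> smooth_fun_at p f -> smooth_fun_at p g ->
  v (fun q => a * f q + g q) = a * v f + v g.
Proof.
move=> tv sf sg; have [c cp] := chart_exists p; rewrite (tangent_chart_vec cp tv).
rewrite !chart_vecE //; last by apply: smooth_funD => //; exact: smooth_funZ.
have d1 := @smooth_near_derivable _ _ _ _ _ (\row_j v (chart_coord c j)) (sf c cp).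
have d2 := @smooth_near_derivable _ _ _ _ _ (\row_j v (chart_coord c j)) (sg c cp).
by have [_ ->] := is_deriveD (is_deriveZ a (derivableP d1)) (derivableP d2).
Qed.

Lemma tangent_fun_cst p v (a : R) : tangent p v -> v (fun=> a) = 0.
Proof.
move=> tv; have [c cp] := chart_exists p; rewrite (tangent_chart_vec cp tv).
by rewrite chart_vecE ?derive_cst //; exact: smooth_fun_cst.
Qed.

Lemma tangent_fun_sum p v (I : finType) (a : I -> R) (f : I -> M -> R) : tangent p v ->
  (forall i, smooth_fun_at p (f i)) ->
  v (fun q => \sum_i a i * f i q) = \sum_i a i * v (f i).
Proof.
move=> tv sf.
suff H (r : seq I) : smooth_fun_at p (fun q => \sum_(i <- r) a i * f i q) /\
    v (fun q => \sum_(i <- r) a i * f i q) = \sum_(i <- r) a i * v (f i).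
  by have [_] := H (index_enum I).
elim: r => [|i r [IH1 IH2]].
  under eq_fun do rewrite big_nil; rewrite big_nil (tangent_fun_cst _ tv).
  by split=> //; exact: smooth_fun_cst.
under eq_fun do rewrite big_cons; rewrite big_cons; split.
  by apply: smooth_funD => //; exact: smooth_funZ.
by rewrite (tangent_fun_lin _ tv (sf i) IH1) IH2.
Qed.

Lemma tangent_funM p v f g : tangent p v -> smooth_fun_at p f -> smooth_fun_at p g ->
  v (fun q => f q * g q) = f p * v g + g p * v f.
Proof.
move=> tv sf sg; have [c cp] := chart_exists p; rewrite (tangent_chart_vec cp tv).
rewrite !chart_vecE //; last exact: smooth_funM.
have d1 := @smooth_near_derivable _ _ _ _ _ (\row_j v (chart_coord c j)) (sf c cp).
have d2 := @smooth_near_derivable _ _ _ _ _ (\row_j v (chart_coord c j)) (sg c cp).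
have [_ ->] := is_deriveM (derivableP d1) (derivableP d2).
by rewrite /= cfunK //; case: cp.
Qed.

End Charts.

(** Product rule for a moving direction. Symmetry of second derivatives puts the second-order term
    in the form that cancels in a commutator. *)
Lemma derive_dir_field (R : realType) n (F : 'rV[R]_n -> R) (b : 'rV[R]_n -> 'rV[R]_n) x u :
  smooth_near x F -> smooth_near x b ->
  'D_u (fun y => 'D_(b y) F y) x = 'D_('D_u b x) F x + 'D_(b x) (fun y => 'D_u F y) x.
Proof.
move=> sF sb; pose ev j := delta_mx (0 : 'I_1) j : 'rV[R]_n.
have sbj j : smooth_near x (fun y => b y 0 j) by move/smooth_near_mxP : sb; exact.
have sFj j : smooth_near x (fun y => 'D_(ev j) F y) by exact: smooth_near_derive.
have -> : 'D_u (fun y => 'D_(b y) F y) x =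
    'D_u (\sum_j (fun y => b y 0 j * 'D_(ev j) F y)) x.
  apply: near_eq_derive; apply: filterS (smooth_near_near sF) => y sFy.
  by rewrite fct_sumE (smooth_near_dir_sum _ sFy).
rewrite derive_sum => [|j]; last first.
  by apply: smooth_near_derivable; exact: smooth_nearM.
have sDu : smooth_near x (fun y => 'D_u F y) by exact: smooth_near_derive.
rewrite (smooth_near_dir_sum _ sF) (smooth_near_dir_sum _ sDu) -big_split /=.
apply: eq_bigr => j _.
have d1 := derivableP (@smooth_near_derivable _ _ _ _ _ u (sbj j)).
have d2 := derivableP (@smooth_near_derivable _ _ _ _ _ u (sFj j)).
have [_ ->] := is_deriveM d1 d2.
rewrite (derive_mx (@smooth_near_derivable _ _ _ _ _ u sb)) mxE.
have E : 'D_u (fun y => 'D_(ev j) F y) x = 'D_(ev j) (fun y => 'D_u F y) x.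
  exact: smooth_near_comm.
rewrite {}E addrC; congr (_ + _).
by rewrite -[LHS]/(_ * _) mulrC.
Qed.

(** * Lie brackets *)

Section Brackets.
Context {R : realType} {M : manifold4Type R}.
Implicit Types (p q : M) (c : chart R M) (f g : M -> R) (X Y Z : vfield R M).

Lemma lie_bracketE p X Y f : smooth_fun_at p f ->
  lie_bracket X Y p f = X p (fun q => Y q f) - Y p (fun q => X q f).
Proof. by move=> sf; rewrite /lie_bracket at_germsE. Qed.

Definition chart_field c X (x : 'rV[R]_4) : 'rV[R]_4 := \row_j X (cinv c x) (chart_coord c j).

Lemma smooth_vfield_tangent p X : smooth_vfield_at p X -> tangent p (X p).
Proof. by case. Qed.

Lemma chart_field_smooth p c X : chart_at p c -> smooth_vfield_at p X ->
  smooth_near (cfun c p) (chart_field c X).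
Proof.
move=> cp [_ sX]; apply/smooth_near_mxP => i j.
apply: smooth_near_eq (sX _ (smooth_fun_coord j cp) c cp) => x /=.
by rewrite mxE.
Qed.

Lemma vfield_chartE p c X f : chart_at p c -> tangent p (X p) -> smooth_fun_at p f ->
  X p f = 'D_(chart_field c X (cfun c p)) (fun x => f (cinv c x)) (cfun c p).
Proof.
move=> cp tX sf; have := congr1 (fun v => v f) (tangent_chart_vec cp tX).
rewrite /= => ->; rewrite (chart_vecE _ _ sf).
by congr ('D_ _ _ _); apply/rowP => j; rewrite !mxE cfunK //; case: cp.
Qed.

Lemma vfield_twice p c X Y f : chart_at p c -> smooth_vfield_at p X ->
  (\forall q \near p, smooth_vfield_at q Y) -> smooth_fun_at p f ->
  let x := cfun c p in let F := fun x => f (cinv c x) in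
  X p (fun q => Y q f) =
  'D_('D_(chart_field c X x) (chart_field c Y) x) F x +
  'D_(chart_field c Y x) (fun y => 'D_(chart_field c X x) F y) x.
Proof.
move=> cp sX nY sf x F.
have sY := nbhs_singleton nY.
have sYf : smooth_fun_at p (fun q => Y q f) by exact: sY.2.
rewrite (vfield_chartE cp (smooth_vfield_tangent sX) sYf) -derive_dir_field.
- apply: near_eq_derive.
  apply: filterS3 (cinvK_near cp) (near_cinv cp nY)
    (near_cinv cp (smooth_fun_near sf)) => y [cy yE] sYy sfy.
  rewrite (@vfield_chartE (cinv c y) c) ?yE //; first by split=> //; exact: cp.1.
  exact: smooth_vfield_tangent.
- exact: sf.
- exact: chart_field_smooth.
Qed.

(** The second-order terms of the two compositions coincide, so the commutator is a first-order
    operator, that is, a tangent vector. *)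
Lemma lie_bracket_chart p c X Y : chart_at p c ->
  (\forall q \near p, smooth_vfield_at q X) -> (\forall q \near p, smooth_vfield_at q Y) ->
  exists xi, lie_bracket X Y p = chart_vec p c xi.
Proof.
move=> cp nX nY; have sX := nbhs_singleton nX; have sY := nbhs_singleton nY.
set x := cfun c p.
exists (-1 *: 'D_(chart_field c Y x) (chart_field c X) x +
  'D_(chart_field c X x) (chart_field c Y) x).
apply/at_germs_eq => f sf.
rewrite (vfield_twice cp sX nY sf) (vfield_twice cp sY nX sf) -/x.
have sF := sf c cp; rewrite (smooth_near_dirP _ _ _ sF).
have E := smooth_near_comm (chart_field c X x) (chart_field c Y x) sF.
have aux (A B C D : R) : D = C -> (A + D) - (B + C) = -1 * B + A.
  by move=> ->; ring.
exact: aux E.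
Qed.

Lemma lie_bracket_smooth p X Y :
  (\forall q \near p, smooth_vfield_at q X) -> (\forall q \near p, smooth_vfield_at q Y) ->
  smooth_vfield_at p (lie_bracket X Y).
Proof.
move=> nX nY; have [c cp] := chart_exists p; split.
  have [xi ->] := lie_bracket_chart cp nX nY; exact: chart_vec_tangent.
move=> f sf; have sX := nbhs_singleton nX; have sY := nbhs_singleton nY.
apply: (@smooth_fun_ext _ _ _ (fun q => X q (fun q => Y q f) - Y q (fun q => X q f))).
  by apply: filterS (smooth_fun_near sf) => q sfq; rewrite lie_bracketE.
by apply: smooth_funB; [apply: sX.2; exact: sY.2|apply: sY.2; exact: sX.2].
Qed.

Definition smooth_vfield X := forall p, smooth_vfield_at p X.

Lemma smooth_lie_bracket X Y : smooth_vfield X -> smooth_vfield Y ->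
  smooth_vfield (lie_bracket X Y).
Proof. by move=> sX sY p; apply: lie_bracket_smooth; exact: nearW. Qed.

Lemma lie_bracketC X Y : lie_bracket X Y = - lie_bracket Y X.
Proof.
apply/funext => p; apply/funext => f; rewrite -[RHS]/(- lie_bracket Y X p f).
have [sf|sf] := pselect (smooth_fun_at p f); first by rewrite !lie_bracketE // opprB.
by rewrite /lie_bracket !at_germs_out // oppr0.
Qed.

Lemma lie_bracket_linr X Y Z (a : R) : smooth_vfield X -> smooth_vfield Y -> smooth_vfield Z ->
  lie_bracket X (a *: Y + Z) = a *: lie_bracket X Y + lie_bracket X Z.
Proof.
move=> sX sY sZ; apply/funext => p; apply/funext => f.
rewrite -[RHS]/(a * lie_bracket X Y p f + lie_bracket X Z p f).
have [sf|sf] := pselect (smooth_fun_at p f); last first.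
  by rewrite /lie_bracket !at_germs_out // mulr0 addr0.
rewrite !lie_bracketE // -[(a *: Y + Z) p _]/(a * Y p _ + Z p _).
rewrite (_ : (fun q => (a *: Y + Z) q f) = (fun q => a * Y q f + Z q f)) //.
rewrite (tangent_fun_lin _ (sX p).1 ((sY p).2 _ sf) ((sZ p).2 _ sf)).
by ring.
Qed.

Lemma smooth_vfield_lin X Y (a : R) : smooth_vfield X -> smooth_vfield Y ->
  smooth_vfield (a *: X + Y).
Proof.
move=> sX sY p; split; first exact: tangent_lin (sX p).1 (sY p).1.
move=> f sf; apply: smooth_funD; last exact: (sY p).2.
by apply: smooth_funZ; exact: (sX p).2.
Qed.

Lemma smooth_vfield0 : smooth_vfield (0 : vfield R M).
Proof. by move=> p; split; [exact: tangent0|move=> f _; exact: smooth_fun_cst]. Qed.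

Lemma smooth_vfield_sum (I : finType) (a : I -> R) (X : I -> vfield R M) :
  (forall i, smooth_vfield (X i)) -> smooth_vfield (\sum_i a i *: X i).
Proof.
move=> sX; elim/big_ind : _ => [|u w su sw|i _]; first exact: smooth_vfield0.
  by have := smooth_vfield_lin 1 su sw; rewrite scale1r.
by have := smooth_vfield_lin (a i) (sX i) smooth_vfield0; rewrite addr0.
Qed.

Lemma lie_bracket_sumr X (I : finType) (a : I -> R) (Y : I -> vfield R M) :
  smooth_vfield X -> (forall i, smooth_vfield (Y i)) ->
  lie_bracket X (\sum_i a i *: Y i) = \sum_i a i *: lie_bracket X (Y i).
Proof.
move=> sX sY.
suff H (r : seq I) : smooth_vfield (\sum_(i <- r) a i *: Y i) /\
    lie_bracket X (\sum_(i <- r) a i *: Y i) = \sum_(i <- r) a i *: lie_bracket X (Y i).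
  by have [_] := H (index_enum I).
elim: r => [|i r [IH1 IH2]].
  rewrite !big_nil; split; first exact: smooth_vfield0.
  have := lie_bracket_linr 1 sX smooth_vfield0 smooth_vfield0.
  rewrite scale1r addr0 => /eqP; rewrite -subr_eq0 scale1r opprD addrA subrr.
  by rewrite sub0r oppr_eq0 => /eqP.
rewrite !big_cons; split; first exact: smooth_vfield_lin.
by rewrite lie_bracket_linr // IH2.
Qed.

Lemma lie_bracket_suml (I : finType) (a : I -> R) (Y : I -> vfield R M) X :
  smooth_vfield X -> (forall i, smooth_vfield (Y i)) ->
  lie_bracket (\sum_i a i *: Y i) X = \sum_i a i *: lie_bracket (Y i) X.
Proof.
move=> sX sY; rewrite lie_bracketC lie_bracket_sumr // -sumrN.
by apply: eq_bigr => i _; rewrite -scalerN -lie_bracketC.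
Qed.

Lemma jacobi X Y Z : smooth_vfield X -> smooth_vfield Y -> smooth_vfield Z ->
  lie_bracket X (lie_bracket Y Z) =
  lie_bracket (lie_bracket X Y) Z + lie_bracket Y (lie_bracket X Z).
Proof.
move=> sX sY sZ; apply/funext => p; apply/funext => f.
rewrite -[RHS]/(lie_bracket (lie_bracket X Y) Z p f + lie_bracket Y (lie_bracket X Z) p f).
have [sf|sf] := pselect (smooth_fun_at p f); last first.
  by rewrite /lie_bracket !at_germs_out // addr0.
(* A bracket acts as the commutator only where [f] is smooth. This holds near [p], and [A p] sees
   nothing else. *)
have bracket_twice A B C : smooth_vfield A -> smooth_vfield B -> smooth_vfield C ->
    A p (fun q => lie_bracket B C q f) =
    A p (fun q => B q (fun r => C r f)) - A p (fun q => C q (fun r => B r f)).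
  move=> sA sB sC.
  have s1 : smooth_fun_at p (fun q => B q (fun r => C r f)).
    by apply: (sB p).2; exact: (sC p).2.
  have s2 : smooth_fun_at p (fun q => C q (fun r => B r f)).
    by apply: (sC p).2; exact: (sB p).2.
  have := tangent_fun_lin (-1) (sA p).1 s2 s1; rewrite mulN1r addrC => <-.
  apply: (tangent_local (sA p).1); apply: filterS (smooth_fun_near sf) => q sfq.
  by rewrite lie_bracketE // mulN1r addrC.
rewrite !lie_bracketE //.
rewrite !bracket_twice // ?lie_bracketE //.
- by ring.
all: by [exact: (sX p).2|exact: (sY p).2|exact: (sZ p).2].
Qed.

End Brackets.

(** * Frames with constant structure coefficients *)

Section Frames.
Context {R : realType} {M : manifold4Type R}.
Implicit Types (p q : M) (c : chart R M) (X Y : 'I_4 -> vfield R M).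

Lemma unitmx_inj n (A : 'M[R]_n) : (forall a : 'rV_n, a *m A = 0 -> a = 0) -> A \in unitmx.
Proof.
move=> A0; rewrite -row_free_unit -kermx_eq0; apply/eqP/row_matrixP => i.
by rewrite row0; apply: A0; rewrite -row_mul mulmx_ker row0.
Qed.

(** Combinations with constant coefficients: for a left-invariant frame, the row vectors become
    coordinates on the Lie algebra. *)
Definition comb X (a : 'rV[R]_4) : vfield R M := \sum_i a 0 i *: X i.

Lemma combE X a p : comb X a p = \sum_i a 0 i *: X i p.
Proof. by rewrite /comb fct_sumE. Qed.

Lemma combEf X a p f : comb X a p f = \sum_i a 0 i * X i p f.
Proof. by rewrite combE fct_sumE. Qed.

Lemma comb_lin X (t : R) a b : comb X (t *: a + b) = t *: comb X a + comb X b.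
Proof.
rewrite /comb scaler_sumr -big_split /=; apply: eq_bigr => i _.
by rewrite !mxE scalerDl scalerA.
Qed.

Lemma combD X a b : comb X (a + b) = comb X a + comb X b.
Proof. by rewrite -[a]scale1r comb_lin !scale1r. Qed.

Lemma comb0 X : comb X 0 = 0.
Proof. by rewrite /comb big1 // => i _; rewrite mxE scale0r. Qed.

Lemma combZ X (t : R) a : comb X (t *: a) = t *: comb X a.
Proof. by rewrite -[t *: a]addr0 comb_lin comb0 addr0. Qed.

Lemma comb_sum X (I : finType) (t : I -> R) (a : I -> 'rV[R]_4) :
  comb X (\sum_i t i *: a i) = \sum_i t i *: comb X (a i).
Proof.
rewrite (big_morph (comb X) (combD X) (comb0 X)).
by apply: eq_bigr => i _; rewrite combZ.
Qed.

Lemma comb_sumE X (I : finType) (t : I -> R) (a : I -> 'rV[R]_4) p :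
  comb X (\sum_i t i *: a i) p = \sum_i t i *: comb X (a i) p.
Proof. by rewrite comb_sum fct_sumE. Qed.

Lemma comb_delta X i : comb X (delta_mx 0 i) = X i.
Proof.
rewrite /comb (bigD1 i) //= mxE !eqxx scale1r big1 ?addr0 // => j ji.
by rewrite mxE (negbTE ji) andbF scale0r.
Qed.

Definition frame X := forall p, (forall i, smooth_vfield_at p (X i)) /\
  is_basis (fun i => X i p) (tangent p).

Definition frame_mx c X q : 'M[R]_4 := \matrix_(i, j) X i q (chart_coord c j).

Lemma comb_chart_vec c X p a : chart_at p c -> (forall i, tangent p (X i p)) ->
  comb X a p = chart_vec p c (a *m frame_mx c X p).
Proof.
move=> cp tX; have tc : tangent p (comb X a p) by rewrite combE; exact: tangent_sum.
rewrite (tangent_chart_vec cp tc); congr chart_vec; apply/rowP => j.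
by rewrite !mxE combEf; apply: eq_bigr => i _; rewrite mxE.
Qed.

Lemma chart_vec0 p c : chart_at p c -> chart_vec p c 0 = 0.
Proof.
move=> cp; have := chart_vec_lin (-1) 0 0 cp.
by rewrite scaler0 add0r scaleN1r addNr.
Qed.

Lemma indep_frame_mx X p c : chart_at p c -> (forall i, tangent p (X i p)) ->
  (forall a, comb X a p = 0 -> a = 0) -> frame_mx c X p \in unitmx.
Proof.
move=> cp tX iX; apply: unitmx_inj => a a0; apply: iX.
by rewrite (comb_chart_vec _ cp tX) a0 chart_vec0.
Qed.

(** Four independent tangent vectors span, because their coordinate matrix is square and therefore
    invertible. *)
Lemma indep_basis X p : (forall i, tangent p (X i p)) ->
  (forall a, comb X a p = 0 -> a = 0) -> is_basis (fun i => X i p) (tangent p).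
Proof.
move=> tX iX; split.
  move=> a a0 i; have : comb X (\row_i a i) p = 0.
    by rewrite combE -[RHS]a0; apply: eq_bigr => j _; rewrite mxE.
  by move=> /iX /rowP /(_ i); rewrite !mxE.
have [c cp] := chart_exists p.
have uX := indep_frame_mx cp tX iX.
apply/seteqP; split=> [v tv|_ [a ->]]; last exact: tangent_sum.
pose b := (\row_j v (chart_coord c j)) *m invmx (frame_mx c X p).
exists (b 0); rewrite -combE (comb_chart_vec _ cp tX) /b mulmxKV //.
exact: tangent_chart_vec.
Qed.

Lemma basis_indep X p : is_basis (fun i => X i p) (tangent p) ->
  forall a, comb X a p = 0 -> a = 0.
Proof.
by move=> [iX _] a; rewrite combE => /iX a0; apply/rowP => i; rewrite a0 mxE.
Qed.

Lemma basis_inj X p : is_basis (fun i => X i p) (tangent p) ->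
  forall a b, comb X a p = comb X b p -> a = b.
Proof.
move=> bX a b ab; apply/eqP; rewrite -subr_eq0; apply/eqP.
apply: (basis_indep bX); have := congr1 (fun v => v p) (comb_lin X (-1) b a).
rewrite /= scaleN1r addrC => ->.
by rewrite -[LHS]/(-1 *: comb X b p + comb X a p) ab scaleN1r addNr.
Qed.

Lemma frame_smooth X : frame X -> forall i, smooth_vfield (X i).
Proof. by move=> fX i p; have [] := fX p. Qed.

Lemma frame_tangent X : frame X -> forall p i, tangent p (X i p).
Proof. by move=> fX p i; have [/(_ i) []] := fX p. Qed.

Lemma comb_smooth X a : frame X -> smooth_vfield (comb X a).
Proof. by move=> fX; apply: smooth_vfield_sum; exact: frame_smooth. Qed.

Lemma frame_mx_unit X p c : frame X -> chart_at p c -> frame_mx c X p \in unitmx.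
Proof.
move=> fX cp; apply: indep_frame_mx => //; first exact: frame_tangent.
by have [_ bX] := fX p; exact: basis_indep.
Qed.

(** Coefficients are computed by an inverse matrix rather than chosen, so that they depend smoothly
    on [q]. *)
Definition frame_coef c X (Z : vfield R M) q : 'rV[R]_4 :=
  (\row_j Z q (chart_coord c j)) *m invmx (frame_mx c X q).

Lemma frame_coefE X c Z q : frame X -> chart_at q c -> tangent q (Z q) ->
  Z q = comb X (frame_coef c X Z q) q.
Proof.
move=> fX cq tZ; rewrite (comb_chart_vec _ cq (frame_tangent fX q)).
by rewrite /frame_coef mulmxKV ?frame_mx_unit //; exact: tangent_chart_vec.
Qed.

Lemma frame_coef_smooth X c Z p i : frame X -> chart_at p c -> smooth_vfield_at p Z ->
  smooth_fun_at p (fun q => frame_coef c X Z q 0 i).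
Proof.
move=> fX cp sZ; under eq_fun do rewrite mxE.
apply: smooth_fun_sum => j; apply: smooth_funM.
  under eq_fun do rewrite mxE; apply: sZ.2; exact: smooth_fun_coord.
apply: smooth_fun_invmx; last exact: frame_mx_unit.
move=> k l; under eq_fun do rewrite mxE.
by have [/(_ k) [_ s] _] := fX p; apply: s; exact: smooth_fun_coord.
Qed.

Lemma frame_decomp X p v : frame X -> tangent p v -> exists a, v = comb X a p.
Proof.
move=> fX tv; have [_ [_ bX]] := fX p; move: tv; rewrite bX => -[a ->].
by exists (\row_i a i); rewrite combE; apply: eq_bigr => i _; rewrite mxE.
Qed.

Definition structure X (C : 'I_4 -> 'I_4 -> 'rV[R]_4) :=
  forall i j, lie_bracket (X i) (X j) = comb X (C i j).

Definition br (C : 'I_4 -> 'I_4 -> 'rV[R]_4) (a b : 'rV[R]_4) : 'rV[R]_4 :=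
  \sum_i \sum_j (a 0 i * b 0 j) *: C i j.

Lemma lie_bracket_comb X C a b : frame X -> structure X C ->
  lie_bracket (comb X a) (comb X b) = comb X (br C a b).
Proof.
move=> fX CX; rewrite {1}/comb lie_bracket_suml; [|exact: comb_smooth|exact: frame_smooth].
rewrite /br (big_morph (comb X) (combD X) (comb0 X)); apply: eq_bigr => i _.
rewrite {1}/comb lie_bracket_sumr; [|exact: frame_smooth|exact: frame_smooth].
rewrite comb_sum scaler_sumr; apply: eq_bigr => j _.
by rewrite CX scalerA.
Qed.

Lemma br_linl C (t : R) a a' b : br C (t *: a + a') b = t *: br C a b + br C a' b.
Proof.
rewrite /br scaler_sumr -big_split /=; apply: eq_bigr => i _.
rewrite scaler_sumr -big_split /=; apply: eq_bigr => j _.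
by rewrite !mxE scalerA -scalerDl; congr (_ *: _); ring.
Qed.

Lemma br_linr C (t : R) a b b' : br C a (t *: b + b') = t *: br C a b + br C a b'.
Proof.
rewrite /br scaler_sumr -big_split /=; apply: eq_bigr => i _.
rewrite scaler_sumr -big_split /=; apply: eq_bigr => j _.
by rewrite !mxE scalerA -scalerDl; congr (_ *: _); ring.
Qed.

(** The laws of the algebraic bracket are read off from those of vector fields at a single point;
    this is why [M] must be inhabited. *)
Lemma br_anti X C a b : inhabited M -> frame X -> structure X C -> br C a b = - br C b a.
Proof.
move=> [p] fX CX; have [_ bX] := fX p; apply: (basis_inj bX).
rewrite -scaleN1r combZ -(lie_bracket_comb _ _ fX CX) -(lie_bracket_comb _ _ fX CX).
by rewrite lie_bracketC scaleN1r.
Qed.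

Lemma br_jacobi X C a b d : inhabited M -> frame X -> structure X C ->
  br C a (br C b d) = br C (br C a b) d + br C b (br C a d).
Proof.
move=> [p] fX CX; have [_ bX] := fX p; apply: (basis_inj bX).
rewrite combD -!(lie_bracket_comb _ _ fX CX); congr (_ p).
by apply: jacobi; exact: comb_smooth.
Qed.

(* If Z = sum a_i X_i with a(q) in the fixed space B, then the derivatives of a
   also lie in B: only the algebraic bracket leaves the given spaces. *)
Lemma lie_bracket_section X C Z Z' p m m' n (B : 'M[R]_(m, 4)) (B' : 'M[R]_(m', 4))
    (B'' : 'M[R]_(n, 4)) :
  frame X -> structure X C ->
  (\forall q \near p, smooth_vfield_at q Z /\ exists2 a, (a <= B)%MS & Z q = comb X a q) ->
  (\forall q \near p, smooth_vfield_at q Z' /\ exists2 a, (a <= B')%MS & Z' q = comb X a q) ->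
  (B <= B'')%MS -> (B' <= B'')%MS ->
  (forall a b, (a <= B)%MS -> (b <= B')%MS -> (br C a b <= B'')%MS) ->
  exists2 z, (z <= B'')%MS & lie_bracket Z Z' p = comb X z p.
Proof.
move=> fX CX nZ nZ' BB'' B'B'' brB.
have [c cp] := chart_exists p.
pose a q := frame_coef c X Z q; pose b q := frame_coef c X Z' q.
have coefP Z0 k (B0 : 'M[R]_(k, 4)) :
    (\forall q \near p, smooth_vfield_at q Z0 /\ exists2 a, (a <= B0)%MS & Z0 q = comb X a q) ->
    \forall q \near p, Z0 q = comb X (frame_coef c X Z0 q) q /\ (frame_coef c X Z0 q <= B0)%MS.
  move=> nZ0; apply: filterS2 (chart_at_near cp) nZ0 => q cq [[tZ _] [d dB dE]].
  have E := frame_coefE fX cq tZ; split=> //.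
  have [_ bX] := fX q; suff -> : frame_coef c X Z0 q = d by [].
  by apply: (basis_inj bX); rewrite -E dE.
have aP := coefP _ _ _ nZ; have bP := coefP _ _ _ nZ'.
have [sZ _] := nbhs_singleton nZ; have [sZ' _] := nbhs_singleton nZ'.
have sa i : smooth_fun_at p (fun q => a q 0 i) by exact: frame_coef_smooth.
have sb i : smooth_fun_at p (fun q => b q 0 i) by exact: frame_coef_smooth.
have [ZE aB] := nbhs_singleton aP; have [Z'E bB] := nbhs_singleton bP.
(* Lying in [B0] is a system of linear equations, [d *m cokermx B0 = 0]. Its coefficients are
   constant, so it can be differentiated along [Z0]. *)
have dsub k (B0 : 'M[R]_(k, 4)) (Z0 : vfield R M) (d : M -> 'rV[R]_4) : tangent p (Z0 p) ->
    (forall i, smooth_fun_at p (fun q => d q 0 i)) -> (\forall q \near p, (d q <= B0)%MS) ->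
    (\row_i Z0 p (fun q => d q 0 i) <= B0)%MS.
  move=> tZ0 sd nd; rewrite submxE; apply/eqP/rowP => k'; rewrite !mxE.
  under eq_bigr do rewrite mxE mulrC.
  rewrite -(tangent_fun_sum _ tZ0 sd); apply: etrans (tangent_fun_cst 0 tZ0).
  apply: (tangent_local tZ0); apply: filterS nd => q.
  rewrite submxE => /eqP /rowP /(_ k'); rewrite !mxE => H.
  rewrite -[RHS]H.
  by apply: eq_bigr => i _; rewrite mulrC.
pose da := \row_i Z' p (fun q => a q 0 i); pose db := \row_i Z p (fun q => b q 0 i).
have daB : (da <= B)%MS.
  by apply: dsub => //; [exact: sZ'.1|apply: filterS aP => q []].
have dbB : (db <= B')%MS.
  by apply: dsub => //; [exact: sZ.1|apply: filterS bP => q []].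
(* Leibniz: the algebraic bracket, plus the derivative of [b] along [Z], minus that of [a] along
   [Z']. *)
exists (br C (a p) (b p) + db - da).
  rewrite -scaleN1r addmx_sub ?scalemx_sub ?(submx_trans daB) //.
  by rewrite addmx_sub ?brB // (submx_trans dbB).
have twice (Z1 Z2 : vfield R M) (d1 d2 : M -> 'rV[R]_4) f : smooth_vfield_at p Z1 -> smooth_fun_at p f ->
    Z1 p = comb X (d1 p) p ->
    (\forall q \near p, Z2 q = comb X (d2 q) q) ->
    (forall i, smooth_fun_at p (fun q => d2 q 0 i)) ->
    Z1 p (fun q => Z2 q f) =
    \sum_i \sum_j d1 p 0 i * d2 p 0 j * X i p (fun q => X j q f) +
    \sum_j Z1 p (fun q => d2 q 0 j) * X j p f.
  move=> sZ1 sf Z1E nZ2 sd2.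
  have sXf j : smooth_fun_at p (fun q => X j q f) by have [/(_ j) [_ s] _] := fX p; apply: s.
  have -> : Z1 p (fun q => Z2 q f) =
      Z1 p (fun q => \sum_j 1 * (d2 q 0 j * X j q f)).
    apply: (tangent_local sZ1.1); apply: filterS nZ2 => q ->.
    by rewrite combEf; apply: eq_bigr => j _; rewrite mul1r.
  rewrite (tangent_fun_sum _ sZ1.1); last by move=> j; exact: smooth_funM.
  rewrite exchange_big -big_split /=; apply: eq_bigr => j _.
  rewrite mul1r (tangent_funM sZ1.1 (sd2 j) (sXf j)); congr (_ + _); last exact: mulrC.
  rewrite {1}Z1E combEf mulr_sumr; apply: eq_bigr => i _.
  by rewrite mulrA (mulrC (d2 p 0 j)).
rewrite -[comb X _ p]addr0; apply/funext => f; rewrite -[RHS]/(comb X _ p f + 0) addr0.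
have [sf|sf] := pselect (smooth_fun_at p f); last first.
  rewrite /lie_bracket at_germs_out // combEf big1 // => i _.
  by rewrite (tangent_out (frame_tangent fX p i) sf) mulr0.
have nZc : \forall q \near p, Z q = comb X (a q) q by apply: filterS aP => q [].
have nZ'c : \forall q \near p, Z' q = comb X (b q) q by apply: filterS bP => q [].
rewrite lie_bracketE // (twice Z Z' a b f sZ sf ZE nZ'c sb) (twice Z' Z b a f sZ' sf Z'E nZc sa).
have -> : br C (a p) (b p) + db - da = -1 *: da + (br C (a p) (b p) + db).
  by rewrite scaleN1r addrC.
rewrite comb_lin combD.
rewrite -[RHS]/(-1 * comb X da p f + (comb X (br C (a p) (b p)) p f + comb X db p f)).
rewrite (combEf _ da) (combEf _ db) -(lie_bracket_comb _ _ fX CX).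
have -> : lie_bracket (comb X (a p)) (comb X (b p)) p f =
    \sum_i \sum_j a p 0 i * b p 0 j * X i p (fun q => X j q f) -
    \sum_i \sum_j b p 0 i * a p 0 j * X i p (fun q => X j q f).
  rewrite (lie_bracketE _ _ sf).
  have tw a1 b1 : comb X a1 p (fun q => comb X b1 q f) =
      \sum_i \sum_j a1 0 i * b1 0 j * X i p (fun q => X j q f).
    rewrite combEf; apply: eq_bigr => i _.
    under eq_fun do rewrite combEf.
    rewrite (tangent_fun_sum _ (frame_tangent fX p i)) ?mulr_sumr.
      by apply: eq_bigr => j _; rewrite mulrA.
    by move=> j; have [/(_ j) [_ s] _] := fX p; apply: s.
  by rewrite !tw.
under [X in _ = -1 * X + _]eq_bigr do rewrite mxE.
under [X in _ = _ + (_ + X)]eq_bigr do rewrite mxE.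
by ring.
Qed.

End Frames.

(** * Rank conditions in the coordinates of a frame *)

Section FamilyRank.
Context {R : realType} {M : manifold4Type R}.
Implicit Types (p q : M) (X : 'I_4 -> vfield R M).

Lemma lspan_comb X m (B : 'M[R]_(m, 4)) (A : set (operator R M)) p v :
  (forall u, A u -> exists2 z, (z <= B)%MS & u = comb X z p) -> lspan A v ->
  exists2 z, (z <= B)%MS & v = comb X z p.
Proof.
move=> AB [n [t [E [EA ->]]]].
have /choice [z zP] : forall i, exists z, (z <= B)%MS /\ E i = comb X z p.
  by move=> i; have [z zB zE] := AB _ (EA i); exists z.
exists (\sum_i t i *: z i).
  by apply: summx_sub => i _; rewrite scalemx_sub //; case: (zP i).
rewrite comb_sumE; apply: eq_bigr => i _.
by have [_ ->] := zP i.
Qed.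

(** An upper bound for the span of brackets of all local sections, whose coefficients may vary, by a
    condition on constant coefficients alone. *)
Lemma bracket_family_sub X C (D D' : M -> set (operator R M)) m m' n
    (B : 'M[R]_(m, 4)) (B' : 'M[R]_(m', 4)) (B'' : 'M[R]_(n, 4)) :
  frame X -> structure X C ->
  (forall q v, D q v -> exists2 a, (a <= B)%MS & v = comb X a q) ->
  (forall q v, D' q v -> exists2 a, (a <= B')%MS & v = comb X a q) ->
  (B <= B'')%MS -> (B' <= B'')%MS ->
  (forall a b, (a <= B)%MS -> (b <= B')%MS -> (br C a b <= B'')%MS) ->
  forall p v, bracket_family D D' p v -> exists2 z, (z <= B'')%MS & v = comb X z p.
Proof.
move=> fX CX DB D'B' BB'' B'B'' brB p v.
apply: lspan_comb => _ [Z [Z' [sZ sZ' ->]]].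
apply: (lie_bracket_section fX CX _ _ BB'' B'B'' brB).
  by apply: filterS sZ => q [sq Dq]; split=> //; exact: DB.
by apply: filterS sZ' => q [sq Dq]; split=> //; exact: D'B'.
Qed.

Lemma dim_le_rank X p m (B : 'M[R]_(m, 4)) n (S : set (operator R M)) :
  has_dim n S -> (forall v, S v -> exists2 z, (z <= B)%MS & v = comb X z p) ->
  (n <= \rank B)%N.
Proof.
move=> [E [iE SE]] SB.
have /choice [z zP] : forall i, exists z, (z <= B)%MS /\ E i = comb X z p.
  move=> i; have [|z zB zE] := SB (E i); last by exists z.
  rewrite SE; exists (fun j => (j == i)%:R).
  rewrite (bigD1 i) //= eqxx scale1r big1 ?addr0 // => j /negbTE ->.
  by rewrite scale0r.
pose A : 'M[R]_(n, 4) := \matrix_i z i.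
have rA : row_free A.
  rewrite -kermx_eq0; apply/eqP/row_matrixP => k; rewrite row0.
  set a := row k _; have aA : a *m A = 0 by rewrite /a -row_mul mulmx_ker row0.
  apply/rowP => i; rewrite [RHS]mxE; apply: (iE (a 0)).
  under eq_bigr do rewrite (zP _).2.
  rewrite -comb_sumE.
  have -> : \sum_i a 0 i *: z i = a *m A.
    by rewrite mulmx_sum_row; apply: eq_bigr => j _; rewrite rowK.
  by rewrite aA comb0.
move: rA; rewrite /row_free => /eqP <-; apply: mxrankS.
by apply/row_subP => i; rewrite rowK; case: (zP i).
Qed.

End FamilyRank.

(** * Left-invariant frames on Lie groups *)

Section ProductCalculus.
Context {R : realType} {V1 V2 W : normedModType R}.
Implicit Types (F : V1 * V2 -> W).

Lemma derive_fst F x y u : 'D_(u, 0) F (x, y) = 'D_u (fun x => F (x, y)) x.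
Proof.
rewrite /derive (_ : (fun h => _) = (fun h : R =>
    h^-1 *: (((fun x => F (x, y)) \o shift x) (h *: u) - F (x, y)))) //.
apply/funext => h /=.
by rewrite -[h *: (u, 0) + (x, y)]/(h *: u + x, h *: (0 : V2) + y) scaler0 add0r.
Qed.

Lemma derive_snd F x y v : 'D_(0, v) F (x, y) = 'D_v (fun y => F (x, y)) y.
Proof.
rewrite /derive (_ : (fun h => _) = (fun h : R =>
    h^-1 *: (((fun y => F (x, y)) \o shift y) (h *: v) - F (x, y)))) //.
apply/funext => h /=.
by rewrite -[h *: (0, v) + (x, y)]/(h *: (0 : V1) + x, h *: v + y) scaler0 add0r.
Qed.

Lemma derivable_snd F x y v : derivable F (x, y) (0, v) -> derivable (fun y => F (x, y)) y v.
Proof.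
rewrite /derivable (_ : (fun h => _) = (fun h : R =>
    h^-1 *: (((fun y => F (x, y)) \o shift y) (h *: v) - F (x, y)))) //.
apply/funext => h /=.
by rewrite -[h *: (0, v) + (x, y)]/(h *: (0 : V1) + x, h *: v + y) scaler0 add0r.
Qed.

Lemma smooth_near_slice F x y : smooth_near (x, y) F -> smooth_near y (fun y => F (x, y)).
Proof.
move=> [U [oU Uxy sF]].
have cx y' : {for y', continuous (fun y : V2 => (x, y))}.
  by apply: cvg_pair; [exact: cvg_cst|exact: cvg_id].
have oU' : open [set y | U (x, y)].
  have -> : [set y | U (x, y)] = (fun y => (x, y)) @^-1` U by [].
  by apply: open_comp => // y' _; exact: cx.
have cF k (H : V1 * V2 -> W) : Ck k U H -> forall y', U (x, y') ->
    {for y', continuous (fun y => H (x, y))}.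
  move=> cH y' Uy; apply: (@continuous_comp _ _ _ (fun y => (x, y)) H); first exact: cx.
  exact: Ck_cont cH Uy.
exists [set y | U (x, y)]; split=> // k; elim: k F {sF} (sF k) => [|k IH] H cH.
  by split=> // y' Uy; exact: cF cH _ Uy.
apply: (@CkS_intro _ _ _ _ _ _ (fun v y => 'D_(0, v) H (x, y))) => //.
- by move=> y' Uy; exact: cF cH _ Uy.
- move=> v y' Uy; split; last by rewrite derive_snd.
  by apply: derivable_snd; exact: Ck_derivable cH Uy.
- by move=> v; exact: (IH _ (Ck_derive _ cH)).
Qed.

Lemma smooth_near_fst (z : V1 * V2) : smooth_near z (fun z : V1 * V2 => z.1).
Proof.
pose L : {linear (V1 * V2)%type -> V1} := HB.pack (fun z : V1 * V2 => z.1)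
  (GRing.isLinear.Build R (V1 * V2)%type V1 _ (fun z : V1 * V2 => z.1) (fun a u v => erefl)).
by apply: (@smooth_near_lin R _ _ L) => w; exact: cvg_fst.
Qed.

Lemma smooth_near_snd (z : V1 * V2) : smooth_near z (fun z : V1 * V2 => z.2).
Proof.
pose L : {linear (V1 * V2)%type -> V2} := HB.pack (fun z : V1 * V2 => z.2)
  (GRing.isLinear.Build R (V1 * V2)%type V2 _ (fun z : V1 * V2 => z.2) (fun a u v => erefl)).
by apply: (@smooth_near_lin R _ _ L) => w; exact: cvg_snd.
Qed.

End ProductCalculus.

(** * Smooth maps to and between manifolds *)

Section SmoothPointMaps.
Context {R : realType}.

(** Smoothness is tested on functions of the target instead of in its charts, which makes
    compositions immediate. [smooth_pullback] does the same for maps between manifolds. *)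
Definition smooth_into (V : normedModType R) (M : manifold4Type R) (x : V) (phi : V -> M) :=
  {for x, continuous phi} /\
  forall f, smooth_fun_at (phi x) f -> smooth_near x (fun y => f (phi y)).

Definition smooth_pullback (M N : manifold4Type R) (p : M) (F : M -> N) :=
  {for p, continuous F} /\
  forall f, smooth_fun_at (F p) f -> smooth_fun_at p (fun q => f (F q)).

Lemma smooth_into_cst (V : normedModType R) (M : manifold4Type R) (x : V) (p : M) :
  smooth_into x (fun=> p).
Proof. by split=> [|f _]; [exact: cst_continuous|exact: smooth_near_cst]. Qed.

Lemma smooth_into_cinv (M : manifold4Type R) (p : M) (c : chart R M) : chart_at p c ->
  smooth_into (cfun c p) (cinv c).
Proof.
move=> cp; split; first by apply: cinv_continuous; exists p => //; exact: cp.2.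
by move=> f; rewrite cfunK; [apply; exact: cp|exact: cp.2].
Qed.

Lemma smooth_into_comp (V : normedModType R) n (M : manifold4Type R) (x : V) (u : V -> 'rV[R]_n)
    (phi : 'rV[R]_n -> M) :
  smooth_near x u -> smooth_into (u x) phi -> smooth_into x (fun y => phi (u y)).
Proof.
move=> su [cphi sphi]; split.
  by apply: (@continuous_comp _ _ _ u phi) => //; exact: smooth_near_continuous.
by move=> f /sphi sf; apply: (@smooth_near_compR R _ _ x u (fun y => f (phi y))).
Qed.

Lemma smooth_into_snd (V1 V2 : normedModType R) (M : manifold4Type R) (x : V1) (y : V2)
    (phi : V2 -> M) :
  smooth_into y phi -> smooth_into (x, y) (fun z : V1 * V2 => phi z.2).
Proof.
move=> [cphi sphi]; split.
  by apply: (@continuous_comp _ _ _ (fun z : V1 * V2 => z.2) phi); [exact: cvg_snd|].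
move=> f /sphi sf.
pose L : {linear (V1 * V2)%type -> V2} := HB.pack (fun z : V1 * V2 => z.2)
  (GRing.isLinear.Build R (V1 * V2)%type V2 _ (fun z : V1 * V2 => z.2) (fun a u v => erefl)).
by apply: (@smooth_near_lin_comp R _ _ _ L (x, y) (fun y => f (phi y))) => // w; exact: cvg_snd.
Qed.

Lemma smooth_into_chart (V : normedModType R) (M : manifold4Type R) (x : V) (phi : V -> M)
    (c : chart R M) :
  smooth_into x phi -> chart_at (phi x) c -> smooth_near x (fun y => cfun c (phi y)).
Proof.
move=> [_ sphi] cp; apply/smooth_near_mxP => i j.
have := sphi _ (smooth_fun_coord j cp); apply: smooth_near_eq => y.
by rewrite /chart_coord ord1.
Qed.

Lemma smooth_into_near (V : normedModType R) (M : manifold4Type R) (x : V) (phi : V -> M)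
    (P : M -> Prop) :
  smooth_into x phi -> (\forall q \near phi x, P q) -> \forall y \near x, P (phi y).
Proof. by move=> [cphi _]; exact: cphi. Qed.

Lemma smooth_pullback_map (M N : manifold4Type R) (p : M) (F : M -> N) :
  smooth_pullback p F -> smooth_map_at p F.
Proof.
move=> [cF sF]; split=> // c d cp dFp; apply/smooth_near_mxP => i j.
have := sF _ (smooth_fun_coord j dFp) c cp; apply: smooth_near_eq => x.
by rewrite /chart_coord ord1.
Qed.

Lemma smooth_into_pullback (M N : manifold4Type R) (p : M) (c : chart R M) (F : M -> N) :
  chart_at p c -> {for p, continuous F} -> smooth_into (cfun c p) (fun x => F (cinv c x)) ->
  smooth_pullback p F.
Proof.
move=> cp cF [_ sF]; split=> // f sf; apply: (smooth_fun_chart cp).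
by apply: sF; rewrite cfunK //; exact: cp.2.
Qed.

(** The components of the image in a chart [d] are the values of [v] on the coordinates of [d]
    composed with [F]; the chain rule does the rest. *)
Lemma tangent_map_tangent (M N : manifold4Type R) (p : M) (F : M -> N) v :
  smooth_pullback p F -> tangent p v -> tangent (F p) (tangent_map F p v).
Proof.
move=> [cF sF] tv; have [c cp] := chart_exists p; have [d dFp] := chart_exists (F p).
exists d, (\row_j v (fun q => chart_coord d j (F q))); split=> //.
apply: at_germs_eq => f sf; rewrite -[LHS]/(v (fun q => f (F q))).
have sj j := sF _ (smooth_fun_coord j dFp).
set xi := \row_j v (chart_coord c j).
have vE g : smooth_fun_at p g -> v g = 'D_xi (fun x => g (cinv c x)) (cfun c p).
  by move=> sg; rewrite (tangent_chart_vec cp tv) chart_vecE.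
rewrite vE; last exact: sF.
have su : smooth_near (cfun c p) (fun x => cfun d (F (cinv c x))).
  apply/smooth_near_mxP => i j; apply: smooth_near_eq (sj j c cp) => x /=.
  by rewrite /chart_coord ord1.
have sfd : smooth_near (cfun d (F (cinv c (cfun c p)))) (fun y => f (cinv d y)).
  by rewrite (cfunK cp.2); exact: sf.
have -> : 'D_xi (fun x => f (F (cinv c x))) (cfun c p) =
    'D_xi (fun x => (fun y => f (cinv d y)) (cfun d (F (cinv c x)))) (cfun c p).
  apply: near_eq_derive.
  have nd : \forall q \near p, cdom d (F q).
    by apply: cF; apply: filterS (chart_at_near dFp) => q [].
  by apply: filterS (near_cinv cp nd) => x dx /=; rewrite cfunK.
have [_ ->] := smooth_near_chain sfd (@smooth_near_derivable R _ _ _ _ xi su).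
rewrite (cfunK cp.2) (smooth_near_dir_sum _ (sf d dFp)); apply: eq_bigr => j _.
congr (_ * _); rewrite mxE vE; last exact: sj.
by rewrite (derive_mx (@smooth_near_derivable R _ _ _ _ xi su)) mxE.
Qed.

Lemma tangent_mapE (M N : manifold4Type R) (F : M -> N) (p : M) v f :
  smooth_fun_at (F p) f -> tangent_map F p v f = v (fun q => f (F q)).
Proof. by move=> sf; rewrite /tangent_map at_germsE. Qed.

Lemma tangent_map_lin (M N : manifold4Type R) (F : M -> N) (p : M) (I : finType)
    (t : I -> R) (v : I -> operator R M) :
  tangent_map F p (\sum_i t i *: v i) = \sum_i t i *: tangent_map F p (v i).
Proof.
apply/funext => f.
have -> : (\sum_i t i *: tangent_map F p (v i)) f = \sum_i t i * tangent_map F p (v i) f.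
  by rewrite fct_sumE.
have [sf|sf] := pselect (smooth_fun_at (F p) f).
  rewrite tangent_mapE // fct_sumE; apply: eq_bigr => i _.
  by rewrite tangent_mapE.
rewrite [LHS]at_germs_out // big1 // => i _.
by rewrite [tangent_map _ _ _ _]at_germs_out ?mulr0.
Qed.

End SmoothPointMaps.

Section LieGroup.
Context {R : realType} {G : lieGroup4Type R}.
Implicit Types (p q a : G) (X : 'I_4 -> vfield R G).

(** Carries the smoothness of the group law from charts to [smooth_into], after which products of
    group-valued maps are handled without charts. *)
Lemma smooth_intoM (V : normedModType R) (x : V) (phi psi : V -> G) :
  smooth_into x phi -> smooth_into x psi -> smooth_into x (fun y => (phi y * psi y)%g).
Proof.
move=> sphi spsi; have [cm sm] := @mulg_smooth R G (phi x) (psi x).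
have cprod : {for x, continuous (fun y => (phi y * psi y)%g)}.
  exact: (@cvg_comp _ _ _ (fun y => (phi y, psi y)) (fun z : G * G => (z.1 * z.2)%g)
    _ _ _ (cvg_pair sphi.1 spsi.1) cm).
split=> // f sf.
have [c cp] := chart_exists (phi x); have [d dp] := chart_exists (psi x).
have [e ep] := chart_exists (phi x * psi x)%g.
have s1 := smooth_into_chart sphi cp; have s2 := smooth_into_chart spsi dp.
have sme := sm c d e cp dp ep.
have spr : smooth_near x (fun y => cfun e (cinv c (cfun c (phi y)) * cinv d (cfun d (psi y)))%g).
  apply/smooth_near_mxP => i j.
  have sh := iffLR (smooth_near_mxP _ _) sme i j.
  exact: (@smooth_near_pair R V _ _ x _ _
    (fun z => cfun e (cinv c z.1 * cinv d z.2)%g i j) s1 s2 sh).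
have : smooth_near x (fun y => (fun z => f (cinv e z))
    (cfun e (cinv c (cfun c (phi y)) * cinv d (cfun d (psi y)))%g)).
  apply: (@smooth_near_compR R _ 4 x _ (fun z => f (cinv e z)) spr).
  by rewrite (cfunK cp.2) (cfunK dp.2); exact: sf.
apply: smooth_near_ext.
have n1 := smooth_into_near sphi (chart_at_near cp).
have n2 := smooth_into_near spsi (chart_at_near dp).
have n3 : nbhs x [set y | chart_at (phi y * psi y)%g e].
  exact: (cprod [set q | chart_at q e] (chart_at_near ep)).
by apply: filterS3 n1 n2 n3 => y [_ h1] [_ h2] [_ h3]; rewrite !cfunK.
Qed.

Lemma mulg_continuous p q : {for (p, q), continuous (fun z : G * G => (z.1 * z.2)%g)}.
Proof. by have [] := @mulg_smooth R G p q. Qed.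

Lemma left_translation_smooth a p : smooth_pullback p (left_translation a).
Proof.
have [c cp] := chart_exists p; apply: (smooth_into_pullback cp).
  have c1 : (fun y : G => (a, y)) @ p --> (a, p).
    by apply: cvg_pair; [exact: cvg_cst|exact: cvg_id].
  exact: (@cvg_comp _ _ _ (fun y : G => (a, y)) (fun z : G * G => (z.1 * z.2)%g)
    _ _ _ c1 (@mulg_continuous a p)).
by apply: smooth_intoM; [exact: smooth_into_cst|exact: smooth_into_cinv].
Qed.

Definition right_translation a : G -> G := fun x => (x * a)%g.

Lemma right_translation_smooth a p : smooth_pullback p (right_translation a).
Proof.
have [c cp] := chart_exists p; apply: (smooth_into_pullback cp).
  have c1 : (fun y : G => (y, a)) @ p --> (p, a).
    by apply: cvg_pair; [exact: cvg_id|exact: cvg_cst].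
  exact: (@cvg_comp _ _ _ (fun y : G => (y, a)) (fun z : G * G => (z.1 * z.2)%g)
    _ _ _ c1 (@mulg_continuous p a)).
by apply: smooth_intoM; [exact: smooth_into_cinv|exact: smooth_into_cst].
Qed.

Lemma left_invariant_near X i a p f : left_invariant_frame X ->
  smooth_fun_at (a * p)%g f ->
  \forall q \near p, X i (a * q)%g f = X i q (fun r => f (a * r)%g).
Proof.
move=> lX sf; have [cL _] := left_translation_smooth a p.
have n1 : nbhs p [set q | smooth_fun_at (a * q)%g f].
  exact: (cL [set r | smooth_fun_at r f] (smooth_fun_near sf)).
apply: filterS n1 => q sq; have := lX i a q.
by rewrite /left_translation => ->; rewrite tangent_mapE.
Qed.

Lemma bracket_left_invariant X i j a p : frame X -> left_invariant_frame X ->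
  lie_bracket (X i) (X j) (a * p)%g = tangent_map (left_translation a) p (lie_bracket (X i) (X j) p).
Proof.
move=> fX lX; apply: at_germs_eq => f sf.
have sfa : smooth_fun_at p (f \o left_translation a) by apply: (left_translation_smooth a p).2.
rewrite lie_bracketE //.
have tw k l : X k (a * p)%g (fun q => X l q f) = X k p (fun q => X l q (f \o left_translation a)).
  have := lX k a p; rewrite /left_translation => ->; rewrite tangent_mapE; last first.
    by have [/(_ l) [_ s] _] := fX (a * p)%g; exact: s.
  apply: (tangent_local (frame_tangent fX p k)).
  exact: left_invariant_near.
by rewrite !tw.
Qed.

(** The coefficients found at 1 are valid everywhere, since brackets and frame are moved by the same
    left translations. *)
Lemma structure_exists X : frame X -> left_invariant_frame X -> exists C, structure X C.
Proof.
move=> fX lX.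
have /choice [C CP] : forall ij : 'I_4 * 'I_4, exists z,
    lie_bracket (X ij.1) (X ij.2) 1%g = comb X z 1%g.
  move=> ij; apply: frame_decomp => //.
  exact: (smooth_lie_bracket (frame_smooth fX ij.1) (frame_smooth fX ij.2) 1%g).1.
exists (fun i j => C (i, j)) => i j; apply/funext => p.
rewrite -[p]mulg1 bracket_left_invariant // (CP (i, j)) !combE tangent_map_lin.
by apply: eq_bigr => k _; rewrite -(lX k p 1%g).
Qed.

(* Left translates of the coordinate vectors of a chart around 1. *)
Lemma left_invariant_frame_exists : exists Y : 'I_4 -> vfield R G, frame Y /\ left_invariant_frame Y.
Proof.
have [c c1] := chart_exists (1%g : G).
pose v i := chart_vec 1%g c (delta_mx 0 i).
pose Y i : vfield R G := fun p => at_germs p (fun f => v i (fun q => f (p * q)%g)).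
have YE i p : Y i p = tangent_map (left_translation p) 1%g (v i).
  by rewrite /tangent_map /left_translation mulg1.
have tY i p : tangent p (Y i p).
  rewrite YE -{1}[p]mulg1; apply: tangent_map_tangent; first exact: left_translation_smooth.
  exact: chart_vec_tangent.
exists Y; split=> [p|i a p]; last first.
  apply: at_germs_eq => f sf; rewrite -[RHS]/(Y i p (fun q => f (a * q)%g)).
  have sfa : smooth_fun_at p (fun q => f (a * q)%g) by exact: (left_translation_smooth a p).2.
  rewrite /Y at_germsE //; congr (v i _); apply/funext => q.
  by rewrite /left_translation mulgA.
split=> [i|].
  split=> // f sf.
  have [d dp] := chart_exists p; apply: (smooth_fun_chart dp).
  (* Applied to [f], the field is a partial derivative of the group law read in charts, with the
     second variable frozen at 1. *)
  pose Phi (z : 'rV[R]_4 * 'rV[R]_4) := f (cinv d z.1 * cinv c z.2)%g.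
  have sPhi : smooth_near (cfun d p, cfun c 1%g) Phi.
    apply: (smooth_intoM _ _).2.
    - by apply: smooth_into_comp (smooth_near_fst _) _; exact: smooth_into_cinv.
    - by apply: smooth_into_comp (smooth_near_snd _) _; exact: smooth_into_cinv.
    - by rewrite /= (cfunK dp.2) (cfunK c1.2) mulg1.
  have sD := @smooth_near_derive _ _ _ _ _ (0, delta_mx 0 i) sPhi.
  have sx : smooth_near (cfun d p) (fun x => 'D_(0, delta_mx 0 i) Phi (x, cfun c 1%g)).
    apply: (@smooth_near_pair R _ _ _ _ (fun x => x) (fun=> cfun c 1%g)
       ('D_(0, delta_mx 0 i) Phi)) => //; last exact: smooth_near_cst.
    by exists setT; split=> //; [exact: openT|move=> k; exact/Ck_id/openT].
  apply: smooth_near_ext sx.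
  apply: filterS (near_cinv dp (smooth_fun_near sf)) => x sfx.
  rewrite derive_snd /Y at_germsE // /v chart_vecE //.
  have := (left_translation_smooth (cinv d x) 1%g).2; apply.
  by rewrite /left_translation mulg1.
apply: indep_basis => // a a0.
apply/rowP => j; rewrite [RHS]mxE.
(* Coordinates around 1 translated to [p]: on them the fields take the values of the unit vectors,
   which isolates the coefficient [a 0 j]. *)
pose g (q : G) := chart_coord c j (p^-1 * q)%g.
have sg : smooth_fun_at p g.
  apply: (left_translation_smooth p^-1%g p).2; rewrite /left_translation mulVg.
  exact: smooth_fun_coord.
have := congr1 (fun w => w g) a0; rewrite combEf -[(0 : operator R G) g]/(0 : R) => <-.
have Yg i : Y i p g = (delta_mx 0 i : 'rV[R]_4) 0 j.
  rewrite /Y at_germsE // -(chart_vec_coord _ j c1); congr (v i _).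
  by apply/funext => q; rewrite /g mulgA mulVg mul1g.
under eq_bigr do rewrite Yg.
by rewrite {1}(row_sum_delta a) summxE; apply: eq_bigr => i _; rewrite !mxE.
Qed.

End LieGroup.

(** * The adjoint action and local frame maps *)

Section Adjoint.
Context {R : realType} {G : lieGroup4Type R}.
Variable X : 'I_4 -> vfield R G.
Hypotheses (fX : frame X) (lX : left_invariant_frame X).
Implicit Types (p q g h : G) (f : G -> R).

Lemma left_invariantE i g p f : smooth_fun_at (g * p)%g f ->
  X i (g * p)%g f = X i p (fun r => f (g * r)%g).
Proof.
by move=> sf; have := lX i g p; rewrite /left_translation => ->; rewrite tangent_mapE.
Qed.

Lemma comb_left_invariantE a g p f : smooth_fun_at (g * p)%g f ->
  comb X a (g * p)%g f = comb X a p (fun r => f (g * r)%g).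
Proof.
by move=> sf; rewrite !combEf; apply: eq_bigr => i _; rewrite left_invariantE.
Qed.

Lemma comb_inj p a b : (forall f, smooth_fun_at p f -> comb X a p f = comb X b p f) -> a = b.
Proof.
move=> ab; have [_ bX] := fX p; apply: (basis_inj bX); apply/funext => f.
have [sf|sf] := pselect (smooth_fun_at p f); first exact: ab.
by rewrite !combEf !big1 // => i _; rewrite (tangent_out (frame_tangent fX p i) sf) mulr0.
Qed.

Definition Ad_row g i : set 'rV[R]_4 := [set z | forall q f, smooth_fun_at (q * g)%g f ->
  X i q (fun r => f (r * g)%g) = comb X z (q * g)%g f].

(** The row is found at [q = 1]. Left translations commute with the right one, so the same row works
    for every [q]. *)
Lemma Ad_row_exists g i : exists z, Ad_row g i z.
Proof.
have tg : tangent (1 * g)%g (tangent_map (right_translation g) 1%g (X i 1%g)).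
  exact: (tangent_map_tangent (right_translation_smooth g 1%g) (frame_tangent fX 1%g i)).
have [z zE] := frame_decomp fX tg; exists z => q f sf.
have s1 : smooth_fun_at q (fun r => f (r * g)%g) by exact: (right_translation_smooth g q).2.
rewrite -[q in X i q]mulg1 left_invariantE ?mulg1 //.
have s2 : smooth_fun_at (1 * g)%g (fun r => f (q * r)%g).
  by apply: (left_translation_smooth q _).2; rewrite /left_translation mul1g.
have -> : (fun r => f (q * r * g)%g) = (fun r => (fun r => f (q * r)%g) (r * g)%g).
  by apply/funext => r; rewrite mulgA.
transitivity (tangent_map (right_translation g) 1%g (X i 1%g) (fun r => f (q * r)%g)).
  by rewrite tangent_mapE.
rewrite zE.
by rewrite -[in RHS](mul1g g) comb_left_invariantE ?mul1g.
Qed.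

(** In the usual notation, row [i] contains the coordinates of the adjoint action of g^-1 on [X i].
    With rows as vectors this is multiplicative in [g]. *)
Definition Ad g : 'M[R]_4 := \matrix_i xget 0 (Ad_row g i).

Lemma AdE g i q f : smooth_fun_at (q * g)%g f ->
  X i q (fun r => f (r * g)%g) = comb X (row i (Ad g)) (q * g)%g f.
Proof.
rewrite rowK; have [z zP] := Ad_row_exists g i.
exact: (@xgetPex _ 0 (Ad_row g i) (ex_intro _ z zP)).
Qed.

Lemma AdM g h : Ad (g * h)%g = Ad g *m Ad h.
Proof.
apply/row_matrixP => i; apply: (@comb_inj (1 * (g * h))%g) => f sf.
rewrite -AdE //.
have s1 : smooth_fun_at (1 * g)%g (fun r => f (r * h)%g).
  by apply: (right_translation_smooth h _).2; rewrite /right_translation -mulgA.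
have -> : (fun r => f (r * (g * h))%g) = (fun r => (fun r => f (r * h)%g) (r * g)%g).
  by apply/funext => r; rewrite mulgA.
apply: (etrans (AdE i s1)); rewrite combEf row_mul mulmx_sum_row.
rewrite comb_sumE.
have -> : (\sum_k row i (Ad g) 0 k *: comb X (row k (Ad h)) (1 * (g * h))%g) f =
    \sum_k row i (Ad g) 0 k * comb X (row k (Ad h)) (1 * (g * h))%g f by rewrite fct_sumE.
apply: eq_bigr => k _; congr (_ * _).
by rewrite mulgA; apply: AdE; rewrite -mulgA.
Qed.

Lemma Ad1 : Ad 1%g = 1%:M.
Proof.
apply/row_matrixP => i; apply: (@comb_inj (1 * 1)%g) => f sf.
rewrite -AdE // row1 comb_delta mulg1; congr (X i _ _).
by apply/funext => r; rewrite mulg1.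
Qed.

(** The equation is tested on functions, so that translates of the curve can be differentiated
    without following them through charts. *)
Definition integral_curve i (d : R) (c : R -> G) := [/\ 0 < d, c 0 = 1%g &
  forall t, `|t| < d -> smooth_into t c /\
    forall f, smooth_fun_at (c t) f -> is_derive t (1 : R) (fun s => f (c s)) (X i (c t) f)].

Lemma integral_curve_exists i : exists c d, integral_curve i d c.
Proof.
have [c c1] := chart_exists (1%g : G).
have sa := chart_field_smooth c1 (frame_smooth fX i 1%g).
(* [U] also lies inside the image of the chart, so a solution in [U] can be carried back to the
   group. *)
have [U [oU U1 UI sU]] := smooth_near_open sa (cinvK_near c1).
have [x [d [d0 x0 xP]]] := local_ode oU U1 sU.
exists (fun t => cinv c (x t)), d; split=> //; first by rewrite x0 (cfunK c1.2).
move=> t td; have [Ut Dx sx] := xP t td; have [cdx cx] := UI _ Ut.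
have ct : chart_at (cinv c (x t)) c by split=> //; exact: c1.1.
have sc : smooth_into (x t) (cinv c) by rewrite -{1}cx; exact: smooth_into_cinv.
split=> [|f sf]; first exact: smooth_into_comp.
have sF : smooth_near (x t) (fun y => f (cinv c y)) by exact: sc.2.
have := smooth_near_chain sF (@smooth_near_derivable R _ _ _ _ (1 : R) sx).
rewrite (vfield_chartE ct (frame_tangent fX _ i) sf) cx.
rewrite (smooth_near_dir_sum _ sF).
by have [_ ->] := Dx.
Qed.

(** The left factor [g] is absorbed by left invariance; the right factor [h] turns [X i] into row
    [i] of [Ad h]. *)
Lemma curve_derive i d c t g h f : integral_curve i d c -> `|t| < d ->
  smooth_fun_at (g * c t * h)%g f ->
  is_derive t (1 : R) (fun s => f (g * c s * h)%g) (comb X (row i (Ad h)) (g * c t * h)%g f).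
Proof.
move=> [_ _ cP] td sf; have [_ Dc] := cP t td.
have s1 : smooth_fun_at (g * c t)%g (fun r => f (r * h)%g).
  exact: (right_translation_smooth h _).2.
have s2 : smooth_fun_at (c t) (fun r => f (g * r * h)%g).
  exact: (left_translation_smooth g _).2 _ s1.
have := Dc _ s2.
by rewrite -(left_invariantE i s1) AdE.
Qed.

Section AdODE.
Variables (C : 'I_4 -> 'I_4 -> 'rV[R]_4) (j : 'I_4) (d : R) (c : R -> G).
Hypotheses (CX : structure X C) (cj : integral_curve j d c).

(** Row [k] holds [X_k, X_j], the matrix of - ad X_j on rows. The sign goes with [Ad g] being the
    adjoint action of g^-1. *)
Definition ad_mx : 'M[R]_4 := \matrix_(k, l) C k j 0 l.

(** In a chart around [c t], let [Mx s] be the matrix of the frame and [N s] that of its right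
    translate from 1, so that [N s = Ad (c s) *m Mx s]. Differentiating [N] produces X_k X_j on
    coordinates, differentiating [Mx] produces X_j X_k; their difference is the bracket. *)
Lemma Ad_derive t : `|t| < d -> is_derive t (1 : R) (fun s => Ad (c s)) (Ad (c t) *m ad_mx).
Proof.
move=> td; have [d0 c0 cP] := cj; have [sc _] := cP t td.
have [b bt] := chart_exists (c t); have [a a1] := chart_exists (1%g : G).
pose Mx s := frame_mx b X (c s).
have sXb k l q : chart_at q b -> smooth_fun_at q (fun r => X k r (chart_coord b l)).
  by move=> bq; apply: (frame_smooth fX k q).2; exact: smooth_fun_coord.
have sM k l : smooth_near t (fun s => Mx s k l).
  by apply: smooth_near_eq (sc.2 _ (sXb k l _ bt)) => s; rewrite mxE.
have nb := smooth_into_near sc (chart_at_near bt).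
pose Psi l (z : 'rV[R]_4 * R) := chart_coord b l (cinv a z.1 * c z.2)%g.
have sPsi l : smooth_near (cfun a 1%g, t) (Psi l).
  apply: (smooth_intoM _ _).2.
  - by apply: smooth_into_comp (smooth_near_fst _) _; exact: smooth_into_cinv.
  - exact: smooth_into_snd.
  - by rewrite /= (cfunK a1.2) mul1g; exact: smooth_fun_coord.
pose xi i := chart_field a (X i) (cfun a 1%g).
pose N s : 'M[R]_4 := \matrix_(i, l) X i 1%g (fun r => chart_coord b l (r * c s)%g).
have NE s : chart_at (c s) b -> N s = Ad (c s) *m Mx s.
  move=> bs; apply/matrixP => i l; rewrite !mxE AdE ?mul1g; last exact: smooth_fun_coord.
  by rewrite combEf; apply: eq_bigr => k _; rewrite !mxE.
have NPsi s i l : smooth_fun_at (c s) (chart_coord b l) ->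
    N s i l = 'D_(xi i, 0) (Psi l) (cfun a 1%g, s).
  move=> sl; rewrite mxE derive_fst.
  have s1 : smooth_fun_at 1%g (fun r => chart_coord b l (r * c s)%g).
    by apply: (right_translation_smooth (c s) 1%g).2; rewrite /right_translation mul1g.
  by rewrite (vfield_chartE a1 (frame_tangent fX _ i) s1).
have sN i l : smooth_near t (fun s => N s i l).
  have sD : smooth_near (cfun a 1%g, t) (fun z => 'D_(xi i, 0) (Psi l) z).
    exact: smooth_near_derive.
  have sp : smooth_near t (fun s => 'D_(xi i, 0) (Psi l) (cfun a 1%g, s)).
    exact: smooth_near_slice sD.
  apply: smooth_near_ext sp; apply: filterS nb => s bs.
  by rewrite NPsi //; exact: smooth_fun_coord.
have uM s : chart_at (c s) b -> Mx s \in unitmx by exact: frame_mx_unit.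
(* The rows of [Ad] are chosen pointwise; this product of smooth matrices is what makes [Ad] smooth
   along the curve. *)
have AdN : \forall s \near t, N s *m invmx (Mx s) = Ad (c s).
  by apply: filterS nb => s bs; rewrite NE // mulmxK ?uM.
have sAd : smooth_near t (fun s => Ad (c s)).
  apply: smooth_near_ext AdN _; apply: smooth_near_mulmx; apply/smooth_near_mxP => // i l.
  by apply: smooth_near_invmx => //; exact: uM.
split; first exact: smooth_near_derivable.
apply: (can_inj (mulmxK (uM t bt))).
apply/matrixP => i l.
have DM k : 'D_1 (fun s => Mx s k l) t = X j (c t) (fun r => X k r (chart_coord b l)).
  have [_ /(_ _ (sXb k l _ bt)) [_ <-]] := cP t td.
  have -> // : (fun s => Mx s k l) = (fun s => X k (c s) (chart_coord b l)).
  by apply/funext => s; rewrite mxE.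
(* The mixed derivatives of [Psi] are exchanged: the derivative along the curve comes first and
   gives [X j], then the one along [X i] at 1 passes through right translation by [c t] and gives
   [Ad]. *)
have DN : 'D_1 (fun s => N s i l) t =
    \sum_k Ad (c t) i k * X k (c t) (fun r => X j r (chart_coord b l)).
  transitivity ('D_1 (fun s => 'D_(xi i, 0) (Psi l) (cfun a 1%g, s)) t).
    apply: near_eq_derive; apply: filterS nb => s bs.
    by rewrite NPsi //; exact: smooth_fun_coord.
  rewrite -(derive_snd ('D_(xi i, 0) (Psi l))) smooth_near_comm // derive_fst.
  transitivity ('D_(xi i) (fun x => X j (cinv a x * c t)%g (chart_coord b l)) (cfun a 1%g)).
    apply: near_eq_derive.
    have nbr : \forall r \near (1%g : G), chart_at (r * c t)%g b.
      have rc : (fun r : G => (r * c t)%g) @ (1%g : G) --> (1 * c t)%g.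
        exact: (right_translation_smooth (c t) 1%g).1.
      by rewrite mul1g in rc; exact: (rc [set q | chart_at q b] (chart_at_near bt)).
    apply: filterS (near_cinv a1 nbr) => x bx; rewrite derive_snd.
    have sx : smooth_fun_at (cinv a x * c t * 1)%g (chart_coord b l).
      by rewrite mulg1; exact: smooth_fun_coord.
    have [_] := curve_derive cj td sx.
    rewrite Ad1 row1 comb_delta mulg1 => <-.
    have -> // : (fun y => Psi l (x, y)) = (fun s => chart_coord b l (cinv a x * c s * 1)%g).
    by apply/funext => s; rewrite /Psi mulg1.
  have sXj : smooth_fun_at (1 * c t)%g (fun r => X j r (chart_coord b l)).
    by rewrite mul1g; exact: sXb.
  have s2 : smooth_fun_at 1%g (fun r => X j (r * c t)%g (chart_coord b l)).
    exact: (right_translation_smooth (c t) 1%g).2 _ sXj.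
  have := vfield_chartE a1 (frame_tangent fX _ i) s2.
  rewrite -/(xi i) => <-; rewrite (AdE _ sXj) mul1g combEf.
  by apply: eq_bigr => k _; rewrite mxE.
have NM : 'D_1 (fun s => N s i l) t = 'D_1 (fun s => (Ad (c s) *m Mx s) i l) t.
  by apply: near_eq_derive; apply: filterS nb => s bs; rewrite NE.
have dAd i' k := derivableP (@smooth_near_derivable R _ _ _ _ (1 : R) (iffLR (smooth_near_mxP _ _) sAd i' k)).
have dM k l' := derivableP (@smooth_near_derivable R _ _ _ _ (1 : R) (sM k l')).
have DAdM : 'D_1 (fun s => (Ad (c s) *m Mx s) i l) t =
    \sum_k (Ad (c t) i k * 'D_1 (fun s => Mx s k l) t +
            Mx t k l * 'D_1 (fun s => Ad (c s) i k) t).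
  have -> : (fun s => (Ad (c s) *m Mx s) i l) = \sum_k (fun s => Ad (c s) i k * Mx s k l).
    by apply/funext => s; rewrite fct_sumE mxE.
  rewrite derive_sum => [|k]; last first.
    by apply: smooth_near_derivable; apply: smooth_nearM => //; move/smooth_near_mxP: sAd; exact.
  apply: eq_bigr => k _.
  by have [_ ->] := is_deriveM (dAd i k) (dM k l).
rewrite mxE (derive_mx (@smooth_near_derivable R _ _ _ _ (1 : R) sAd)).
have -> : (Ad (c t) *m ad_mx *m Mx t) i l =
    \sum_k Ad (c t) i k * lie_bracket (X k) (X j) (c t) (chart_coord b l).
  rewrite -mulmxA mxE; apply: eq_bigr => k _; congr (_ * _).
  by rewrite CX combEf mxE; apply: eq_bigr => m _; rewrite !mxE.
have -> : \sum_k Ad (c t) i k * lie_bracket (X k) (X j) (c t) (chart_coord b l) =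
  'D_1 (fun s => N s i l) t - \sum_k Ad (c t) i k * 'D_1 (fun s => Mx s k l) t.
  rewrite DN -sumrB; apply: eq_bigr => k _; rewrite -mulrBr DM lie_bracketE //.
  exact: smooth_fun_coord.
rewrite NM DAdM big_split /= addrAC subrr add0r.
by apply: eq_bigr => k _; rewrite mxE mulrC.
Qed.

End AdODE.

End Adjoint.

Lemma ord4_cases (j : 'I_4) : [\/ j = i1, j = i2, j = i3 | j = i4].
Proof.
case: j => [[|[|[|[|m]]]] lt] //.
- by constructor 1; exact: val_inj.
- by constructor 2; exact: val_inj.
- by constructor 3; exact: val_inj.
- by constructor 4; exact: val_inj.
Qed.

(** * Parametrization of a neighbourhood by products of integral curves *)

Section Parametrization.
Context {R : realType} {G : lieGroup4Type R}.
Variables (X : 'I_4 -> vfield R G) (C : 'I_4 -> 'I_4 -> 'rV[R]_4).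
Hypotheses (fX : frame X) (lX : left_invariant_frame X) (CX : structure X C).
Variables (d : R) (gamma : 'I_4 -> R -> G).
Hypothesis gammaP : forall j, integral_curve X j d (gamma j).

(** [head] and [tail] gather the factors of [phi] on either side of [gamma j]. Neither involves
    [t 0 j], so changing that coordinate moves a single factor. *)
Definition head (p : G) (t : 'rV[R]_4) (j : nat) : G :=
  (p * (if (0 < j)%N then gamma i1 (t 0 i1) else 1)
     * (if (1 < j)%N then gamma i2 (t 0 i2) else 1)
     * (if (2 < j)%N then gamma i3 (t 0 i3) else 1))%g.

Definition tail (t : 'rV[R]_4) (j : nat) : G :=
  ((if (j < 1)%N then gamma i2 (t 0 i2) else 1)
     * (if (j < 2)%N then gamma i3 (t 0 i3) else 1)
     * (if (j < 3)%N then gamma i4 (t 0 i4) else 1))%g.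

Definition phi (p : G) (t : 'rV[R]_4) : G :=
  (p * gamma i1 (t 0 i1) * gamma i2 (t 0 i2) * gamma i3 (t 0 i3) * gamma i4 (t 0 i4))%g.

Lemma phi_split p t (j : 'I_4) : phi p t = (head p t j * gamma j (t 0 j) * tail t j)%g.
Proof.
by case: (ord4_cases j) => ->; rewrite /phi /head /tail /= ?mulg1 ?mul1g ?mulgA.
Qed.

Lemma head_shift p (s : R) (t : 'rV[R]_4) (j : 'I_4) : head p (s *: ev j + t) j = head p t j.
Proof.
by case: (ord4_cases j) => ->; rewrite /head /= ?mxE /= ?mulr0 ?add0r.
Qed.

Lemma tail_shift (s : R) (t : 'rV[R]_4) (j : 'I_4) : tail (s *: ev j + t) j = tail t j.
Proof.
by case: (ord4_cases j) => ->; rewrite /tail /= ?mxE /= ?mulr0 ?add0r.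
Qed.

Lemma phi0 p : phi p 0 = p.
Proof.
rewrite /phi !mxE; have g0 j : gamma j 0 = 1%g by have [_ -> _] := gammaP j.
by rewrite !g0 !mulg1.
Qed.

Lemma smooth_into_coord (M : manifold4Type R) (c : R -> M) n (t : 'rV[R]_n) j :
  smooth_into (t 0 j) c -> smooth_into t (fun s : 'rV[R]_n => c (s 0 j)).
Proof.
move=> [cc sc]; split.
  apply: (@continuous_comp _ _ _ (fun s : 'rV[R]_n => s 0 j) c) => //.
  exact: coord_continuous.
move=> f /sc sf.
pose L : {linear 'rV[R]_n -> R} := HB.pack (fun x : 'rV[R]_n => x 0 j)
  (GRing.isLinear.Build _ _ _ _ (fun x : 'rV[R]_n => x 0 j)
     (fun a u v => (etrans (mxE _ _ _ _) (congr1 (fun z => z + v 0 j) (mxE _ _ _ _))))).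
by apply: (@smooth_near_lin_comp R _ _ _ L t (fun y => f (c y))) => //; exact: coord_continuous.
Qed.

Lemma coord_lt (t : 'rV[R]_4) (e : R) j : `|t| < e -> `|t 0 j| < e.
Proof. exact: le_lt_trans (mx_norm_coord _ _ _). Qed.

Lemma phi_smooth p t : `|t| < d -> smooth_into t (phi p).
Proof.
move=> td; have sg j : smooth_into t (fun s : 'rV[R]_4 => gamma j (s 0 j)).
  apply: smooth_into_coord; have [_ _ cP] := gammaP j.
  by have [] := cP _ (coord_lt j td).
rewrite /phi; do 4 (apply: smooth_intoM => //); exact: smooth_into_cst.
Qed.

Lemma derive_coord_line (F : 'rV[R]_4 -> R) (H : R -> R) t j v :
  (forall s, F (s *: ev j + t) = H (s + t 0 j)) -> is_derive (t 0 j) (1 : R) H v ->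
  'D_(ev j) F t = v.
Proof.
move=> FH [_ <-]; rewrite /derive.
have -> // : (fun h : R => h^-1 *: ((F \o shift t) (h *: ev j) - F t)) =
  (fun h : R => h^-1 *: ((H \o shift (t 0 j)) (h *: (1 : R)) - H (t 0 j))).
apply/funext => h /=; rewrite FH [h *: 1]mulr1; congr (_ *: (_ - _)).
by have := FH 0; rewrite scale0r !add0r.
Qed.

(* Moving the factor gamma j to the right end of the product turns X j into
   Ad of the factors that follow it. *)
Definition pull_mx (t : 'rV[R]_4) : 'M[R]_4 := \matrix_j row j (Ad X (tail t j)).

Lemma phi_derive p t j f : `|t| < d -> smooth_fun_at (phi p t) f ->
  'D_(ev j) (fun s => f (phi p s)) t = comb X (row j (pull_mx t)) (phi p t) f.
Proof.
move=> td; rewrite (phi_split p t j) => sf; rewrite rowK.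
apply: derive_coord_line (curve_derive fX lX (gammaP j) (coord_lt j td) sf) => s.
by rewrite (phi_split p _ j) head_shift tail_shift !mxE !eqxx mulr1.
Qed.

(** Expressed through [Ad] along the four curves separately, the matrix can be compared between two
    groups. *)
Lemma pull_mx_Ad t : pull_mx t = \matrix_j row j
  ((if (j < 1)%N then Ad X (gamma i2 (t 0 i2)) else 1%:M) *m
   (if (j < 2)%N then Ad X (gamma i3 (t 0 i3)) else 1%:M) *m
   (if (j < 3)%N then Ad X (gamma i4 (t 0 i4)) else 1%:M)).
Proof.
apply/row_matrixP => j; rewrite /pull_mx [LHS]rowK [RHS]rowK /tail !(AdM fX lX).
by case: (ord4_cases j) => -> /=; rewrite ?(Ad1 fX lX).
Qed.

Lemma pull_mx0 : pull_mx 0 = 1%:M.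
Proof.
have g0 j : gamma j 0 = 1%g by have [_ -> _] := gammaP j.
rewrite pull_mx_Ad; apply/row_matrixP => j; rewrite rowK !mxE !g0 !(Ad1 fX lX).
by rewrite !if_same !mulmx1.
Qed.

Definition chart_phi p c (t : 'rV[R]_4) : 'rV[R]_4 := cfun c (phi p t).

Lemma chart_phi_smooth p c t : `|t| < d -> chart_at (phi p t) c -> smooth_near t (chart_phi p c).
Proof. by move=> td ct; apply: smooth_into_chart => //; exact: phi_smooth. Qed.

Lemma jacobian_phi p c t : `|t| < d -> chart_at (phi p t) c ->
  jacobian_mx (chart_phi p c) t = pull_mx t *m frame_mx c X (phi p t).
Proof.
move=> td ct; apply/matrixP => i j; rewrite mxE.
have := phi_derive i td (smooth_fun_coord j ct).
have sc := chart_phi_smooth td ct.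
rewrite (derive_mx (@smooth_near_derivable R _ _ _ _ (ev i) sc)) mxE => ->.
by rewrite combEf mxE; apply: eq_bigr => k _; rewrite !mxE.
Qed.

Lemma phi_local_diffeo p : exists (c : chart R G) (U V : set 'rV[R]_4) (h : 'rV[R]_4 -> 'rV[R]_4),
  [/\ open U, U 0, open V & smooth_on V h] /\
  [/\ forall t, U t -> `|t| < d, forall t, U t -> chart_at (phi p t) c,
      forall t, U t -> pull_mx t \in unitmx,
      chart_phi p c @` U = V & forall t, U t -> h (chart_phi p c t) = t].
Proof.
have d0 : 0 < d by have [] := gammaP i1.
have [c cp] := chart_exists p.
have td0 : `|0 : 'rV[R]_4| < d by rewrite normr0.
have cp0 : chart_at (phi p 0) c by rewrite phi0.
have s0 := chart_phi_smooth td0 cp0.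
have uM q : chart_at q c -> frame_mx c X q \in unitmx by exact: frame_mx_unit.
have uJ : jacobian_mx (chart_phi p c) 0 \in unitmx.
  by rewrite jacobian_phi // pull_mx0 mul1mx uM.
have [U0 [V0 [h [[oU0 U00 oV0 V00] [fU0 hf sf sh]]]]] := inverse_function s0 uJ.
have n1 : \forall t \near (0 : 'rV[R]_4), `|t| < d by exact: nbhs0_lt.
have n2 := smooth_into_near (phi_smooth p td0) (chart_at_near cp0).
have n3 := jacobian_mx_unit s0 uJ.
pose P t := [/\ `|t| < d, chart_at (phi p t) c & jacobian_mx (chart_phi p c) t \in unitmx].
have nP : nbhs (0 : 'rV[R]_4) [set t | P t] by apply: filterS3 n1 n2 n3 => t; split.
pose U := U0 `&` interior [set t | P t].
have UP t : U t -> P t by move=> [_ /interior_subset].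
have oU : open U by apply: openI => //; exact: open_interior.
have oV : open (V0 `&` h @^-1` U).
  rewrite openE => y [Vy Uhy]; apply: filterI; first exact: open_nbhs_nbhs.
  by apply: (Ck_cont (sh 0) Vy); exact: open_nbhs_nbhs.
exists c, U, (V0 `&` h @^-1` U), h; split; split => //.
- by move=> k; apply: Ck_sub (sh k) => y [].
- by move=> t /UP [].
- by move=> t /UP [].
(* The Jacobian factors through [pull_mx t], so its invertibility passes to that factor. *)
- move=> t /UP [td ct]; rewrite jacobian_phi // unitmx_mul => /andP[]; by [].
- apply/seteqP; split=> [_ [t Ut <-]|y [Vy Uhy]].
    have [U0t _] := Ut; split; first by rewrite -fU0; exists t.
    by rewrite /preimage /= hf.
  move: Vy; rewrite -fU0 => -[t U0t ty]; exists t => //.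
  by move: Uhy; rewrite /preimage /= -ty hf.
- by move=> t [U0t _]; exact: hf.
Qed.

End Parametrization.

Lemma min4 (R : realType) (f : 'I_4 -> R) : (forall j, 0 < f j) ->
  exists2 d, 0 < d & forall j, d <= f j.
Proof.
move=> f0; exists (Num.min (Num.min (f i1) (f i2)) (Num.min (f i3) (f i4))).
  by rewrite !lt_min !f0.
by move=> j; rewrite !ge_min; case: (ord4_cases j) => ->; rewrite lexx ?orbT.
Qed.

Lemma integral_curve_le (R : realType) (G : lieGroup4Type R) (X : 'I_4 -> vfield R G) i (d d' : R) c :
  0 < d' -> d' <= d -> integral_curve X i d c -> integral_curve X i d' c.
Proof. by move=> d'0 dd [_ c0 cP]; split=> // t td; apply: cP; exact: lt_le_trans dd. Qed.

Lemma integral_curves_exist (R : realType) (G : lieGroup4Type R) (X : 'I_4 -> vfield R G) :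
  frame X -> exists gamma d, forall j, integral_curve X j d (gamma j).
Proof.
move=> fX; have /choice [gamma /choice [d dP]] := integral_curve_exists fX.
have [|e e0 ed] := @min4 R d; first by move=> j; have [] := dP j.
by exists gamma, e => j; exact: integral_curve_le (ed j) (dP j).
Qed.

Section LocalInverse.
Context {R : realType} {G : lieGroup4Type R}.
Variables (X : 'I_4 -> vfield R G) (d : R) (gamma : 'I_4 -> R -> G) (p : G)
  (c : chart R G) (U V : set 'rV[R]_4) (h : 'rV[R]_4 -> 'rV[R]_4).

Definition local_inverse :=
  [/\ open U, U 0, open V & smooth_on V h] /\
  [/\ forall t, U t -> `|t| < d, forall t, U t -> chart_at (phi gamma p t) c,
      forall t, U t -> pull_mx X gamma t \in unitmx,
      chart_phi gamma p c @` U = V & forall t, U t -> h (chart_phi gamma p c t) = t].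

Hypothesis inv : local_inverse.

Lemma local_inverse_image W : open W -> W `<=` U -> open (phi gamma p @` W).
Proof.
move=> oW WU; have [[oU U0 oV sh] [Ud Uc Uu fU hf]] := inv.
have E x : chart_at x c -> V (cfun c x) -> W (h (cfun c x)) -> (phi gamma p @` W) x.
  move=> cx; rewrite -fU => -[t Ut tx] Wt; have {}Wt : W t by rewrite -(hf _ Ut) tx.
  exists t => //; rewrite -(cfunK cx.2) -tx /chart_phi cfunK //; exact: (Uc _ Ut).2.
rewrite openE => _ [t Wt <-]; have Ut := WU _ Wt; have ct := Uc _ Ut.
have Vt : V (cfun c (phi gamma p t)) by rewrite -fU; exists t.
have nV : nbhs (cfun c (phi gamma p t)) V by exact: open_nbhs_nbhs.
have nW : nbhs (cfun c (phi gamma p t)) (h @^-1` W).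
  apply: (Ck_cont (sh 0) Vt); rewrite -[cfun c _]/(chart_phi gamma p c t) hf //.
  exact: open_nbhs_nbhs.
by apply: filterS3 (chart_at_near ct) (near_cfun ct nV) (near_cfun ct nW) => x; exact: E.
Qed.

Lemma local_inverseK t : U t -> h (cfun c (phi gamma p t)) = t.
Proof. by move=> Ut; have [_ [_ _ _ _ hf]] := inv; exact: hf. Qed.

Lemma smooth_into_inverse (N : manifold4Type R) (psi : 'rV[R]_4 -> N) t : U t ->
  smooth_into t psi -> smooth_pullback (phi gamma p t) (fun x => psi (h (cfun c x))).
Proof.
move=> Ut spsi; have [[oU U0 oV sh] [Ud Uc Uu fU hf]] := inv; have ct := Uc _ Ut.
have sht : smooth_near (cfun c (phi gamma p t)) h.
  by exists V; split=> //; rewrite -fU; exists t.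
have sc : smooth_into (cfun c (phi gamma p t)) (fun y => psi (h y)).
  by apply: smooth_into_comp => //; rewrite local_inverseK.
split.
  apply: (@continuous_comp _ _ _ (cfun c) (fun y => psi (h y))).
    exact: cfun_continuous ct.2.
  exact: sc.1.
move=> f sf.
apply: (smooth_fun_chart ct); have := sc.2 _ sf; apply: smooth_near_ext.
by apply: filterS (cinvK_near ct) => x [_ xE]; rewrite /= xE.
Qed.

End LocalInverse.

Section LocalFrameMap.
Context {R : realType} {G G' : lieGroup4Type R}.
Variables (X : 'I_4 -> vfield R G) (X' : 'I_4 -> vfield R G') (C : 'I_4 -> 'I_4 -> 'rV[R]_4).
Hypotheses (fX : frame X) (lX : left_invariant_frame X) (CX : structure X C).
Hypotheses (fX' : frame X') (lX' : left_invariant_frame X') (CX' : structure X' C).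

(** Both sides start at the identity and solve the same linear equation, because [ad_mx] depends on
    [C] and [j] only; their difference vanishes by [linear_ode_unique]. *)
Lemma Ad_curve_eq j (d : R) c c' : integral_curve X j d c -> integral_curve X' j d c' ->
  exists2 e, 0 < e & forall t, `|t| < e -> Ad X (c t) = Ad X' (c' t).
Proof.
move=> cj cj'; have [d0 c0 _] := cj; have [_ c0' _] := cj'.
have D0 : Ad X (c 0) - Ad X' (c' 0) = 0.
  by rewrite c0 c0' (Ad1 fX lX) (Ad1 fX' lX') subrr.
have [|e e0 eP] := @linear_ode_unique R 4 (ad_mx C j) (fun t => Ad X (c t) - Ad X' (c' t)) d d0 D0.
  move=> t td; rewrite mulmxBl.
  exact: (is_deriveB_fun (Ad_derive fX lX CX cj td) (Ad_derive fX' lX' CX' cj' td)).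
by exists e => // t /eP /eqP; rewrite subr_eq0 => /eqP.
Qed.

Lemma local_frame_map (p : G) (q : G') :
  exists (U : set G) (V : set G') (F : G -> G') (F' : G' -> G),
    [/\ [/\ open U, U p, open V, V q & F p = q],
        [/\ F @` U = V, forall x, U x -> F' (F x) = x,
            forall x, U x -> smooth_map_at x F
          & forall y, V y -> smooth_map_at y F']
      & forall x, U x -> forall k, tangent_map F x (X k x) = X' k (F x)].
Proof.
have [gamma [d gP]] := integral_curves_exist fX.
have [gamma' [d' gP']] := integral_curves_exist fX'.
have d0 : 0 < d by have [] := gP i1.
have d0' : 0 < d' by have [] := gP' i1.
pose d1 := Num.min d d'; have d10 : 0 < d1 by rewrite lt_min d0.
have gP1 j : integral_curve X j d1 (gamma j).
  by apply: integral_curve_le (gP j) => //; rewrite ge_min lexx.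
have gP1' j : integral_curve X' j d1 (gamma' j).
  by apply: integral_curve_le (gP' j) => //; rewrite ge_min lexx orbT.
have /choice [e eP] : forall j, exists e, 0 < e /\
    forall t, `|t| < e -> Ad X (gamma j t) = Ad X' (gamma' j t).
  by move=> j; have [e e0 eP] := Ad_curve_eq (gP1 j) (gP1' j); exists e.
have [|e1 e10 e1e] := @min4 R e; first by move=> j; have [] := eP j.
pose d2 := Num.min d1 e1; have d20 : 0 < d2 by rewrite lt_min d10.
have gP2 j : integral_curve X j d2 (gamma j).
  by apply: integral_curve_le (gP1 j) => //; rewrite ge_min lexx.
have gP2' j : integral_curve X' j d2 (gamma' j).
  by apply: integral_curve_le (gP1' j) => //; rewrite ge_min lexx.
have pullE (t : 'rV[R]_4) : `|t| < d2 -> pull_mx X gamma t = pull_mx X' gamma' t.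
  rewrite lt_min => /andP[_ te].
  have AE j : Ad X (gamma j (t 0 j)) = Ad X' (gamma' j (t 0 j)).
    by have [_ ->] := eP j; rewrite // (lt_le_trans (coord_lt j te)).
  by rewrite (pull_mx_Ad fX lX) (pull_mx_Ad fX' lX') !AE.
have [c [U [V [h inv]]]] := phi_local_diffeo fX lX gP2 p.
have [c' [U' [V' [h' inv']]]] := phi_local_diffeo fX' lX' gP2' q.
rewrite -/(local_inverse X d2 gamma p c U V h) in inv.
rewrite -/(local_inverse X' d2 gamma' q c' U' V' h') in inv'.
have [[oU U0 _ _] [Ud Uc Uu _ _]] := inv.
have [[oU' U0' _ _] [Ud' Uc' Uu' _ _]] := inv'.
(* The parameters at which both parametrizations can be inverted; open neighbourhoods in the two
   groups are obtained as images of this one set. *)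
pose W := U `&` U'; have oW : open W by exact: openI.
have W0 : W 0 by split.
have WU : W `<=` U by move=> t [].
have WU' : W `<=` U' by move=> t [].
pose F x := phi gamma' q (h (cfun c x)).
pose F' y := phi gamma p (h' (cfun c' y)).
have FE t : W t -> F (phi gamma p t) = phi gamma' q t.
  by move=> [Ut _]; rewrite /F (local_inverseK inv).
have FE' t : W t -> F' (phi gamma' q t) = phi gamma p t.
  by move=> [_ Ut]; rewrite /F' (local_inverseK inv').
have sF t : W t -> smooth_pullback (phi gamma p t) F.
  move=> [Ut Ut']; apply: (smooth_into_inverse inv Ut).
  by apply: phi_smooth gP2' _ _ _; exact: Ud'.
have sF' t : W t -> smooth_pullback (phi gamma' q t) F'.
  move=> [Ut Ut']; apply: (smooth_into_inverse inv' Ut').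
  by apply: phi_smooth gP2 _ _ _; exact: Ud.
have oI := local_inverse_image inv oW WU.
have oI' := local_inverse_image inv' oW WU'.
exists (phi gamma p @` W), (phi gamma' q @` W), F, F'; split; [split => //|split => //|].
- by exists 0 => //; exact: phi0 gP2 p.
- by exists 0 => //; exact: phi0 gP2' q.
- by rewrite -{1}(phi0 gP2 p) FE // (phi0 gP2').
- apply/seteqP; split=> [_ [_ [t Wt <-] <-]|_ [t Wt <-]].
    by rewrite FE //; exists t.
  by exists (phi gamma p t); [exists t|rewrite FE].
- by move=> _ [t Wt <-]; rewrite FE // FE'.
- by move=> _ [t Wt <-]; apply: smooth_pullback_map; exact: sF.
- by move=> _ [t Wt <-]; apply: smooth_pullback_map; exact: sF'.
- move=> _ [t Wt <-].
  have [Ut Ut'] := Wt; have td : `|t| < d2 by exact: Ud.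
  have tX : forall k, tangent (F (phi gamma p t)) (tangent_map F (phi gamma p t) (X k (phi gamma p t))).
    by move=> k; apply: tangent_map_tangent (sF t Wt) (frame_tangent fX _ k).
  have key f : smooth_fun_at (F (phi gamma p t)) f ->
      forall k, X k (phi gamma p t) (fun x => f (F x)) = X' k (F (phi gamma p t)) f.
    move=> sf.
    have sfF : smooth_fun_at (phi gamma p t) (fun x => f (F x)) by exact: (sF t Wt).2.
    pose u : 'cV[R]_4 := \col_k X k (phi gamma p t) (fun x => f (F x)).
    pose u' : 'cV[R]_4 := \col_k X' k (F (phi gamma p t)) f.
    suff E : u = u' by move=> k; have /colP /(_ k) := E; rewrite !mxE.
    (* Multiplied by [pull_mx], both columns become the derivatives of one function of the
       parameters, since [F] carries [phi] to its counterpart in the second group. *)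
    apply: (can_inj (mulKmx (Uu _ Ut))); apply/colP => j.
    have sf' : smooth_fun_at (phi gamma' q t) f by rewrite -FE.
    have D1 := phi_derive fX lX gP2 j td sfF.
    have D2 := phi_derive fX' lX' gP2' j td sf'.
    have DD : 'D_(delta_mx 0 j) (fun s => f (F (phi gamma p s))) t =
        'D_(delta_mx 0 j) (fun s => f (phi gamma' q s)) t.
      by apply: near_eq_derive; apply: filterS (open_nbhs_nbhs (conj oW Wt)) => s Ws; rewrite FE.
    rewrite D1 D2 !combEf (pullE _ td) in DD.
    rewrite !mxE; move: DD; rewrite (pullE _ td) => DD.
    transitivity (\sum_i row j (pull_mx X' gamma' t) 0 i * X i (phi gamma p t) (fun r => f (F r))).
      by apply: eq_bigr => i _; rewrite !mxE.
    by rewrite DD; apply: eq_bigr => i _; rewrite !mxE FE.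
  move=> k; apply/funext => f.
  have [sf|sf] := pselect (smooth_fun_at (F (phi gamma p t)) f).
    by rewrite tangent_mapE //; exact: key.
  by rewrite (tangent_out (tX k) sf) (tangent_out (frame_tangent fX' _ k) sf).
Qed.

End LocalFrameMap.

(** * Canonical frames with equal structure constants *)

Lemma lspan2P (R : realType) (V : lmodType R) (u w v : V) :
  lspan [set u; w] v <-> exists s t, v = s *: u + t *: w.
Proof.
split=> [[n [a [E [EP ->]]]]|[s [t ->]]].
  suff H (r : seq 'I_n) : exists s t, \sum_(i <- r) a i *: E i = s *: u + t *: w by exact: H.
  elim: r => [|i r [s [t IH]]]; first by exists 0, 0; rewrite big_nil !scale0r addr0.
  rewrite big_cons IH; case: (EP i) => ->.
    by exists (a i + s), t; rewrite scalerDl addrA.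
  by exists s, (a i + t); rewrite scalerDl addrCA.
exists 2, (fun i => if i == ord0 then s else t), (fun i => if i == ord0 then u else w).
split; first by move=> i; case: ifP => _; [left|right].
by rewrite !big_ord_recl big_ord0 /= addr0.
Qed.

Section GramSchmidt.
Context {R : realType} {V : lmodType R} (P : set V) (m : V -> V -> R).
Hypotheses (P0 : P 0) (Plin : forall (a : R) u v, P u -> P v -> P (a *: u + v)).
Hypothesis msym : forall u v, P u -> P v -> m u v = m v u.
Hypothesis mlin : forall (a : R) u v w, P u -> P v -> P w -> m (a *: u + v) w = a * m u w + m v w.
Hypothesis mpos : forall v, P v -> v != 0 -> 0 < m v v.

Let PZ (a : R) u : P u -> P (a *: u).
Proof. by move=> Pu; rewrite -[_ *: _]addr0; exact: Plin. Qed.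

Let m0 w : P w -> m 0 w = 0.
Proof. by move=> Pw; have := mlin 1 P0 P0 Pw; rewrite scaler0 addr0; lra. Qed.

Let mZ (a : R) u w : P u -> P w -> m (a *: u) w = a * m u w.
Proof. by move=> Pu Pw; rewrite -[a *: u]addr0 mlin // m0 // addr0. Qed.

Let mZr (a : R) u w : P u -> P w -> m u (a *: w) = a * m u w.
Proof. by move=> Pu Pw; rewrite msym ?mZ 1?msym //; exact: PZ. Qed.

(** Bilinearity and symmetry are available only on [P], as the values of an Engel metric outside the
    distribution are arbitrary. *)
Lemma metric_orthonormal e1 e2 (s t s' t' : R) : P e1 -> P e2 ->
  m e1 e1 = 1 -> m e2 e2 = 1 -> m e1 e2 = 0 ->
  m (s *: e1 + t *: e2) (s' *: e1 + t' *: e2) = s * s' + t * t'.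
Proof.
move=> P1 P2 m11 m22 m12; have m21 : m e2 e1 = 0 by rewrite msym.
have Pst (a b : R) : P (a *: e1 + b *: e2) by apply: Plin => //; exact: PZ.
rewrite mlin ?mZ // ?(msym _ (Pst s' t')) ?mlin ?mZ // ?m11 ?m12 ?m21 ?m22; try exact: PZ.
by ring.
Qed.

Let normalize w : P w -> w != 0 -> exists2 k, k != 0 & m (k *: w) (k *: w) = 1.
Proof.
move=> Pw w0; have r0 := mpos Pw w0; exists (Num.sqrt (m w w))^-1.
  by rewrite invr_neq0 // gt_eqF // sqrtr_gt0.
rewrite mZ ?mZr //; last exact: PZ.
by rewrite mulrA -expr2 exprVn sqr_sqrtr ?ltW // mulVf ?gt_eqF.
Qed.

Lemma orthonormal_pair u w : (forall s t : R, s *: u + t *: w = 0 -> s = 0 /\ t = 0) ->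
  (forall v, P v <-> exists s t : R, v = s *: u + t *: w) ->
  exists e1 e2, [/\ forall v, P v <-> exists s t : R, v = s *: e1 + t *: e2,
    m e1 e1 = 1, m e2 e2 = 1 & m e1 e2 = 0].
Proof.
move=> iuw PE.
have Pu : P u by apply/PE; exists 1, 0; rewrite scale1r scale0r addr0.
have Pw : P w by apply/PE; exists 0, 1; rewrite scale1r scale0r add0r.
have u0 : u != 0.
  apply/eqP => u0; have [|/eqP] := iuw 1 0; first by rewrite u0 scaler0 scale0r addr0.
  by rewrite oner_eq0.
have [k k0 mk] := normalize Pu u0; set e1 := k *: u in mk.
have P1 : P e1 by exact: PZ.
pose mu := m w e1; pose w' := - mu *: e1 + w.
have Pw' : P w' by exact: Plin.
have w'0 : w' != 0.
  apply/eqP => w'0; have [|_ /eqP] := iuw (- mu * k) 1; first by rewrite -scalerA scale1r.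
  by rewrite oner_eq0.
have [l l0 ml] := normalize Pw' w'0; set e2 := l *: w' in ml.
have P2 : P e2 by exact: PZ.
exists e1, e2; split=> //; last first.
  rewrite msym // mZ // mlin // mk -/mu; ring.
move=> v; split=> [/PE [s [t ->]]|[s [t ->]]]; last by apply: Plin => //; exact: PZ.
(* [u] is [e1] divided by [k], and [w] is [mu *: e1] plus [e2] divided by [l]. *)
exists (s / k + t * mu), (t / l).
have -> : (t / l) *: e2 = t *: w' by rewrite /e2 scalerA divfK.
have -> : s *: u = (s / k) *: e1 by rewrite /e1 scalerA divfK.
suff aux (a b c : R) (x y : V) : a *: x + b *: y = (a + b * c) *: x + b *: (- c *: x + y) by exact: aux.
by rewrite scalerDr scalerDl scalerA mulrN scaleNr !addrA addrK.
Qed.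

End GramSchmidt.

Section CanonicalIsometry.
Context {R : realType} {M : manifold4Type R}.
Variables (S : engel_structure M) (X : 'I_4 -> vfield R M).
Hypothesis cX : canonical_frame S X.

Lemma canonical_frame_frame : frame X.
Proof. by case: cX. Qed.

Lemma canonical_distP p v : engel_dist S p v <-> exists s t, v = s *: X i1 p + t *: X i2 p.
Proof. by case: cX => _ /(_ p) [-> _ _ _] _ _ _; exact: lspan2P. Qed.

Lemma canonical_metricE p (a b a' b' : R) :
  engel_metric S p (a *: X i1 p + b *: X i2 p) (a' *: X i1 p + b' *: X i2 p) = a * a' + b * b'.
Proof.
have [sym lin _ _] := emetricP S.
have [_ /(_ p) [_ g11 g22 g12] _ _ _] := cX.
have D s t : engel_dist S p (s *: X i1 p + t *: X i2 p) by apply/canonical_distP; exists s, t.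
have D1 := D 1 0; have D2 := D 0 1; rewrite !(scale1r, scale0r, addr0, add0r) in D1 D2.
apply: (metric_orthonormal _ _ (@sym p) (@lin p)) => //.
  by have := D 0 0; rewrite !scale0r addr0.
move=> r _ _ /canonical_distP [s [t ->]] /canonical_distP [s' [t' ->]].
by rewrite scalerDr !scalerA addrACA -!scalerDl.
Qed.

End CanonicalIsometry.

Lemma frame_map_isometry (R : realType) (M N : manifold4Type R) (S : engel_structure M)
    (S' : engel_structure N) X X' (F : M -> N) (x : M) :
  canonical_frame S X -> canonical_frame S' X' ->
  (forall k, tangent_map F x (X k x) = X' k (F x)) -> isometry_at S S' F x.
Proof.
move=> cX cX' FX.
have TF (s t : R) : tangent_map F x (s *: X i1 x + t *: X i2 x) =
    s *: X' i1 (F x) + t *: X' i2 (F x).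
  rewrite -!FX; have := tangent_map_lin F x (fun i : 'I_2 => if i == ord0 then s else t)
    (fun i : 'I_2 => if i == ord0 then X i1 x else X i2 x).
  by rewrite !big_ord_recl !big_ord0 /= !addr0.
split.
  apply/seteqP; split=> [v /(canonical_distP cX') [s [t ->]]|_ [v /(canonical_distP cX) [s [t ->]] <-]].
    by exists (s *: X i1 x + t *: X i2 x); [apply/(canonical_distP cX); exists s, t|].
  by rewrite TF; apply/(canonical_distP cX'); exists s, t.
move=> v w /(canonical_distP cX) [s [t ->]] /(canonical_distP cX) [s' [t' ->]].
by rewrite !TF (canonical_metricE cX) (canonical_metricE cX').
Qed.

Lemma canonical_locally_isometric (R : realType) (G G' : lieGroup4Type R)
    (S : engel_structure G) (S' : engel_structure G') X X' C :
  canonical_frame S X -> left_invariant_frame X -> structure X C ->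
  canonical_frame S' X' -> left_invariant_frame X' -> structure X' C ->
  locally_isometric S S'.
Proof.
move=> cX lX CX cX' lX' CX' p q.
have [U [V [F [F' [H1 H2 H3]]]]] := local_frame_map (canonical_frame_frame cX) lX CX
  (canonical_frame_frame cX') lX' CX' p q.
exists U, V, F, F'; split=> // x Ux.
exact: frame_map_isometry cX cX' (H3 x Ux).
Qed.

(** * The families *)

(* a is the component [X1, X4]^1. *)
Lemma engel_jacobi_cases (R : realType) (a T1 T2 T3 T4 T5 T6 : R) :
  2 * a = T1 * T4 -> 2 * (T2 * T5) = T1 * (a - T1 * T4) ->
  2 * (T4 * T5) = T1 * (T2 * T5 - T3 * T4) -> T1 * T6 + 2 * (T2 * T4) = 0 ->
  a * T4 = - (T5 * T6) + T1 * (a * T2 - T3 * T6) ->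
  (a - T1 * T4) * T6 = a * T6 + 2 * (T2 * (a * T2 - T3 * T6)) ->
  [\/ [/\ T2 = 0, T4 = 0 & T6 = 0], [/\ T4 = 0, T5 = 0 & T6 = 0],
      [/\ T1 = 0, T2 = 0 & T5 = 0] | [/\ T1 = 0, T3 = 0, T4 = 0 & T5 = 0]] \/
  [/\ T1 != 0, T4 = 2^-1 * (T2 * (T1 ^+ 2 + 4 * T3) / T1),
      T5 = - (8^-1 * T1 ^+ 3) - 2^-1 * (T1 * T3) &
      T6 = - (T2 ^+ 2 * (T1 ^+ 2 + 4 * T3) / T1 ^+ 2)].
Proof.
move=> E1 E2 E3 E4 E5 E6.
have [T10|T1n0] := eqVneq T1 0.
  left; subst T1; have a0 : a = 0 by move: E1; lra.
  subst a; have [T50|T5n0] := eqVneq T5 0.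
    subst T5; have [T20|T2n0] := eqVneq T2 0; first by constructor 3.
    have T40 : T4 = 0 by apply: (mulfI T2n0); move: E4; lra.
    subst T4; have [T60|T6n0] := eqVneq T6 0; first by constructor 2.
    have T30 : T3 = 0 by apply: (mulIf T6n0); apply: (mulfI T2n0); move: E6; lra.
    by constructor 4.
  have T20 : T2 = 0 by apply: (mulIf T5n0); move: E2; lra.
  have T40 : T4 = 0 by apply: (mulIf T5n0); move: E3; lra.
  have T60 : T6 = 0 by apply: (mulfI T5n0); move: E5; lra.
  by constructor 1.
(* For nonzero [T1], the first two equations give [T4] and the fourth gives [T6]; [T2 = 0] or
   [T5 = 0] then leads to the first two families. *)
have T4E : T4 = - 4 * T2 * T5 / T1 ^+ 2.
  have -> : T4 = (T1 ^+ 2 * T4) / T1 ^+ 2 by rewrite mulrAC divff ?mul1r // expf_neq0.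
  congr (_ / _); have : 4 * (T2 * T5) = - (T1 * (T1 * T4)).
    have -> : 4 * (T2 * T5) = 2 * (2 * (T2 * T5)) by ring.
    by rewrite E2 mulrCA mulrBr E1; ring.
  move=> H; have -> : - 4 * T2 * T5 = - (4 * (T2 * T5)) by ring.
  by rewrite H; ring.
have T6E : T6 = - 2 * T2 * T4 / T1.
  have -> : T6 = (T1 * T6) / T1 by rewrite mulrAC divff ?mul1r.
  by congr (_ / _); move: E4; lra.
have [T20|T2n0] := eqVneq T2 0.
  left; constructor 1; split=> //.
    by rewrite T4E T20 mulr0 !mul0r.
  by rewrite T6E T20 mulr0 !mul0r.
have [T50|T5n0] := eqVneq T5 0.
  have T40 : T4 = 0 by rewrite T4E T50 mulr0 mul0r.
  by left; constructor 2; split=> //; rewrite T6E T40 mulr0 mul0r.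
have T5E : T5 = - (8^-1 * T1 ^+ 3) - 2^-1 * (T1 * T3).
  (* The third equation after substitution of [T4]; its last factor is the relation between [T5],
     [T1] and [T3] in the fifth family. *)
  have H : T2 * T5 * (8 * T5 + T1 ^+ 3 + 4 * (T1 * T3)) = 0.
    have -> : T2 * T5 * (8 * T5 + T1 ^+ 3 + 4 * (T1 * T3)) =
      T1 ^+ 2 * (T1 * (T2 * T5 - T3 * T4) - 2 * (T4 * T5)).
      by rewrite T4E; field.
    by rewrite -E3 subrr mulr0.
  move/eqP: H; rewrite mulf_eq0 mulf_eq0 (negbTE T2n0) (negbTE T5n0) /= => /eqP.
  by lra.
right; split=> //.
  by rewrite T4E T5E; field.
by rewrite T6E T4E T5E; field.
Qed.

Lemma sum4 (V : nmodType) (F : 'I_4 -> V) : \sum_i F i = F i1 + F i2 + F i3 + F i4.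
Proof.
rewrite !big_ord_recl big_ord0 addr0 !addrA.
by congr (F _ + F _ + F _ + F _); apply/val_inj.
Qed.

(** All that a canonical frame contributes to the classification: antisymmetry, the Jacobi identity
    in coordinates, and the three normalizations of the frame. From here on the argument is pure
    algebra. *)
Definition engel_constants (R : realType) (C : 'I_4 -> 'I_4 -> 'rV[R]_4) :=
  [/\ forall i j, C i j = - C j i,
      forall i j k m, \sum_l C j k 0 l * C i l 0 m =
        \sum_l C i j 0 l * C l k 0 m + \sum_l C i k 0 l * C j l 0 m,
      C i1 i2 = delta_mx 0 i3, C i1 i3 = delta_mx 0 i4 & C i2 i3 0 i4 = 0].

Section EngelConstants.
Context {R : realType} (C : 'I_4 -> 'I_4 -> 'rV[R]_4).
Hypothesis HC : engel_constants C.
Let a := C i1 i4 0 i1.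
Let T1 := C i1 i4 0 i4.
Let T2 := C i2 i3 0 i3.
Let T3 := C i1 i4 0 i3.
Let T4 := C i2 i3 0 i2.
Let T5 := C i1 i4 0 i2.
Let T6 := C i2 i3 0 i1.

Let anti i j m : C i j 0 m = - C j i 0 m.
Proof. by have [A _ _ _ _] := HC; rewrite (A i j) mxE. Qed.

Let diag i m : C i i 0 m = 0.
Proof. by have := anti i i m; lra. Qed.

Let C12 m : C i1 i2 0 m = (m == i3)%:R.
Proof. by have [_ _ E _ _] := HC; rewrite E mxE eqxx. Qed.

Let C13 m : C i1 i3 0 m = (m == i4)%:R.
Proof. by have [_ _ _ E _] := HC; rewrite E mxE eqxx. Qed.

Let C23 : C i2 i3 0 i4 = 0.
Proof. by have [_ _ _ _ E] := HC. Qed.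

Let jac i j k m : \sum_l C j k 0 l * C i l 0 m =
  \sum_l C i j 0 l * C l k 0 m + \sum_l C i k 0 l * C j l 0 m.
Proof. by have [_ J _ _ _] := HC. Qed.

(** Since [[X1, X2], X3] = [X3, X3] = 0, the Jacobi identity reads [X2, X4] = [X1, [X2, X3]]. *)
Lemma engel_C24 : [/\ C i2 i4 0 i1 = 0, C i2 i4 0 i2 = 0, C i2 i4 0 i3 = T4 & C i2 i4 0 i4 = T2].
Proof.
have J m := jac i1 i2 i3 m.
split; [have := J i1|have := J i2|have := J i3|have := J i4];
  rewrite !sum4 !diag !C12 !C13 !C23 /= /T4 /T2; lra.
Qed.

(** The Jacobi identity reads [X3, X4] = [X1, [X2, X4]] - [X2, [X1, X4]], and the right side is
    known by [engel_C24]. *)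
Lemma engel_C34 : [/\ C i3 i4 0 i1 = a * T2 - T3 * T6, C i3 i4 0 i2 = T2 * T5 - T3 * T4,
  C i3 i4 0 i3 = a - T1 * T4 & C i3 i4 0 i4 = T4].
Proof.
have J m := jac i1 i2 i4 m; have [D1 D2 D3 D4] := engel_C24.
split; [have := J i1|have := J i2|have := J i3|have := J i4];
  rewrite !sum4 !(anti i2 i1) !diag !C12 !C13 ?C23 D1 D2 D3 D4 /= -/a -/T1 -/T2 -/T3 -/T4 -/T5 -/T6;
  lra.
Qed.

(** The first three equations and the fifth are the components along X4, X3, X2 and X1 of the Jacobi
    identity for (1,3,4). The fourth and the sixth are the components along X4 and X1 of the one for
    (2,3,4). *)
Lemma engel_constants_eqs : 
  [/\ 2 * a = T1 * T4, 2 * (T2 * T5) = T1 * (a - T1 * T4) &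
      2 * (T4 * T5) = T1 * (T2 * T5 - T3 * T4)] /\
  [/\ T1 * T6 + 2 * (T2 * T4) = 0, a * T4 = - (T5 * T6) + T1 * (a * T2 - T3 * T6) &
      (a - T1 * T4) * T6 = a * T6 + 2 * (T2 * (a * T2 - T3 * T6))].
Proof.
have [D1 D2 D3 D4] := engel_C24; have [E1 E2 E3 E4] := engel_C34.
have J m := jac i1 i3 i4 m; have K m := jac i2 i3 i4 m.
have S3 := anti i3 i1; have S4 := anti i3 i2; have S5 := anti i4 i3.
have := J i1; have := J i2; have := J i3; have := J i4.
have := K i1; have := K i2; have := K i3; have := K i4.
rewrite !sum4 !(anti i2 i1) !(anti i3 i1) !(anti i3 i2) !diag !C12 !C13 ?C23 D1 D2 D3 D4 E1 E2 E3 E4.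
rewrite /= -/a -/T1 -/T2 -/T3 -/T4 -/T5 -/T6.
by move=> K4 _ _ K1 J4 J3 J2 J1; split; split; lra.
Qed.

End EngelConstants.

Section FrameConstants.
Context {R : realType} {M : manifold4Type R} (S : engel_structure M).
Variables (X : 'I_4 -> vfield R M) (C : 'I_4 -> 'I_4 -> 'rV[R]_4) (p0 : M).
Hypotheses (cX : canonical_frame S X) (CX : structure X C).

Lemma br_delta i j : br C (delta_mx 0 i) (delta_mx 0 j) = C i j.
Proof.
rewrite /br (bigD1 i) //= (bigD1 j) //= !mxE !eqxx mulr1 scale1r !big1 ?addr0 //.
  by move=> k ki; rewrite big1 // => l _; rewrite !mxE (negbTE ki) andbF mul0r scale0r.
by move=> l lj; rewrite !mxE (negbTE lj) andbF mulr0 scale0r.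
Qed.

Lemma br_deltal i b m : br C (delta_mx 0 i) b 0 m = \sum_l b 0 l * C i l 0 m.
Proof.
rewrite /br summxE (bigD1 i) //= [X in _ + X = _]big1 ?addr0.
  by rewrite summxE; apply: eq_bigr => l _; rewrite !mxE !eqxx mul1r.
by move=> k ki; rewrite summxE big1 // => l _; rewrite !mxE (negbTE ki) andbF !mul0r.
Qed.

Lemma br_deltar a j m : br C a (delta_mx 0 j) 0 m = \sum_l a 0 l * C l j 0 m.
Proof.
rewrite /br summxE; apply: eq_bigr => k _; rewrite summxE (bigD1 j) //= [X in _ + X = _]big1 ?addr0.
  by rewrite !mxE !eqxx mulr1.
by move=> l lj; rewrite !mxE (negbTE lj) andbF mulr0 mul0r.
Qed.

Lemma frame_comb_eq a b : comb X a = comb X b -> a = b.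
Proof.
move=> ab; have [_ bX] := canonical_frame_frame cX p0.
by apply: (basis_inj bX); rewrite ab.
Qed.

Lemma canonical_engel_constants : engel_constants C.
Proof.
have fX := canonical_frame_frame cX; have iM : inhabited M by [].
have [_ bX] := fX p0; have [_ _ X3 X4 X23] := cX.
split=> [i j|i j k m|||].
- by rewrite -!br_delta (br_anti _ _ iM fX CX).
- have := congr1 (fun v : 'rV_4 => v 0 m)
    (br_jacobi (delta_mx 0 i) (delta_mx 0 j) (delta_mx 0 k) iM fX CX).
  by rewrite mxE !br_delta br_deltar !br_deltal.
- by apply: frame_comb_eq; rewrite -CX comb_delta.
- by apply: frame_comb_eq; rewrite -CX comb_delta.
(* The row space is the span of the first three basis vectors, and the last column is zero. *)
pose B : 'M[R]_4 := \matrix_i (if i == i4 then 0 else delta_mx 0 i).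
have Bi i : i != i4 -> ((delta_mx 0 i : 'rV[R]_4) <= B)%MS.
  by move=> /negbTE ii4; have := row_sub i B; rewrite rowK ii4.
have [z zB zE] : exists2 z, (z <= B)%MS & lie_bracket (X i2) (X i3) p0 = comb X z p0.
  apply: lspan_comb (X23 p0) => u [[->|->]|->];
    [exists (delta_mx 0 i1 : 'rV_4)|exists (delta_mx 0 i2 : 'rV_4)|exists (delta_mx 0 i3 : 'rV_4)];
    by rewrite ?comb_delta ?Bi.
have -> : C i2 i3 = z by apply: (basis_inj bX); rewrite -zE CX.
have /submxP [y ->] := zB; rewrite mxE big1 // => i _; rewrite !mxE.
by case: ifP => [_|ii4]; rewrite !mxE ?mulr0 // eq_sym ii4 mulr0.
Qed.

Lemma bracket_coefE i j k p : bracket_coef X i j k p = C i j 0 k.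
Proof.
rewrite /bracket_coef; set A := [set a | _].
have AC : A (C i j) by rewrite /A /= CX combE.
have [_ bX] := canonical_frame_frame cX p.
suff -> : get A = C i j by [].
by apply: (basis_inj bX); rewrite [LHS]combE -CX -[LHS](getPex (ex_intro _ _ AC)).
Qed.

Lemma structure_constantsE T1 T2 T3 T4 T5 T6 : structure_constants X T1 T2 T3 T4 T5 T6 <->
  [/\ C i1 i4 0 i4 = T1, C i2 i3 0 i3 = T2 & C i1 i4 0 i3 = T3] /\
  [/\ C i2 i3 0 i2 = T4, C i1 i4 0 i2 = T5 & C i2 i3 0 i1 = T6].
Proof.
split=> [/(_ p0)|H p]; by rewrite !bracket_coefE.
Qed.

Lemma structureE i j : lie_bracket (X i) (X j) =
  C i j 0 i1 *: X i1 + C i j 0 i2 *: X i2 + C i j 0 i3 *: X i3 + C i j 0 i4 *: X i4.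
Proof. by rewrite CX /comb sum4. Qed.

End FrameConstants.

Lemma engel_constants_inj (R : realType) (C C' : 'I_4 -> 'I_4 -> 'rV[R]_4) :
  engel_constants C -> engel_constants C' ->
  [/\ C i1 i4 0 i4 = C' i1 i4 0 i4, C i2 i3 0 i3 = C' i2 i3 0 i3 & C i1 i4 0 i3 = C' i1 i4 0 i3] ->
  [/\ C i2 i3 0 i2 = C' i2 i3 0 i2, C i1 i4 0 i2 = C' i1 i4 0 i2 & C i2 i3 0 i1 = C' i2 i3 0 i1] ->
  C = C'.
Proof.
move=> HC HC' [T1 T2 T3] [T4 T5 T6].
have [[a _ _] _] := engel_constants_eqs HC; have [[a' _ _] _] := engel_constants_eqs HC'.
have aE : C i1 i4 0 i1 = C' i1 i4 0 i1.
  by apply: (mulfI (_ : 2 != 0 :> R)) => //; rewrite a a' T1 T4.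
have [D1 D2 D3 D4] := engel_C24 HC; have [D1' D2' D3' D4'] := engel_C24 HC'.
have [E1 E2 E3 E4] := engel_C34 HC; have [E1' E2' E3' E4'] := engel_C34 HC'.
have [A _ C12 C13 C23] := HC; have [A' _ C12' C13' C23'] := HC'.
have C14E : C i1 i4 = C' i1 i4 by apply/rowP => k; case/ord4_cases: (k) => ->.
have C23E : C i2 i3 = C' i2 i3 by apply/rowP => k; case/ord4_cases: (k) => ->; rewrite ?C23.
have C24E : C i2 i4 = C' i2 i4.
  by apply/rowP => k; case/ord4_cases: (k) => ->; rewrite ?D1 ?D2 ?D3 ?D4 ?D1' ?D2' ?D3' ?D4'.
have C34E : C i3 i4 = C' i3 i4.
  by apply/rowP => k; case/ord4_cases: (k) => ->;
    rewrite ?E1 ?E2 ?E3 ?E4 ?E1' ?E2' ?E3' ?E4' ?T1 ?T2 ?T3 ?T4 ?T5 ?T6 ?aE.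
have diag (D : 'I_4 -> 'I_4 -> 'rV[R]_4) : (forall i j, D i j = - D j i) -> forall i, D i i = 0.
  by move=> AD i; apply/rowP => k; have := congr1 (fun v : 'rV_4 => v 0 k) (AD i i); rewrite !mxE; lra.
apply/funext => i; apply/funext => j.
by case/ord4_cases: (i) => ->; case/ord4_cases: (j) => ->;
  rewrite ?(diag C A) ?(diag C' A') // ?C12 ?C13 ?C12' ?C13' ?C14E ?C23E ?C24E ?C34E //;
  rewrite A A' ?C12 ?C13 ?C12' ?C13' ?C14E ?C23E ?C24E ?C34E.
Qed.

Section Families.
Context {R : realType} {M : manifold4Type R} (S : engel_structure M).
Variable X : 'I_4 -> vfield R M.

Let addE (Y Z : vfield R M) p f : (Y + Z) p f = Y p f + Z p f. Proof. by []. Qed.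
Let oppE (Y : vfield R M) p f : (- Y) p f = - Y p f. Proof. by []. Qed.
Let scaleE t (Y : vfield R M) p f : (t *: Y) p f = t * Y p f. Proof. by []. Qed.
Let zeroE p f : (0 : vfield R M) p f = 0. Proof. by []. Qed.
Let fieldE := (addE, oppE, scaleE, zeroE).

(** Comparing the fields value by value leaves identities between real numbers, within reach of
    [ring] and [field]. *)
Lemma structure_equations_ext B14 B23 B24 B34 B14' B23' B24' B34' :
  structure_equations X B14 B23 B24 B34 ->
  (forall p f, B14 p f = B14' p f) -> (forall p f, B23 p f = B23' p f) ->
  (forall p f, B24 p f = B24' p f) -> (forall p f, B34 p f = B34' p f) ->
  structure_equations X B14' B23' B24' B34'.
Proof.
by move=> [H1 H2 [H3 H4 H5 H6]] K1 K2 K3 K4; split; [| |split]; rewrite ?H1 ?H2 ?H3 ?H4 ?H5 ?H6 //;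
  apply/funext => p; apply/funext => f.
Qed.

Lemma engel_families (a T1 T2 T3 T4 T5 T6 : R) :
  structure_equations X
    (a *: X i1 + T5 *: X i2 + T3 *: X i3 + T1 *: X i4)
    (T6 *: X i1 + T4 *: X i2 + T2 *: X i3)
    (T4 *: X i3 + T2 *: X i4)
    ((a * T2 - T3 * T6) *: X i1 + (T2 * T5 - T3 * T4) *: X i2 + (a - T1 * T4) *: X i3 + T4 *: X i4) ->
  2 * a = T1 * T4 -> 2 * (T2 * T5) = T1 * (a - T1 * T4) ->
  2 * (T4 * T5) = T1 * (T2 * T5 - T3 * T4) -> T1 * T6 + 2 * (T2 * T4) = 0 ->
  a * T4 = - (T5 * T6) + T1 * (a * T2 - T3 * T6) ->
  (a - T1 * T4) * T6 = a * T6 + 2 * (T2 * (a * T2 - T3 * T6)) ->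
  family_I X T1 T2 T3 T4 T5 T6 \/ family_II X T1 T2 T3 T4 T5 T6 \/
  family_III X T1 T2 T3 T4 T5 T6 \/ family_IV X T1 T2 T3 T4 T5 T6 \/
  family_V X T1 T2 T3 T4 T5 T6.
Proof.
move=> H E1 E2 E3 E4 E5 E6.
have aE : a = 2^-1 * (T1 * T4) by rewrite -E1; field.
have aE0 : T1 * T4 = 0 -> a = 0 by move=> T0; rewrite aE T0 mulr0.
have [[[T20 T40 T60]|[T40 T50 T60]|[T10 T20 T50]|[T10 T30 T40 T50]]|[T1n0 T4E T5E T6E]] :=
  engel_jacobi_cases E1 E2 E3 E4 E5 E6.
- left; have a0 : a = 0 by apply: aE0; rewrite T40 mulr0.
  by split=> //; apply: structure_equations_ext H _ _ _ _ => p f; rewrite !fieldE ?a0 ?T20 ?T40 ?T60; ring.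
- right; left; have a0 : a = 0 by apply: aE0; rewrite T40 mulr0.
  by split=> //; apply: structure_equations_ext H _ _ _ _ => p f; rewrite !fieldE ?a0 ?T40 ?T50 ?T60; ring.
- do 2 right; left; have a0 : a = 0 by apply: aE0; rewrite T10 mul0r.
  by split=> //; apply: structure_equations_ext H _ _ _ _ => p f; rewrite !fieldE ?a0 ?T10 ?T20 ?T50; ring.
- do 3 right; left; have a0 : a = 0 by apply: aE0; rewrite T10 mul0r.
  by split=> //; apply: structure_equations_ext H _ _ _ _ => p f; rewrite !fieldE ?a0 ?T10 ?T30 ?T40 ?T50; ring.
do 4 right; split=> //.
by apply: structure_equations_ext H _ _ _ _ => p f; rewrite !fieldE ?aE ?T6E ?T4E ?T5E; field.
Qed.

End Families.

Lemma canonical_frame_families (R : realType) (M : manifold4Type R) (S : engel_structure M)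
    (X : 'I_4 -> vfield R M) C : inhabited M -> canonical_frame S X -> structure X C ->
  exists T1 T2 T3 T4 T5 T6 : R, structure_constants X T1 T2 T3 T4 T5 T6 /\
  (family_I X T1 T2 T3 T4 T5 T6 \/ family_II X T1 T2 T3 T4 T5 T6 \/
   family_III X T1 T2 T3 T4 T5 T6 \/ family_IV X T1 T2 T3 T4 T5 T6 \/
   family_V X T1 T2 T3 T4 T5 T6).
Proof.
move=> [p0] cX CX.
have HC := canonical_engel_constants p0 cX CX.
exists (C i1 i4 0 i4), (C i2 i3 0 i3), (C i1 i4 0 i3), (C i2 i3 0 i2), (C i1 i4 0 i2), (C i2 i3 0 i1).
split; first by apply/(structure_constantsE p0 cX CX).
have [D1 D2 D3 D4] := engel_C24 HC; have [E1 E2 E3 E4] := engel_C34 HC.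
have [[a1 a2 a3] [a4 a5 a6]] := engel_constants_eqs HC.
have [_ _ _ _ C23] := HC; have [_ _ X3 X4 _] := cX.
apply: engel_families a1 a2 a3 a4 a5 a6; split; [by []|by []|split].
- exact: structureE.
- by rewrite (structureE CX) C23 scale0r addr0.
- by rewrite (structureE CX) D1 D2 D3 D4 !scale0r !add0r.
by rewrite (structureE CX) E1 E2 E3 E4.
Qed.

Lemma same_constants_locally_isometric (R : realType) (G G' : lieGroup4Type R)
    (S : engel_structure G) (S' : engel_structure G') X X' T1 T2 T3 T4 T5 T6 :
  canonical_frame S X -> left_invariant_frame X ->
  canonical_frame S' X' -> left_invariant_frame X' ->
  structure_constants X T1 T2 T3 T4 T5 T6 -> structure_constants X' T1 T2 T3 T4 T5 T6 ->
  locally_isometric S S'.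
Proof.
move=> cX lX cX' lX' TX TX'.
have [C CX] := structure_exists (canonical_frame_frame cX) lX.
have [C' CX'] := structure_exists (canonical_frame_frame cX') lX'.
have /(structure_constantsE 1%g cX CX) [[t1 t2 t3] [t4 t5 t6]] := TX.
have /(structure_constantsE 1%g cX' CX') [[t1' t2' t3'] [t4' t5' t6']] := TX'.
have CC' : C = C'.
  apply: engel_constants_inj; [exact: canonical_engel_constants 1%g cX CX|
    exact: canonical_engel_constants 1%g cX' CX'| |];
    by rewrite ?t1 ?t2 ?t3 ?t4 ?t5 ?t6 ?t1' ?t2' ?t3' ?t4' ?t5' ?t6'.
subst C'; exact: canonical_locally_isometric cX lX CX cX' lX' CX'.
Qed.

(** * Existence of the canonical frame *)

Section SpanRows.
Context {F : fieldType} {n : nat}.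
Implicit Types (u v w z : 'rV[F]_n).

Lemma sub_adds_rV m (A : 'M[F]_(m, n)) w z :
  (z <= A + w)%MS <-> exists (y : 'rV[F]_n) (t : F), (y <= A)%MS /\ z = y + t *: w.
Proof.
split=> [/sub_addsmxP [[a b] /= ->]|[y [t [yA ->]]]].
  exists (a *m A), (b 0 0); split; first exact: submxMl.
  by rewrite {1}[b]mx11_scalar mul_scalar_mx.
by rewrite addmx_sub_adds // scalemx_sub.
Qed.

Lemma sub_adds2 u w z : (z <= u + w)%MS <-> exists s t : F, z = s *: u + t *: w.
Proof.
split=> [/sub_adds_rV [y [t [/sub_rVP [s ->] ->]]]|[s [t ->]]]; first by exists s, t.
by apply/sub_adds_rV; exists (s *: u), t; rewrite scalemx_sub.
Qed.

(** The rank leaves room for a nonzero column annihilated by [A]; its kernel contains the row space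
    and has the same rank. *)
Lemma hyperplane_functional (A : 'M[F]_(n, n)) : (\rank A).+1 = n ->
  exists c : 'cV[F]_n, forall z, (z <= A)%MS = (z *m c == 0).
Proof.
move=> rA; have /rowV0Pn [v /sub_kermxP vA v0] : kermx A^T != 0.
  by rewrite -mxrank_eq0 mxrank_ker mxrank_tr -{1}rA subSnn.
have Ac : A *m v^T = 0 by rewrite -[A]trmxK -trmx_mul vA trmx0.
have Asub : (A <= kermx v^T)%MS by apply/sub_kermxP.
have rv : \rank v^T = 1%N by rewrite mxrank_tr rank_rV v0.
have eqA : (kermx v^T <= A)%MS.
  by rewrite -(geq_leqif (mxrank_leqif_sup Asub)) mxrank_ker rv -{1}rA subn1.
exists v^T => z; apply/idP/eqP => [zA|/sub_kermxP zv]; last exact: submx_trans eqA.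
by apply/sub_kermxP; exact: submx_trans Asub.
Qed.

End SpanRows.

Section AdaptedBasis.
Context {R : realType} (C : 'I_4 -> 'I_4 -> 'rV[R]_4).
Hypothesis anti : forall a b, br C a b = - br C b a.
Implicit Types a b w : 'rV[R]_4.

Definition flag_basis w1 w2 (i : 'I_4) : 'rV[R]_4 :=
  nth 0 [:: w1; w2; br C w1 w2; br C w1 (br C w1 w2)] i.

Lemma br_diag a : br C a a = 0.
Proof.
have := anti a a; move/eqP; rewrite -addr_eq0 => /eqP H.
by apply/rowP => k; have := congr1 (fun v : 'rV_4 => v 0 k) H; rewrite !mxE; lra.
Qed.

Lemma brZl (t : R) a b : br C (t *: a) b = t *: br C a b.
Proof.
rewrite -[t *: a]addr0 br_linl [X in _ + X = _]big1 ?addr0 // => i _.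
by rewrite big1 // => j _; rewrite mxE mul0r scale0r.
Qed.

(** On a plane the bracket is a determinant times [w1, w2]; in particular a rotation of the pair
    does not change it. *)
Lemma br_span2 (s t s' t' : R) w1 w2 :
  br C (s *: w1 + t *: w2) (s' *: w1 + t' *: w2) = (s * t' - t * s') *: br C w1 w2.
Proof.
have brZr (x : R) a b : br C a (x *: b) = x *: br C a b by rewrite anti brZl anti scalerN opprK.
rewrite br_linl !br_linr !brZl !brZr !br_diag !scaler0 add0r addr0 (anti w2 w1) !scalerN !scalerA.
by rewrite -scaleNr -scalerDl; congr (_ *: _); ring.
Qed.

(** Let [l] be a functional with kernel [W]. The map sending [z] to the value of [l] on [z, w3] is a
    nonzero linear form on the plane of [w1] and [w2], with coordinates [al] and [be]. Its
    normalized gradient is [u1], and [u2] is a unit vector in its kernel; [w3] is the same for both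
    pairs. *)
Lemma flag_rotation w1 w2 (W := (w1 + w2 + br C w1 w2)%MS) : \rank W = 3%N ->
  ~~ ((br C w1 (br C w1 w2) <= W) && (br C w2 (br C w1 w2) <= W))%MS ->
  exists c d : R, let u1 := c *: w1 + d *: w2 in let u2 := - d *: w1 + c *: w2 in
  [/\ c ^+ 2 + d ^+ 2 = 1,
      row_free (\matrix_i flag_basis u1 u2 i)
    & exists s t r : R, br C u2 (br C u1 u2) = s *: u1 + t *: u2 + r *: br C u1 u2].
Proof.
move=> rW nW; set w3 := br C w1 w2 in W rW nW *.
have [l lP] : exists l : 'cV[R]_4, forall z : 'rV[R]_4, (z <= W)%MS = (z *m l == 0).
  by apply: (@hyperplane_functional _ 4 W); rewrite rW.
pose al := (br C w1 w3 *m l) 0 0; pose be := (br C w2 w3 *m l) 0 0.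
have inW (z : 'rV[R]_4) : (z <= W)%MS = ((z *m l) 0 0 == 0).
  rewrite lP; apply/eqP/eqP => [->|z0]; first by rewrite mxE.
  by apply/rowP => k; rewrite (ord1 k) z0 mxE.
have r0 : 0 < al ^+ 2 + be ^+ 2.
  rewrite lt_def addr_ge0 ?sqr_ge0 // andbT paddr_eq0 ?sqr_ge0 // !sqrf_eq0.
  by move: nW; rewrite !inW.
pose r := Num.sqrt (al ^+ 2 + be ^+ 2); have rgt0 : 0 < r by rewrite sqrtr_gt0.
have r2 : r ^+ 2 = al ^+ 2 + be ^+ 2 by rewrite sqr_sqrtr // ltW.
have rn0 : r != 0 by rewrite gt_eqF.
exists (al / r), (be / r); set c := al / r; set d := be / r.
move=> u1 u2.
have cd : c ^+ 2 + d ^+ 2 = 1 by rewrite !expr_div_n -mulrDl -r2 divff // expf_neq0.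
have u3 : br C u1 u2 = w3.
  by rewrite br_span2 -[RHS]scale1r -cd; congr (_ *: _); ring.
have w1E : w1 = c *: u1 + - d *: u2.
  rewrite /u1 /u2 -{1}[w1]scale1r -cd.
  by apply/rowP => k; rewrite !mxE; ring.
have w2E : w2 = d *: u1 + c *: u2.
  rewrite /u1 /u2 -{1}[w2]scale1r -cd.
  by apply/rowP => k; rewrite !mxE; ring.
have brl (s t : R) : br C (s *: w1 + t *: w2) w3 *m l = (s * al + t * be)%:M.
  rewrite br_linl brZl mulmxDl -!scalemxAl; apply/rowP => k; rewrite (ord1 k) !mxE /=.
  by rewrite mulr1n /al /be !mxE.
split=> //.
  set A := \matrix_i _.
  have rowA i : (flag_basis u1 u2 i <= A)%MS by have := row_sub i A; rewrite rowK.
  have WA : (W <= A)%MS.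
    rewrite !addsmx_sub {1}w1E {1}w2E -u3 (rowA i3) andbT.
    by rewrite !addmx_sub ?scalemx_sub ?(rowA i1) ?(rowA i2).
  (* The functional takes the nonzero value [r] on [u1, w3], so the fourth vector leaves the
     hyperplane and the rank rises to 4. *)
  have AW : ~~ (A <= W)%MS.
    apply/negP => AW; have := submx_trans (rowA i4) AW; rewrite inW /flag_basis /= u3 brl !mxE /= mulr1n.
    have -> : c * al + d * be = r.
      by rewrite /c /d -!mulrA ![r^-1 * _]mulrC !mulrA -mulrDl -!expr2 -r2 expr2 mulfK.
    by rewrite (negbTE rn0).
  have : (\rank W < \rank A)%N by apply: rank_ltmx; rewrite ltmxE WA.
  by rewrite rW /row_free eqn_leq rank_leq_row.
have : (br C u2 w3 <= W)%MS.
  by rewrite inW brl !mxE /= mulr1n /c /d; apply/eqP; ring.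
move=> /sub_adds_rV [y [t [/sub_adds2 [s [s' ->]] E]]].
exists (s * c + s' * d), (- s * d + s' * c), t; rewrite u3 E; congr (_ + _).
rewrite {1}w1E {1}w2E; clearbody u1 u2; apply/rowP => k; rewrite !mxE; ring.
Qed.
End AdaptedBasis.

Section CanonicalFrameExistence.
Context {R : realType} {G : lieGroup4Type R} (S : engel_structure G).
Hypothesis liS : left_invariant S.

Lemma comb_translate (Y : 'I_4 -> vfield R G) a p : left_invariant_frame Y ->
  comb Y a p = tangent_map (left_translation p) 1%g (comb Y a 1%g).
Proof.
move=> lY; rewrite !combE tangent_map_lin; apply: eq_bigr => k _.
by rewrite -lY /left_translation mulg1.
Qed.

(** An orthonormal pair is chosen at 1 only. Left invariance of the distribution, of the metric and
    of [Y] makes the same constant coordinates work at every point. *)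
Lemma orthonormal_sections (Y : 'I_4 -> vfield R G) : frame Y -> left_invariant_frame Y ->
  exists w1 w2 : 'rV[R]_4,
  [/\ forall p v, engel_dist S p v <-> exists s t : R, v = comb Y (s *: w1 + t *: w2) p
    & forall p (s t s' t' : R), engel_metric S p (comb Y (s *: w1 + t *: w2) p)
        (comb Y (s' *: w1 + t' *: w2) p) = s * s' + t * t'].
Proof.
move=> fY lY.
have [E /nbhs_singleton [sE [iE DE]]] := edist_rank2 S (1%g : G).
have [u uE] := frame_decomp fY (sE ord0).1.
have [w wE] := frame_decomp fY (sE (lift ord0 ord0)).1.
have D1E v : engel_dist S 1%g v <-> exists s t : R, v = s *: comb Y u 1%g + t *: comb Y w 1%g.
  rewrite DE -uE -wE; split=> [[a ->]|[s [t ->]]].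
    by exists (a ord0), (a (lift ord0 ord0)); rewrite !big_ord_recl big_ord0 addr0.
  exists (fun i => if i == ord0 then s else t).
  by rewrite !big_ord_recl big_ord0 addr0.
have ind (s t : R) : s *: comb Y u 1%g + t *: comb Y w 1%g = 0 -> s = 0 /\ t = 0.
  rewrite -uE -wE => st0; have := iE (fun i => if i == ord0 then s else t).
  rewrite !big_ord_recl big_ord0 addr0 => /(_ st0) H.
  by have := H ord0; have := H (lift ord0 ord0).
have [sym lin pos _] := emetricP S.
have D0 : engel_dist S (1%g : G) 0 by apply/D1E; exists 0, 0; rewrite !scale0r addr0.
have Dlin (a : R) v v' : engel_dist S (1%g : G) v -> engel_dist S (1%g : G) v' ->
    engel_dist S (1%g : G) (a *: v + v').
  move=> /D1E [s [t ->]] /D1E [s' [t' ->]]; apply/D1E; exists (a * s + s'), (a * t + t').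
  by rewrite !scalerDl scalerDr !scalerA addrACA.
have [e1 [e2 [DeE m11 m22 m12]]] := orthonormal_pair D0 Dlin (@sym 1%g) (@lin 1%g) (@pos 1%g) ind D1E.
have De1 : engel_dist S (1%g : G) e1 by apply/DeE; exists 1, 0; rewrite scale1r scale0r addr0.
have De2 : engel_dist S (1%g : G) e2 by apply/DeE; exists 0, 1; rewrite scale1r scale0r add0r.
have dec e : engel_dist S (1%g : G) e -> exists w, e = comb Y w 1%g.
  by move=> /D1E [s [t ->]]; exists (s *: u + t *: w); rewrite comb_lin combZ.
have [w1 e1E] := dec _ De1; have [w2 e2E] := dec _ De2.
have combst (s t : R) : s *: e1 + t *: e2 = comb Y (s *: w1 + t *: w2) 1%g.
  by rewrite comb_lin combZ e1E e2E.
have DpE p : engel_dist S p = tangent_map (left_translation p) 1%g @` engel_dist S 1%g.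
  by have [] := liS p 1%g; rewrite /left_translation mulg1.
exists w1, w2; split=> [p v|p s t s' t'].
  rewrite DpE; split=> [[_ /DeE [s [t ->]] <-]|[s [t ->]]].
    by exists s, t; rewrite combst -comb_translate.
  exists (s *: e1 + t *: e2); first by apply/DeE; exists s, t.
  by rewrite combst -comb_translate.
have [_] := liS p 1%g; rewrite {1}/left_translation mulg1 => iso.
have Dst (a b : R) : engel_dist S (1%g : G) (comb Y (a *: w1 + b *: w2) 1%g).
  by rewrite -combst; apply/DeE; exists a, b.
rewrite !(comb_translate _ p lY) iso // -!combst.
exact: (metric_orthonormal D0 Dlin (@sym 1%g) (@lin 1%g)).
Qed.

(** All values of the derived family lie in [W], so the first rank condition bounds the rank of [W]
    from below, while its three generators bound it from above. *)
Lemma engel_flag (Y : 'I_4 -> vfield R G) C w1 w2 (W := (w1 + w2 + br C w1 w2)%MS) :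
  frame Y -> structure Y C ->
  (forall p v, engel_dist S p v -> exists s t : R, v = comb Y (s *: w1 + t *: w2) p) ->
  \rank W = 3%N /\
  ~~ ((br C w1 (br C w1 w2) <= W) && (br C w2 (br C w1 w2) <= W))%MS.
Proof.
move=> fY CY DE; set w3 := br C w1 w2 in W *.
have iG : inhabited G by exact: (inhabits 1%g).
have anti a b : br C a b = - br C b a by exact: br_anti fY CY.
have DW p v : engel_dist S p v -> exists2 a, (a <= w1 + w2)%MS & v = comb Y a p.
  by move=> /DE [s [t ->]]; exists (s *: w1 + t *: w2) => //; apply/sub_adds2; exists s, t.
have w12W : (w1 + w2 <= W)%MS by exact: addsmxSl.
have D'W p v : bracket_family (engel_dist S) (engel_dist S) p v ->
    exists2 a, (a <= W)%MS & v = comb Y a p.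
  apply: (bracket_family_sub fY CY DW DW w12W w12W) => a b.
  move=> /sub_adds2 [s [t ->]] /sub_adds2 [s' [t' ->]].
  by rewrite br_span2 // scalemx_sub // addsmxSr.
have rW3 : (3 <= \rank W)%N := dim_le_rank (ederived_rank3 S 1%g) (D'W 1%g).
have rW : \rank W = 3%N.
  apply/eqP; rewrite eqn_leq rW3 andbT.
  apply: leq_trans (mxrank_adds_leqif _ _).1 _.
  apply: (@leq_trans (1 + 1 + 1)%N) => //; apply: leq_add (rank_leq_row _).
  apply: leq_trans (mxrank_adds_leqif _ _).1 _.
  by apply: leq_add; exact: rank_leq_row.
split=> //; apply/negP => /andP [W1 W2].
(* If both brackets with [w3] stayed in [W], the second derived family would too, and its dimension
   would be at most 3. *)
have D''W p v : bracket_family (engel_dist S) (bracket_family (engel_dist S) (engel_dist S)) p v ->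
    exists2 a, (a <= W)%MS & v = comb Y a p.
  apply: (bracket_family_sub fY CY DW D'W w12W (submx_refl W)) => a b.
  move=> /sub_adds2 [s [t ->]] /sub_adds_rV [y [r [/sub_adds2 [s' [t' ->]] ->]]].
  rewrite [_ + r *: _]addrC br_linr br_span2 // addmx_sub ?scalemx_sub ?addsmxSr //.
  by rewrite br_linl brZl addmx_sub ?scalemx_sub.
by have := dim_le_rank (ederived_rank4 S 1%g) (D''W 1%g); rewrite rW.
Qed.

Lemma canonical_frame_exists : exists X, canonical_frame S X /\ left_invariant_frame X.
Proof.
have [Y [fY lY]] := @left_invariant_frame_exists R G.
have [C CY] := structure_exists fY lY.
have [w1 [w2 [DE mE]]] := orthonormal_sections fY lY.
have iG : inhabited G by exact: (inhabits 1%g).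
have anti a b : br C a b = - br C b a by exact: br_anti fY CY.
have [rW nW] := engel_flag fY CY (fun p v => (DE p v).1).
have [c [d [cd free [s0 [t0 [r0 u23]]]]]] := flag_rotation anti rW nW.
set u1 := c *: w1 + d *: w2 in free u23; set u2 := - d *: w1 + c *: w2 in free u23.
pose U := flag_basis C u1 u2; exists (fun i => comb Y (U i)).
have XE a : comb (fun i => comb Y (U i)) a = comb Y (a *m \matrix_i U i).
  rewrite mulmx_sum_row comb_sum; apply: eq_bigr => i _.
  by rewrite rowK.
have u12 (s t : R) : s *: u1 + t *: u2 = (s * c - t * d) *: w1 + (s * d + t * c) *: w2.
  by apply/rowP => k; rewrite !mxE; ring.
have Xst p (s t : R) : s *: comb Y (U i1) p + t *: comb Y (U i2) p =
    comb Y ((s * c - t * d) *: w1 + (s * d + t * c) *: w2) p.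
  by rewrite -u12 comb_lin combZ.
have tY := frame_tangent fY.
split; last first.
  move=> i a p; rewrite !combE tangent_map_lin.
  by apply: eq_bigr => k _; rewrite lY.
split=> [p|p|||p].
- split=> [i|]; first exact: comb_smooth.
  apply: (@indep_basis _ _ (fun i => comb Y (U i))) => [i|a]; first by rewrite combE; exact: tangent_sum.
  have [_ bY] := fY p.
  rewrite XE => /(basis_indep bY) a0.
  by apply: (row_free_inj free); rewrite a0 mul0mx.
- have X1E : comb Y (U i1) p = comb Y (c *: w1 + d *: w2) p by [].
  have X2E : comb Y (U i2) p = comb Y (- d *: w1 + c *: w2) p by [].
  split; [|by rewrite X1E mE -cd; ring|by rewrite X2E mE -cd; ring|by rewrite X1E X2E mE; ring].
  apply/seteqP; split=> [v /DE [s [t ->]]|v /lspan2P [s [t ->]]].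
    (* Coordinates in the rotated pair, given by the transposed rotation. *)
    apply/lspan2P; exists (s * c + t * d), (- s * d + t * c); rewrite Xst; congr (comb Y _ p).
    have {1}-> : s = s * (c ^+ 2 + d ^+ 2) by rewrite cd mulr1.
    have {1}-> : t = t * (c ^+ 2 + d ^+ 2) by rewrite cd mulr1.
    by congr (_ *: _ + _ *: _); ring.
  by apply/DE; rewrite Xst; exists (s * c - t * d), (s * d + t * c).
- by rewrite (lie_bracket_comb _ _ fY CY).
- by rewrite (lie_bracket_comb _ _ fY CY).
rewrite (lie_bracket_comb _ _ fY CY) /= [br _ _ _]u23.
exists 3, (fun i : 'I_3 => nth 0 [:: s0; t0; r0] i),
  (fun i : 'I_3 => nth 0 [:: comb Y (U i1) p; comb Y (U i2) p; comb Y (U i3) p] i); split.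
  by case=> [[|[|[|k]]]] //= _; [left; left|left; right|right].
by rewrite !big_ord_recl big_ord0 /= addr0 combD comb_lin !combZ -addrA.
Qed.

End CanonicalFrameExistence.

Theorem theorem2 (R : realType) :
  (forall (G : lieGroup4Type R) (S : engel_structure G), left_invariant S ->
     (exists X, canonical_frame S X /\ left_invariant_frame X) /\
     (forall X, canonical_frame S X -> left_invariant_frame X ->
        exists T1 T2 T3 T4 T5 T6 : R,
          structure_constants X T1 T2 T3 T4 T5 T6 /\
          (family_I X T1 T2 T3 T4 T5 T6 \/
           family_II X T1 T2 T3 T4 T5 T6 \/
           family_III X T1 T2 T3 T4 T5 T6 \/
           family_IV X T1 T2 T3 T4 T5 T6 \/
           family_V X T1 T2 T3 T4 T5 T6)))
  /\
  (forall (G G' : lieGroup4Type R)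
     (S : engel_structure G) (S' : engel_structure G'),
     left_invariant S -> left_invariant S' ->
     forall (X : 'I_4 -> vfield R G) (X' : 'I_4 -> vfield R G'),
     canonical_frame S X -> left_invariant_frame X ->
     canonical_frame S' X' -> left_invariant_frame X' ->
     forall T1 T2 T3 T4 T5 T6 : R,
       structure_constants X T1 T2 T3 T4 T5 T6 ->
       structure_constants X' T1 T2 T3 T4 T5 T6 ->
       locally_isometric S S').
Proof.
split=> [G S liS|G G' S S' liS liS' X X' cX lX cX' lX' T1 T2 T3 T4 T5 T6 TX TX'].
  split=> [|X cX lX]; first exact: canonical_frame_exists.
  have [C CX] := structure_exists (canonical_frame_frame cX) lX.
  exact: canonical_frame_families (inhabits 1%g) cX CX.
exact: same_constants_locally_isometric cX lX cX' lX' TX TX'.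
Qed.
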